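(* The constructions $G\mapsto C^*(G)$ (groupoid $C^*$-algebra) and $[\varphi,\psi]\mapsto\pi_\psi\circ\sigma_\varphi$ (for proper couple morphisms $[\varphi,\psi]=[\varphi,\psi;K]\colon G\to H$) form a functor from the category $\mathbf{EG_{lcH}}$ of étale groupoids with locally compact Hausdorff unit spaces and proper couple morphisms to the category $\mathbf{C^*_{alg}}$ of $C^*$-algebras and $*$-homomorphisms.
   Context: The category $\mathbf{EG_{lcH}}$. A groupoid $G$ has unit space $G^{(0)}\subset G$, domain and range maps $d,r$; $g'g$ is defined iff $d(g')=r(g)$; $G_u:=d^{-1}(u)$. A topological groupoid (continuous multiplication and inversion) is étale if $d\colon G\to G^{(0)}$ is a local homeomorphism; $G$ itself is not assumed Hausdorff. For a groupoid homomorphism $\varphi\colon G\to H$, $\varphi^{(0)}\colon G^{(0)}\to H^{(0)}$ and $\varphi_u\colon G_u\to H_{\varphi(u)}$ are its restrictions; $\varphi$ is fibrewise bijective if all $\varphi_u$ are bijective. A couple morphism $(\varphi,\psi;K)\colon G\to H$ of étale groupoids consists of an étale groupoid $K$, a continuous fibrewise bijective homomorphism $\varphi\colon K\to G$ and a continuous homomorphism $\psi\colon K\to H$ with $\psi^{(0)}$ open and injective. $(\varphi_1,\psi_1;K_1)$ and $(\varphi_2,\psi_2;K_2)$ are equivalent if there is a homeomorphic groupoid isomorphism $\iota\colon K_1\to K_2$ with $\varphi_2\circ\iota=\varphi_1$, $\psi_2\circ\iota=\psi_1$; $[\varphi,\psi;K]$ (or $[\varphi,\psi]$) is the equivalence class.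 It is proper if $\varphi^{(0)}$ is proper (preimages of compact sets are compact). Composition of $[\varphi_1,\psi_1;K_1]\colon G_1\to G_2$ and $[\varphi_2,\psi_2;K_2]\colon G_2\to G_3$ is $[\varphi_1\circ\widetilde{\varphi_2},\psi_2\circ\widetilde{\psi_1};K_1\times_{G_2}K_2]$, with $K_1\times_{G_2}K_2=\{(k_1,k_2):\psi_1(k_1)=\varphi_2(k_2)\}$ (component-wise structure, topology from the product), $\widetilde{\varphi_2}(k_1,k_2)=k_1$, $\widetilde{\psi_1}(k_1,k_2)=k_2$; identities $[\mathrm{id}_G,\mathrm{id}_G;G]$. Objects of $\mathbf{EG_{lcH}}$ are étale groupoids with locally compact Hausdorff unit space, morphisms are (equivalence classes of) proper couple morphisms. Groupoid $C^*$-algebras. Let $G$ be étale with $G^{(0)}$ locally compact Hausdorff. For an open Hausdorff subset $U\subset G$, $C_c(U)$ is the space of compactly supported continuous functions $U\to\mathbb C$, extended by zero to functions on $G$. $Q(G)$ is the linear span of $\bigcup_UC_c(U)$ over all open Hausdorff $U$ in the space of functions $G\to\mathbb C$. It is a $*$-algebra with $(f_1*f_2)(g)=\sum_{g_1g_2=g}f_1(g_1)f_2(g_2)$ and $f^*(g)=\overline{f(g^{-1})}$. $C^*(G)$ is the unique $C^*$-algebra containing $Q(G)$ as a dense $*$-subalgebra such that every $*$-homomorphism from $Q(G)$ to a $C^*$-algebra extends uniquely to a $*$-homomorphism on $C^*(G)$. For a proper couple morphism $(\varphi,\psi;K)\colon G\to H$ between such groupoids ($K^{(0)}$ is then also locally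 compact Hausdorff): $\sigma_\varphi\colon C^*(G)\to C^*(K)$ is the $*$-homomorphism extending $Q(G)\to Q(K)$, $f\mapsto f\circ\varphi$; $\pi_\psi\colon C^*(K)\to C^*(H)$ is the $*$-homomorphism extending $Q(K)\to Q(H)$, $\pi_\psi(f)(h)=\sum_{k\in K,\ \psi(k)=h}f(k)$. *)

(* Defs.v *)
From HB Require Import structures.
From mathcomp Require Import all_boot all_order all_algebra.
From mathcomp Require Import all_classical all_reals all_analysis.
From mathcomp Require Import complex.

Set Implicit Arguments.
Unset Strict Implicit.
Unset Printing Implicit Defensive.

Import Order.TTheory GRing.Theory Num.Theory numFieldNormedType.Exports.

Local Open Scope classical_set_scope.
Local Open Scope ring_scope.

Lemma open_subtypeP (X : topologicalType) (A : set X) (W : set A) :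
  open W <-> exists2 V : set X, open V & W = val @^-1` V.
Proof. by split=> [[V oV <-]|[V oV ->]]; exists V. Qed.

Lemma nbhs_subtypeP (X : topologicalType) (A : set X) (a : A) (W : set A) :
  nbhs a W <-> exists2 V : set X, nbhs (val a) V & val @^-1` V `<=` W.
Proof.
split=> [aW|[V aV VW]].
  have /open_subtypeP[V oV VE] : open W^° by exact: open_interior.
  exists V; last by rewrite -VE => z; exact: nbhs_singleton.
  apply: open_nbhs_nbhs; split=> //.
  by have : W^° a by []; rewrite VE.
by apply: (filterS VW); exact: (@initial_continuous A X val a V aV).
Qed.

Lemma val_continuous (X : topologicalType) (A : set X) :
  continuous (val : A -> X).
Proof. exact: initial_continuous. Qed.

Lemma continuous_subtype (X Y : topologicalType) (A : set X) (f : Y -> A) :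
  continuous (val \o f) -> continuous f.
Proof.
move=> cf y W /nbhs_subtypeP[V fV VW].
have fyV : nbhs y ((val \o f) @^-1` V) := cf y V fV.
have fVW : (val \o f) @^-1` V `<=` f @^-1` W by move=> z; exact: VW.
exact: (filterS fVW fyV).
Qed.

Lemma continuous_pair (X Y Z : topologicalType) (f : Z -> X) (g : Z -> Y) :
  continuous f -> continuous g -> continuous (fun z => (f z, g z)).
Proof. by move=> cf cg z; apply: cvg_pair; [exact: cf|exact: cg]. Qed.

Lemma continuous_fst (X Y : topologicalType) : continuous (@fst X Y).
Proof.
move=> z A zA; exists (A, setT); first by split=> //; exact: filterT.
by move=> w [].
Qed.

Lemma continuous_snd (X Y : topologicalType) : continuous (@snd X Y).
Proof.
move=> z A zA; exists (setT, A); first by split=> //; exact: filterT.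
by move=> w [].
Qed.

Lemma continuous_comp_fun (X Y Z : topologicalType) (f : X -> Y) (g : Y -> Z) :
  continuous f -> continuous g -> continuous (fun x => g (f x)).
Proof. by move=> cf cg x; apply: continuous_comp; [exact: cf|exact: cg]. Qed.

Definition homeomorphism (X Y : topologicalType) (f : X -> Y) : Prop :=
  exists g : Y -> X,
    [/\ cancel f g, cancel g f, continuous f & continuous g].

Definition local_homeomorphism (X Y : topologicalType) (f : X -> Y) : Prop :=
  forall x : X, exists (U : set X) (V : set Y),
    [/\ open U, U x, open V &
        exists h : U -> V, homeomorphism h /\
          forall u : U, val (h u) = f (val u)].

Definition open_map (X Y : topologicalType) (f : X -> Y) : Prop :=
  forall U : set X, open U -> open (f @` U).

Definition proper_map (X Y : topologicalType) (f : X -> Y) : Prop :=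
  forall C : set Y, compact C -> compact (f @^-1` C).

Definition open_chart (X Y : topologicalType) (f : X -> Y) (U : set X) :=
  [/\ open U, set_inj U f & forall W, open W -> W `<=` U -> open (f @` W)].

Lemma local_homeoW (X Y : topologicalType) (f : X -> Y) :
  local_homeomorphism f ->
  continuous f /\ forall x, exists2 U, open_chart f U & U x.
Proof.
move=> lf; split=> [x|x]; have [U [V [oU Ux oV]]] := lf x.
  move=> [h [[g [hK gK ch cg]] hE]] N fxN.
  have cvh : continuous (val \o h : U -> Y).
    by apply: continuous_comp_fun => //; exact: val_continuous.
  pose u : U := exist _ x (mem_set Ux).
  have : nbhs u ((val \o h) @^-1` N) by apply: cvh; rewrite /= hE.
  move=> /nbhs_subtypeP[M xM MN]; apply: filterS (filterI xM (open_nbhs_nbhs (conj oU Ux))).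
  move=> y [My Uy]; have := MN (exist _ y (mem_set Uy)) My.
  by rewrite /= hE.
move=> [h [[g [hK gK ch cg]] hE]]; exists U => //; split=> //.
  move=> a b /set_mem Ua /set_mem Ub fab.
  pose a' : U := exist _ a (mem_set Ua); pose b' : U := exist _ b (mem_set Ub).
  have: h a' = h b' by apply: val_inj; rewrite /= !hE.
  by move=> /(can_inj hK) /(congr1 val).
move=> W oW WU.
have oW' : open (g @^-1` ((val : U -> X) @^-1` W)).
  by apply: open_comp => [? _|]; [exact: cg|apply/open_subtypeP; exists W].
have [M oM ME] := (open_subtypeP _).1 oW'.
suff -> : f @` W = M `&` V by exact: openI.
rewrite eqEsubset; split=> [_ [w Ww <-]|y [My Vy]].
  pose w' : U := exist _ w (mem_set (WU _ Ww)).
  have: (g @^-1` (val @^-1` W)) (h w') by rewrite /= hK.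
  rewrite ME /= hE /= => Mw; split=> //; rewrite -[f w](hE w').
  exact/set_mem/(valP (h w')).
pose y' : V := exist _ y (mem_set Vy).
have: (g @^-1` (val @^-1` W)) y' by rewrite ME.
by move=> /= Wy; exists (val (g y')) => //; rewrite -hE gK.
Qed.

Lemma local_homeoI (X Y : topologicalType) (f : X -> Y) :
  continuous f -> (forall x, exists2 U, open_chart f U & U x) ->
  local_homeomorphism f.
Proof.
move=> cf fU x; have [U [oU injU opU] Ux] := fU x.
exists U, (f @` U); split=> //; first exact: opU.
pose h (u : U) : f @` U :=
  exist _ (f (val u)) (mem_set (imageP f (set_mem (valP u)))).
have hinj : injective h.
  move=> a b /(congr1 val)/= fab; apply: val_inj.
  by apply: (injU _ _ _ _ fab); exact: valP.
have hsurj (v : f @` U) : exists u, h u = v.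
  have [w Uw fw] := set_mem (valP v).
  by exists (exist _ w (mem_set Uw)); exact: val_inj.
pose g v := sval (cid (hsurj v)).
have gK : cancel g h by move=> v; rewrite /g; case: cid.
have hK : cancel h g by move=> u; apply: hinj; rewrite gK.
exists h; split=> //; exists g; split=> //.
  apply: continuous_subtype.
  exact: (continuous_comp_fun (@val_continuous _ U) cf).
apply/continuousP => W /open_subtypeP[M oM ->].
apply/open_subtypeP; exists (f @` (M `&` U)); first by apply: opU; [exact: openI|exact: subIsetr].
rewrite eqEsubset; split=> v /=.
  move=> Mv; exists (val (g v)); last by rewrite -[in RHS](gK v).
  by split=> //; exact/set_mem/valP.
move=> [w [Mw Uw] fw]; suff -> : g v = exist _ w (mem_set Uw) by [].
by apply: hinj; rewrite gK; apply: val_inj.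
Qed.

Lemma local_homeoP (X Y : topologicalType) (f : X -> Y) :
  local_homeomorphism f <->
  continuous f /\ forall x, exists2 U, open_chart f U & U x.
Proof. by split=> [/local_homeoW|[cf fU]] //; exact: local_homeoI. Qed.

Lemma open_map_local_at (X Y : topologicalType) (f : X -> Y) (U : set X) :
  (forall x, U x -> nbhs (f x) (f @` U)) -> open (f @` U).
Proof. by move=> fU; rewrite openE => _ [x Ux <-]; exact: fU. Qed.

Lemma open_map_local (X Y : topologicalType) (f : X -> Y) :
  (forall x N, nbhs x N -> nbhs (f x) (f @` N)) -> open_map f.
Proof.
move=> fN U oU; apply: open_map_local_at => x Ux.
by apply: fN; apply: open_nbhs_nbhs.
Qed.

(* [mul g' g] is meaningful only when [dom g' = rng g]; its other values are
   irrelevant. *)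
Record is_groupoid (T : Type) (dom rng inv : T -> T) (mul : T -> T -> T) :
    Prop := IsGroupoid {
  gpd_dom_dom : forall g, dom (dom g) = dom g;
  gpd_rng_dom : forall g, rng (dom g) = dom g;
  gpd_dom_rng : forall g, dom (rng g) = rng g;
  gpd_rng_rng : forall g, rng (rng g) = rng g;
  gpd_dom_mul : forall g' g, dom g' = rng g -> dom (mul g' g) = dom g;
  gpd_rng_mul : forall g' g, dom g' = rng g -> rng (mul g' g) = rng g';
  gpd_mulA : forall g'' g' g, dom g'' = rng g' -> dom g' = rng g ->
    mul g'' (mul g' g) = mul (mul g'' g') g;
  gpd_mul1 : forall g, mul (rng g) g = g;
  gpd_mulr1 : forall g, mul g (dom g) = g;
  gpd_dom_inv : forall g, dom (inv g) = rng g;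
  gpd_rng_inv : forall g, rng (inv g) = dom g;
  gpd_mulV : forall g, mul (inv g) g = dom g;
  gpd_mulrV : forall g, mul g (inv g) = rng g
}.

Record top_groupoid := TopGroupoid {
  arrow :> topologicalType;
  dom : arrow -> arrow;
  rng : arrow -> arrow;
  inv : arrow -> arrow;
  mul : arrow -> arrow -> arrow;
  groupoidP : is_groupoid dom rng inv mul;
  mul_continuous : {within [set p : arrow * arrow | dom p.1 = rng p.2],
                     continuous (fun p => mul p.1 p.2)};
  inv_continuous : continuous inv
}.

Definition units (G : top_groupoid) : set G := range (@dom G).
Arguments units : clear implicits.

Definition unit_space (G : top_groupoid) : topologicalType :=
  set_type (units G).

(* The domain map with codomain the unit space. *)
Definition dom0 (G : top_groupoid) (g : G) : unit_space G :=
  exist _ (dom g) (mem_set (imageT (@dom G) g)).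

Definition etale (G : top_groupoid) : Prop := local_homeomorphism (@dom0 G).

Record etale_groupoid := EtaleGroupoid {
  etale_top :> top_groupoid;
  etaleP : etale etale_top
}.

Section GroupoidTheory.
Variable G : top_groupoid.
Implicit Types g h : G.

Lemma dom_dom g : dom (dom g) = dom g.
Proof. exact: (gpd_dom_dom (groupoidP G)). Qed.
Lemma rng_dom g : rng (dom g) = dom g.
Proof. exact: (gpd_rng_dom (groupoidP G)). Qed.
Lemma dom_rng g : dom (rng g) = rng g.
Proof. exact: (gpd_dom_rng (groupoidP G)). Qed.
Lemma rng_rng g : rng (rng g) = rng g.
Proof. exact: (gpd_rng_rng (groupoidP G)). Qed.
Lemma dom_mul g h : dom g = rng h -> dom (mul g h) = dom h.
Proof. exact: (gpd_dom_mul (groupoidP G)). Qed.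
Lemma rng_mul g h : dom g = rng h -> rng (mul g h) = rng g.
Proof. exact: (gpd_rng_mul (groupoidP G)). Qed.
Lemma gmulA (k g h : G) : dom k = rng g -> dom g = rng h ->
  mul k (mul g h) = mul (mul k g) h.
Proof. exact: (gpd_mulA (groupoidP G)). Qed.
Lemma gmul1 g : mul (rng g) g = g.
Proof. exact: (gpd_mul1 (groupoidP G)). Qed.
Lemma gmulr1 g : mul g (dom g) = g.
Proof. exact: (gpd_mulr1 (groupoidP G)). Qed.
Lemma dom_inv g : dom (inv g) = rng g.
Proof. exact: (gpd_dom_inv (groupoidP G)). Qed.
Lemma rng_inv g : rng (inv g) = dom g.
Proof. exact: (gpd_rng_inv (groupoidP G)). Qed.
Lemma gmulV g : mul (inv g) g = dom g.
Proof. exact: (gpd_mulV (groupoidP G)). Qed.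
Lemma gmulrV g : mul g (inv g) = rng g.
Proof. exact: (gpd_mulrV (groupoidP G)). Qed.

Lemma unitsP g : units G g <-> dom g = g.
Proof. by split=> [[h _ <-]|<-]; [exact: dom_dom|exists g]. Qed.

Lemma dom_unit (u : unit_space G) : dom (val u) = val u.
Proof. exact/unitsP/set_mem/(valP u). Qed.

Lemma dom0_unit (u : unit_space G) : dom0 (val u) = u.
Proof. by apply: val_inj; exact: dom_unit. Qed.

Lemma gmul_continuous (T : topologicalType) (a b : T -> G) :
  continuous a -> continuous b -> (forall t, dom (a t) = rng (b t)) ->
  continuous (fun t => mul (a t) (b t)).
Proof.
move=> ca cb ab; have /subspace_sigL_continuousP cm := @mul_continuous G.
pose D := [set p : G * G | dom p.1 = rng p.2].
pose p t : D := exist _ (a t, b t) (mem_set (ab t : D (a t, b t))).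
have cp : continuous p by apply: continuous_subtype; exact: continuous_pair.
by have := continuous_comp_fun cp cm.
Qed.

End GroupoidTheory.

Lemma dom0_continuous (G : etale_groupoid) : continuous (@dom0 G).
Proof. exact: (local_homeoW (@etaleP G)).1. Qed.

Lemma dom_continuous (G : etale_groupoid) : continuous (@dom G).
Proof.
exact: (continuous_comp_fun (@dom0_continuous G) (@val_continuous _ _)).
Qed.

Lemma etale_chart (G : etale_groupoid) (g : G) :
  exists2 U, open_chart (@dom0 G) U & U g.
Proof. exact: (local_homeoW (@etaleP G)).2. Qed.

Record is_ghom (G H : top_groupoid) (f : G -> H) : Prop := IsGhom {
  ghom_dom : forall g, f (dom g) = dom (f g);
  ghom_rng : forall g, f (rng g) = rng (f g);
  ghom_mul : forall g' g, dom g' = rng g -> f (mul g' g) = mul (f g') (f g)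
}.

Lemma ghom_units (G H : top_groupoid) (f : G -> H) (hf : is_ghom f)
  (u : unit_space G) : f (val u) \in units H.
Proof.
by apply/mem_set; exists (f (val u)) => //; rewrite -(ghom_dom hf) dom_unit.
Qed.

Definition unit_map (G H : top_groupoid) (f : G -> H) (hf : is_ghom f)
  (u : unit_space G) : unit_space H := exist _ (f (val u)) (ghom_units hf u).

Lemma unit_map_continuous (G H : top_groupoid) (f : G -> H) (hf : is_ghom f) :
  continuous f -> continuous (unit_map hf).
Proof.
move=> cf; apply: continuous_subtype.
exact: (continuous_comp_fun (@val_continuous _ _) cf).
Qed.

Lemma ghom_id (G : top_groupoid) : is_ghom (@id G).
Proof. by []. Qed.

Lemma ghom_comp (G H K : top_groupoid) (f : G -> H) (f' : H -> K) :
  is_ghom f -> is_ghom f' -> is_ghom (f' \o f).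
Proof.
move=> [fd fr fm] [fd' fr' fm']; split=> [g|g|g' g gg'] /=.
- by rewrite fd fd'.
- by rewrite fr fr'.
- by rewrite fm // fm' // -fd -fr gg'.
Qed.

Definition fibrewise_bijective (G H : top_groupoid) (f : G -> H) : Prop :=
  forall u, units G u ->
    set_bij [set g | dom g = u] [set h | dom h = f u] f.

Section FibreProduct.
Variables (K1 K2 G : top_groupoid) (a : K1 -> G) (b : K2 -> G).
Hypotheses (ha : is_ghom a) (hb : is_ghom b).

Definition fp_set : set (K1 * K2) := [set p | a p.1 = b p.2].

Definition fp_pair (k1 : K1) (k2 : K2) (e : a k1 = b k2) : fp_set :=
  exist _ (k1, k2) (mem_set (e : fp_set (k1, k2))).

Lemma fpP (p : fp_set) : a (val p).1 = b (val p).2.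
Proof. exact: (set_mem (valP p)). Qed.

Lemma fp_dom_subproof (p : fp_set) : a (dom (val p).1) = b (dom (val p).2).
Proof. by rewrite (ghom_dom ha) (ghom_dom hb) fpP. Qed.

Lemma fp_rng_subproof (p : fp_set) : a (rng (val p).1) = b (rng (val p).2).
Proof. by rewrite (ghom_rng ha) (ghom_rng hb) fpP. Qed.

Lemma ghom_inv (H H' : top_groupoid) (f : H -> H') (hf : is_ghom f) (g : H) :
  f (inv g) = inv (f g).
Proof.
have e1 : rng (f (inv g)) = dom (f g).
  by rewrite -(ghom_rng hf) rng_inv (ghom_dom hf).
rewrite -[LHS]gmul1 e1 -gmulV -gmulA ?dom_inv ?e1 //.
rewrite -(ghom_mul hf) ?rng_inv // gmulrV (ghom_rng hf) -dom_inv.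
exact: gmulr1.
Qed.

Lemma fp_inv_subproof (p : fp_set) : a (inv (val p).1) = b (inv (val p).2).
Proof. by rewrite !ghom_inv // fpP. Qed.

Definition fp_dom (p : fp_set) : fp_set := fp_pair (fp_dom_subproof p).
Definition fp_rng (p : fp_set) : fp_set := fp_pair (fp_rng_subproof p).
Definition fp_inv (p : fp_set) : fp_set := fp_pair (fp_inv_subproof p).

(* [insubd p q] is [q] when [q] lies in the fibre product, which is the case
   for composable [p] and [p'], and the junk value [p] otherwise. *)
Definition fp_mul (p p' : fp_set) : fp_set :=
  insubd p (mul (val p).1 (val p').1, mul (val p).2 (val p').2).

Lemma fp_domrngP (p p' : fp_set) : fp_dom p = fp_rng p' ->
  dom (val p).1 = rng (val p').1 /\ dom (val p).2 = rng (val p').2.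
Proof. by move=> /(congr1 val) [-> ->]. Qed.

Lemma val_fp_mul (p p' : fp_set) : fp_dom p = fp_rng p' ->
  val (fp_mul p p') = (mul (val p).1 (val p').1, mul (val p).2 (val p').2).
Proof.
move=> /fp_domrngP[e1 e2]; rewrite val_insubd ifT //; apply/mem_set.
by rewrite /fp_set /= (ghom_mul ha) // (ghom_mul hb) // !fpP.
Qed.

Lemma val_fp (p q : fp_set) :
  (val p).1 = (val q).1 -> (val p).2 = (val q).2 -> p = q.
Proof.
by move=> e1 e2; apply: val_inj; apply/eqP; rewrite -pair_eqE /= /pair_eq e1 e2 !eqxx.
Qed.

Lemma fp_groupoid : is_groupoid fp_dom fp_rng fp_inv fp_mul.
Proof.
split.
- by move=> p; apply: val_fp; exact: dom_dom.
- by move=> p; apply: val_fp; exact: rng_dom.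
- by move=> p; apply: val_fp; exact: dom_rng.
- by move=> p; apply: val_fp; exact: rng_rng.
- move=> p p' e; have [e1 e2] := fp_domrngP e.
  by apply: val_fp; rewrite /= val_fp_mul //= dom_mul.
- move=> p p' e; have [e1 e2] := fp_domrngP e.
  by apply: val_fp; rewrite /= val_fp_mul //= rng_mul.
- move=> p p' p'' e e'.
  have [e1 e2] := fp_domrngP e; have [e1' e2'] := fp_domrngP e'.
  have e3 : fp_dom p = fp_rng (fp_mul p' p'').
    by apply: val_fp; rewrite /= val_fp_mul //= rng_mul.
  have e4 : fp_dom (fp_mul p p') = fp_rng p''.
    by apply: val_fp; rewrite /= val_fp_mul //= dom_mul.
  by apply: val_fp; rewrite !val_fp_mul //= gmulA.
- move=> p; have e : fp_dom (fp_rng p) = fp_rng p.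
    by apply: val_fp; exact: dom_rng.
  by apply: val_fp; rewrite !val_fp_mul //= gmul1.
- move=> p; have e : fp_dom p = fp_rng (fp_dom p).
    by apply: val_fp; rewrite /= rng_dom.
  by apply: val_fp; rewrite !val_fp_mul //= gmulr1.
- by move=> p; apply: val_fp; exact: dom_inv.
- by move=> p; apply: val_fp; exact: rng_inv.
- move=> p; have e : fp_dom (fp_inv p) = fp_rng p.
    by apply: val_fp; exact: dom_inv.
  by apply: val_fp; rewrite !val_fp_mul //= gmulV.
- move=> p; have e : fp_dom p = fp_rng (fp_inv p).
    by apply: val_fp; rewrite /= rng_inv.
  by apply: val_fp; rewrite !val_fp_mul //= gmulrV.
Qed.

Lemma fst_val_continuous : continuous (fun p : fp_set => (val p).1).
Proof.
exact: (continuous_comp_fun (@val_continuous _ fp_set) (@continuous_fst _ _)).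
Qed.

Lemma snd_val_continuous : continuous (fun p : fp_set => (val p).2).
Proof.
exact: (continuous_comp_fun (@val_continuous _ fp_set) (@continuous_snd _ _)).
Qed.

Lemma fp_continuous (T : topologicalType) (f : T -> fp_set) :
  continuous (fun t => (val (f t)).1) -> continuous (fun t => (val (f t)).2) ->
  continuous f.
Proof.
move=> c1 c2; apply: continuous_subtype.
have -> : val \o f = fun t => ((val (f t)).1, (val (f t)).2).
  by apply/funext => t /=; case: (val (f t)).
exact: continuous_pair.
Qed.

Lemma fp_inv_continuous : continuous fp_inv.
Proof.
apply: fp_continuous => /=.
  exact: (continuous_comp_fun fst_val_continuous (@inv_continuous _)).
exact: (continuous_comp_fun snd_val_continuous (@inv_continuous _)).
Qed.

Lemma fp_mul_continuous :
  {within [set p : fp_set * fp_set | fp_dom p.1 = fp_rng p.2],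
    continuous (fun p => fp_mul p.1 p.2)}.
Proof.
apply/subspace_sigL_continuousP; set D := [set p | _].
have DP (t : D) := fp_domrngP (set_mem (valP t)).
have c1 : continuous (fun t : D => (val t).1).
  exact: (continuous_comp_fun (@val_continuous _ D) (@continuous_fst _ _)).
have c2 : continuous (fun t : D => (val t).2).
  exact: (continuous_comp_fun (@val_continuous _ D) (@continuous_snd _ _)).
apply: fp_continuous.
  rewrite (_ : (fun t => _) =
    fun t : D => mul (val (val t).1).1 (val (val t).2).1); last first.
    by apply/funext => t; rewrite /sigL /= val_fp_mul //; exact/set_mem/(valP t).
  apply: gmul_continuous => [||t]; last exact: (DP t).1.
    exact: (continuous_comp_fun c1 fst_val_continuous).
  exact: (continuous_comp_fun c2 fst_val_continuous).
rewrite (_ : (fun t => _) =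
  fun t : D => mul (val (val t).1).2 (val (val t).2).2); last first.
  by apply/funext => t; rewrite /sigL /= val_fp_mul //; exact/set_mem/(valP t).
apply: gmul_continuous => [||t]; last exact: (DP t).2.
  exact: (continuous_comp_fun c1 snd_val_continuous).
exact: (continuous_comp_fun c2 snd_val_continuous).
Qed.

Definition fibre_product : top_groupoid :=
  TopGroupoid fp_groupoid fp_mul_continuous fp_inv_continuous.

Definition fp_fst (p : fibre_product) : K1 := (val p).1.
Definition fp_snd (p : fibre_product) : K2 := (val p).2.

Lemma ghom_fp_fst : is_ghom fp_fst.
Proof. by split=> // p p' e; rewrite /fp_fst val_fp_mul. Qed.

Lemma ghom_fp_snd : is_ghom fp_snd.
Proof. by split=> // p p' e; rewrite /fp_snd val_fp_mul. Qed.

Lemma fp_pair_units (u1 : unit_space K1) (u2 : unit_space K2)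
  (e : a (val u1) = b (val u2)) :
  (fp_pair e : fibre_product) \in units fibre_product.
Proof.
by apply/mem_set/unitsP; apply: val_fp => /=; exact: dom_unit.
Qed.

Definition fp_unit (u1 : unit_space K1) (u2 : unit_space K2)
    (e : a (val u1) = b (val u2)) : unit_space fibre_product :=
  exist _ (fp_pair e : fibre_product) (fp_pair_units e).

Lemma fp_fibrewise : fibrewise_bijective b -> fibrewise_bijective fp_fst.
Proof.
move=> bb u /unitsP uu.
have u2 : units K2 (fp_snd u).
  by apply/unitsP; rewrite -(ghom_dom ghom_fp_snd) uu.
have [bf bi bs] := bb _ u2; split.
- by move=> p /= <-.
- move=> p q /set_mem /= pu /set_mem /= qu pq; apply: val_fp => //.
  apply: bi; last by rewrite -!fpP /fp_fst in pq *; rewrite pq.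
    by apply/mem_set; rewrite /= -pu.
  by apply/mem_set; rewrite /= -qu.
- move=> k /= ku.
  have [k2 /= k2u bk2] : (b @` [set g | dom g = fp_snd u]) (a k).
    by apply: bs; rewrite /= -(ghom_dom ha) ku; exact: fpP.
  by exists (fp_pair (esym bk2) : fibre_product) => //; exact: val_fp.
Qed.

End FibreProduct.
Arguments fp_fst {K1 K2 G a b ha hb}.
Arguments fp_snd {K1 K2 G a b ha hb}.

Lemma fp_etale (K1 K2 G : etale_groupoid) (a : K1 -> G) (b : K2 -> G)
  (ha : is_ghom a) (hb : is_ghom b) :
  continuous a -> continuous b -> etale (fibre_product ha hb).
Proof.
move=> ca cb; set P := fibre_product ha hb.
have cfst : continuous (fp_fst : P -> K1) by exact: fst_val_continuous.
have csnd : continuous (fp_snd : P -> K2) by exact: snd_val_continuous.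
apply/local_homeoP; split=> [|p].
  apply: continuous_subtype; apply: fp_continuous => /=.
    exact: (continuous_comp_fun cfst (@dom_continuous _)).
  exact: (continuous_comp_fun csnd (@dom_continuous _)).
have [U1 [oU1 iU1 opU1] pU1] := etale_chart (fp_fst p).
have [U2 [oU2 iU2 opU2] pU2] := etale_chart (fp_snd p).
have [W [oW iW opW] pW] := etale_chart (a (fp_fst p)).
pose V1 := U1 `&` a @^-1` W; pose V2 := U2 `&` b @^-1` W.
have oV1 : open V1 by apply: openI => //; apply: open_comp => // ? _; exact: ca.
have oV2 : open V2 by apply: openI => //; apply: open_comp => // ? _; exact: cb.
exists (fp_fst @^-1` V1 `&` fp_snd @^-1` V2); last first.
  by split; split=> //; rewrite /preimage /= -fpP.
split.
- by apply: openI; apply: open_comp.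
- move=> x y /set_mem[[x1 _] [x2 _]] /set_mem[[y1 _] [y2 _]] /(congr1 val).
  move=> /(congr1 val)[e1 e2]; apply: val_fp.
    by apply: iU1; [exact/mem_set|exact/mem_set|exact: val_inj].
  by apply: iU2; [exact/mem_set|exact/mem_set|exact: val_inj].
move=> Z oZ ZV; apply: open_map_local_at => x Zx.
have /nbhs_subtypeP[Z0 [[N1 N2] [/= xN1 xN2] NZ] ZS] : nbhs x Z.
  exact: open_nbhs_nbhs.
pose M1 := N1^° `&` V1; pose M2 := N2^° `&` V2.
have oM1 : open M1 by apply: openI => //; exact: open_interior.
have oM2 : open M2 by apply: openI => //; exact: open_interior.
have [xV1 xV2] := ZV _ Zx.
have oD1 : open (@dom0 K1 @` M1) by apply: opU1 => // ? [_ []].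
have oD2 : open (@dom0 K2 @` M2) by apply: opU2 => // ? [_ []].
pose q1 : unit_space P -> unit_space K1 := unit_map (ghom_fp_fst ha hb).
pose q2 : unit_space P -> unit_space K2 := unit_map (ghom_fp_snd ha hb).
have : nbhs (dom0 x) (q1 @^-1` (@dom0 K1 @` M1) `&` q2 @^-1` (@dom0 K2 @` M2)).
  apply: open_nbhs_nbhs; split.
    apply: openI; apply: open_comp => // ? _; exact: unit_map_continuous.
  split; first (exists (fp_fst x); last by apply: val_inj).
    by split.
  by exists (fp_snd x); [split|apply: val_inj].
apply: filterS => u [[k1 [k1N [_ k1W]] k1u] [k2 [k2N [_ k2W]] k2u]].
move/(congr1 val): k1u => /= k1u; move/(congr1 val): k2u => /= k2u.
have e : a k1 = b k2.
  apply: iW; [exact/mem_set|exact/mem_set|apply: val_inj => /=].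
  by rewrite -(ghom_dom ha) -(ghom_dom hb) k1u k2u fpP.
exists (fp_pair e); last by apply: val_inj; apply: val_fp.
by apply: ZS; apply: NZ; split; exact: nbhs_singleton.
Qed.

Record couple (G H : etale_groupoid) := Couple {
  mid : etale_groupoid;
  lft : mid -> G;
  rgt : mid -> H;
  lft_hom : is_ghom lft;
  rgt_hom : is_ghom rgt;
  lft_continuous : continuous lft;
  rgt_continuous : continuous rgt;
  lft_bijective : fibrewise_bijective lft;
  rgt_open : open_map (unit_map rgt_hom);
  rgt_injective : injective (unit_map rgt_hom)
}.

Definition couple_equiv (G H : etale_groupoid) (c1 c2 : couple G H) : Prop :=
  exists iota : mid c1 -> mid c2,
    [/\ is_ghom iota, homeomorphism iota,
        (forall k, lft (iota k) = lft k) & (forall k, rgt (iota k) = rgt k)].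

Section CoupleComp.
Variables (G1 G2 G3 : etale_groupoid) (c1 : couple G1 G2) (c2 : couple G2 G3).

Definition comp_mid : etale_groupoid :=
  @EtaleGroupoid (fibre_product (rgt_hom c1) (lft_hom c2))
    (fp_etale (@rgt_continuous _ _ c1) (@lft_continuous _ _ c2)).

Definition comp_lft (p : comp_mid) : G1 := lft (fp_fst p).
Definition comp_rgt (p : comp_mid) : G3 := rgt (fp_snd p).

Lemma comp_lft_hom : is_ghom comp_lft.
Proof.
exact: (@ghom_comp comp_mid _ _ _ _ (ghom_fp_fst _ _) (lft_hom c1)).
Qed.

Lemma comp_rgt_hom : is_ghom comp_rgt.
Proof.
exact: (@ghom_comp comp_mid _ _ _ _ (ghom_fp_snd _ _) (rgt_hom c2)).
Qed.

Lemma comp_lft_continuous : continuous comp_lft.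
Proof.
exact: (continuous_comp_fun (@fst_val_continuous _ _ _ _ _)
  (@lft_continuous _ _ c1)).
Qed.

Lemma comp_rgt_continuous : continuous comp_rgt.
Proof.
exact: (continuous_comp_fun (@snd_val_continuous _ _ _ _ _)
  (@rgt_continuous _ _ c2)).
Qed.

Lemma comp_lft_bijective : @fibrewise_bijective comp_mid _ comp_lft.
Proof.
move=> u uu.
have f1 := fp_fibrewise (ha := rgt_hom c1) (hb := lft_hom c2)
  (@lft_bijective _ _ c2) uu.
have u1 : units (mid c1) (fp_fst u).
  by apply/unitsP; rewrite -(ghom_dom (ghom_fp_fst _ _)); congr fp_fst; apply/unitsP.
exact: (set_bij_comp f1 (lft_bijective u1)).
Qed.

Lemma comp_rgt_injective : injective (unit_map comp_rgt_hom).
Proof.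
move=> x y /(congr1 val)/= exy; apply: val_inj; set p := val x; set q := val y.
pose x2 := unit_map (ghom_fp_snd (rgt_hom c1) (lft_hom c2)) x.
pose y2 := unit_map (ghom_fp_snd (rgt_hom c1) (lft_hom c2)) y.
pose x1 := unit_map (ghom_fp_fst (rgt_hom c1) (lft_hom c2)) x.
pose y1 := unit_map (ghom_fp_fst (rgt_hom c1) (lft_hom c2)) y.
have e2 : x2 = y2 by apply: (@rgt_injective _ _ c2); apply: val_inj.
have e1 : x1 = y1.
  apply: (@rgt_injective _ _ c1); apply: val_inj => /=.
  by rewrite (fpP p) (fpP q); congr lft; exact: (congr1 val e2).
by apply: val_fp; [exact: (congr1 val e1)|exact: (congr1 val e2)].
Qed.

Lemma comp_snd_open :
  open_map (unit_map (ghom_fp_snd (rgt_hom c1) (lft_hom c2))).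
Proof.
apply: open_map_local => x N /nbhs_subtypeP[N' /nbhs_subtypeP[N''
  [[A B] [/= xA xB] ABN'']] N''N' N'N].
pose x1 := unit_map (ghom_fp_fst (rgt_hom c1) (lft_hom c2)) x.
pose x2 := unit_map (ghom_fp_snd (rgt_hom c1) (lft_hom c2)) x.
have oA : open ((val : unit_space (mid c1) -> _) @^-1` A^°).
  by apply: open_comp => [? _|]; [exact: val_continuous|exact: open_interior].
have oB : open ((val : unit_space (mid c2) -> _) @^-1` B^°).
  by apply: open_comp => [? _|]; [exact: val_continuous|exact: open_interior].
have oA' := @rgt_open _ _ c1 _ oA.
have cl := unit_map_continuous (hf := lft_hom c2) (@lft_continuous _ _ c2).
have : nbhs x2 (val @^-1` B^° `&` unit_map (lft_hom c2) @^-1`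
    (unit_map (rgt_hom c1) @` (val @^-1` A^°))).
  apply: open_nbhs_nbhs; split.
    by apply: openI => //; apply: open_comp => // ? _; exact: cl.
  by split => //; exists x1 => //; apply: val_inj => /=; exact: fpP.
apply: filterS => y [yB [z zA /(congr1 val)/= zy]].
exists (fp_unit (rgt_hom c1) (lft_hom c2) zy); last by apply: val_inj.
apply: N'N; apply: N''N'; apply: ABN''.
by split; exact: nbhs_singleton.
Qed.

Lemma comp_rgt_open : open_map (unit_map comp_rgt_hom).
Proof.
move=> U oU; have /= := rgt_open (comp_snd_open oU).
rewrite image_comp; congr open; apply: eq_imagel => x _; exact: val_inj.
Qed.

(* In diagrammatic order: [couple_comp c1 c2] represents [c2] after [c1]. *)
Definition couple_comp : couple G1 G3 :=
  Couple comp_lft_hom comp_lft_continuous comp_rgt_continuous comp_lft_bijective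
    comp_rgt_open comp_rgt_injective.

End CoupleComp.

Section CoupleId.
Variable G : etale_groupoid.

Lemma id_fibrewise : fibrewise_bijective (@id G).
Proof. by move=> u _; split=> // g gu; exists g. Qed.

Lemma unit_map_id : unit_map (ghom_id G) = id.
Proof. by apply/funext => u; exact: val_inj. Qed.

Lemma id_open : open_map (unit_map (ghom_id G)).
Proof. by move=> U oU; rewrite unit_map_id image_id. Qed.

Lemma id_injective : injective (unit_map (ghom_id G)).
Proof. by rewrite unit_map_id. Qed.

Definition couple_id : couple G G :=
  Couple (ghom_id G) (fun x => @cvg_id _ (nbhs x)) (fun x => @cvg_id _ (nbhs x))
    id_fibrewise id_open id_injective.

End CoupleId.

Lemma compact_preimage_embedding (X Y : topologicalType) (j : X -> Y)
    (L : set Y) :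
  (forall x N, nbhs x N -> exists2 M, nbhs (j x) M & j @^-1` M `<=` N) ->
  closed (range j) -> compact L -> compact (j @^-1` L).
Proof.
move=> jN cj cL F PF FL.
have [y [Ly cly]] : L `&` cluster (j @ F) !=set0 by apply: cL.
have [x _ xy] : range j y.
  have Fr : F (j @^-1` (range j)) by apply: (filterS _ FL) => z _; exists z.
  by apply: cj => B yB; exact: cly.
exists x; split; first by rewrite /preimage /= xy.
move=> A B FA /jN[M jM MB].
have FjA : F (j @^-1` (j @` A)) by apply: (filterS _ FA) => z Az; exists z.
rewrite xy in jM; have [_ [[a Aa <-] Ma]] := cly _ _ FjA jM.
by exists a; split=> //; exact: MB.
Qed.

Lemma closed_equalizer (X Y : topologicalType) (f g : X -> Y) :
  hausdorff_space Y -> continuous f -> continuous g ->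
  closed [set x | f x = g x].
Proof.
move=> hY cf cg x clx; apply: hY => A B fA gB.
have /clx[y /= [fg [fy gy]]] : nbhs x (f @^-1` A `&` g @^-1` B).
  by apply: filterI; [exact: cf|exact: cg].
by exists (f y); split=> //; rewrite fg.
Qed.

Record lcH_groupoid := LcHGroupoid {
  lcH_etale :> etale_groupoid;
  lcH_locally_compact : locally_compact [set: unit_space lcH_etale];
  lcH_hausdorff : hausdorff_space (unit_space lcH_etale)
}.

Record proper_couple (G H : lcH_groupoid) := ProperCouple {
  pc_couple :> couple G H;
  pc_proper : proper_map (unit_map (lft_hom pc_couple))
}.

Lemma mid_locally_compact (G H : lcH_groupoid) (c : proper_couple G H) :
  locally_compact [set: unit_space (mid c)].
Proof.
have cl := unit_map_continuous (hf := lft_hom c) (@lft_continuous _ _ c).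
move=> x _.
have [U + [cU clU]] := @lcH_locally_compact G (unit_map (lft_hom c) x) I.
rewrite withinET => Ux; exists (unit_map (lft_hom c) @^-1` U).
  by rewrite withinET; exact: cl.
split; first exact: pc_proper.
by apply: closed_comp => // ? _; exact: cl.
Qed.

Lemma mid_hausdorff (G H : lcH_groupoid) (c : proper_couple G H) :
  hausdorff_space (unit_space (mid c)).
Proof.
have cr := unit_map_continuous (hf := rgt_hom c) (@rgt_continuous _ _ c).
move=> p q pq; apply: (@rgt_injective _ _ c); apply: lcH_hausdorff => A B pA qB.
have [x [Ax Bx]] := pq _ _ (cr _ _ pA) (cr _ _ qB).
by exists (unit_map (rgt_hom c) x).
Qed.

Definition mid_lcH (G H : lcH_groupoid) (c : proper_couple G H) : lcH_groupoid :=
  LcHGroupoid (@mid_locally_compact _ _ c) (@mid_hausdorff _ _ c).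

Lemma couple_id_proper (G : lcH_groupoid) :
  proper_map (unit_map (lft_hom (couple_id G))).
Proof.
move=> C cC; rewrite (_ : unit_map _ = id) //.
by apply/funext => u; exact: val_inj.
Qed.

Lemma couple_comp_proper (G1 G2 G3 : lcH_groupoid)
    (c1 : proper_couple G1 G2) (c2 : proper_couple G2 G3) :
  proper_map (unit_map (lft_hom (couple_comp c1 c2))).
Proof.
move=> C cC; set ha := rgt_hom c1; set hb := lft_hom c2.
pose P := fibre_product ha hb.
pose q1 := unit_map (ghom_fp_fst ha hb).
pose q2 := unit_map (ghom_fp_snd ha hb).
pose D := unit_map (lft_hom c1) @^-1` C.
have cD : compact D by exact: pc_proper.
have ca := unit_map_continuous (hf := ha) (@rgt_continuous _ _ c1).
have cb := unit_map_continuous (hf := hb) (@lft_continuous _ _ c2).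
pose E := unit_map hb @^-1` (unit_map ha @` D).
have cE : compact E.
  apply: pc_proper; apply: continuous_compact => //.
  exact: continuous_subspaceT.
pose j (u : unit_space P) := (q1 u, q2 u).
have jr : range j = [set v | unit_map ha v.1 = unit_map hb v.2].
  rewrite eqEsubset; split=> [_ [u _ <-]|[v1 v2] /= /(congr1 val) e].
    by apply: val_inj; exact: fpP.
  by exists (fp_unit ha hb e) => //; congr (_, _); exact: val_inj.
have cDE : compact (j @^-1` (D `*` E)).
  apply: compact_preimage_embedding; last exact: compact_setX.
    move=> x N /nbhs_subtypeP[N1 /nbhs_subtypeP[N2 [[A B] [/= xA xB] ABN]
      N21 N1N]].
    exists ((val @^-1` A) `*` (val @^-1` B)).
      by exists (val @^-1` A, val @^-1` B) => //; split; exact: val_continuous.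
    by move=> y [yA yB]; apply: N1N; apply: N21; apply: ABN.
  rewrite jr; apply: closed_equalizer; first exact: lcH_hausdorff.
    exact: (continuous_comp_fun (@continuous_fst _ _) ca).
  exact: (continuous_comp_fun (@continuous_snd _ _) cb).
rewrite (_ : _ @^-1` _ = j @^-1` (D `*` E)) //.
rewrite eqEsubset; split=> u /=.
  move=> Cu; have Du : D (q1 u).
    by move: Cu; congr C; exact: val_inj.
  split=> //; exists (q1 u) => //; apply: val_inj; exact: fpP.
by move=> [Du _]; move: Du; congr C; exact: val_inj.
Qed.

Definition proper_couple_id (G : lcH_groupoid) : proper_couple G G :=
  ProperCouple (@couple_id_proper G).

Definition proper_couple_comp (G1 G2 G3 : lcH_groupoid)
    (c1 : proper_couple G1 G2) (c2 : proper_couple G2 G3) :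
    proper_couple G1 G3 :=
  ProperCouple (couple_comp_proper (c1 := c1) (c2 := c2)).

Lemma couple_equivI (G H : etale_groupoid) (c1 c2 : couple G H)
    (f : mid c1 -> mid c2) (g : mid c2 -> mid c1) :
  is_ghom f -> cancel f g -> cancel g f -> continuous f -> continuous g ->
  (forall k, lft (f k) = lft k) -> (forall k, rgt (f k) = rgt k) ->
  couple_equiv c1 c2.
Proof. by move=> hf fK gK cf cg fl fr; exists f; split=> //; exists g. Qed.

Lemma couple_equiv_refl (G H : etale_groupoid) (c : couple G H) :
  couple_equiv c c.
Proof. by apply: (@couple_equivI _ _ c c id id) => // x; exact: cvg_id. Qed.

Lemma couple_equiv_sym (G H : etale_groupoid) (c1 c2 : couple G H) :
  couple_equiv c1 c2 -> couple_equiv c2 c1.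
Proof.
move=> [f [hf [g [fK gK cf cg]] fl fr]]; apply: (@couple_equivI _ _ _ _ g f) => //.
- split=> [x|x|x y xy]; apply: (can_inj fK); rewrite gK.
  + by rewrite (ghom_dom hf) gK.
  + by rewrite (ghom_rng hf) gK.
  + rewrite (ghom_mul hf) ?gK //; apply: (can_inj fK).
    by rewrite (ghom_dom hf) (ghom_rng hf) !gK.
- by move=> k; rewrite -fl gK.
- by move=> k; rewrite -fr gK.
Qed.

Lemma couple_equiv_trans (G H : etale_groupoid) (c1 c2 c3 : couple G H) :
  couple_equiv c1 c2 -> couple_equiv c2 c3 -> couple_equiv c1 c3.
Proof.
move=> [f [hf [g [fK gK cf cg]] fl fr]] [f' [hf' [g' [fK' gK' cf' cg']] fl' fr']].
apply: (@couple_equivI _ _ _ _ (f' \o f) (g \o g')).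
- exact: ghom_comp.
- exact: can_comp.
- exact: can_comp.
- exact: continuous_comp_fun.
- exact: continuous_comp_fun.
- by move=> k /=; rewrite fl' fl.
- by move=> k /=; rewrite fr' fr.
Qed.

Lemma couple_comp_equiv (G1 G2 G3 : etale_groupoid)
    (c1 d1 : couple G1 G2) (c2 d2 : couple G2 G3) :
  couple_equiv c1 d1 -> couple_equiv c2 d2 ->
  couple_equiv (couple_comp c1 c2) (couple_comp d1 d2).
Proof.
move=> [f [hf [g [fK gK cf cg]] fl fr]] [f' [hf' [g' [fK' gK' cf' cg']] fl' fr']].
have gr k : rgt (g k) = rgt k by rewrite -fr gK.
have gl k : lft (g' k) = lft k by rewrite -fl' gK'.
have e (p : mid (couple_comp c1 c2)) :
    rgt (f (fp_fst p)) = lft (f' (fp_snd p)) by rewrite fr fl'; exact: fpP.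
have e' (p : mid (couple_comp d1 d2)) :
    rgt (g (fp_fst p)) = lft (g' (fp_snd p)) by rewrite gr gl; exact: fpP.
apply: (@couple_equivI _ _ (couple_comp c1 c2) (couple_comp d1 d2)
  (fun p => fp_pair (e p)) (fun p => fp_pair (e' p))).
- split=> [p|p|p q pq].
  + by apply: val_fp; [exact: (ghom_dom hf)|exact: (ghom_dom hf')].
  + by apply: val_fp; [exact: (ghom_rng hf)|exact: (ghom_rng hf')].
  + have [pq1 pq2] := fp_domrngP pq.
    have pq' : dom (fp_pair (e p) : mid (couple_comp d1 d2)) =
        rng (fp_pair (e q) : mid (couple_comp d1 d2)).
      apply: val_fp => /=.
        by rewrite -(ghom_dom hf) -(ghom_rng hf); congr f.
      by rewrite -(ghom_dom hf') -(ghom_rng hf'); congr f'.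
    by apply: val_fp; rewrite (val_fp_mul pq') /= /fp_fst /fp_snd (val_fp_mul pq) /=
      ?(ghom_mul hf) ?(ghom_mul hf').
- by move=> p; apply: val_fp => /=; rewrite /fp_fst /fp_snd /= ?fK ?fK'.
- by move=> p; apply: val_fp => /=; rewrite /fp_fst /fp_snd /= ?gK ?gK'.
- apply: fp_continuous => /=.
    exact: (continuous_comp_fun (@fst_val_continuous _ _ _ _ _) cf).
  exact: (continuous_comp_fun (@snd_val_continuous _ _ _ _ _) cf').
- apply: fp_continuous => /=.
    exact: (continuous_comp_fun (@fst_val_continuous _ _ _ _ _) cg).
  exact: (continuous_comp_fun (@snd_val_continuous _ _ _ _ _) cg').
- by move=> p; exact: fl.
- by move=> p; exact: fr'.
Qed.

Lemma couple_comp_id_l (G H : etale_groupoid) (c : couple G H) :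
  couple_equiv (couple_comp (couple_id G) c) c.
Proof.
pose f (p : mid (couple_comp (couple_id G) c)) : mid c := fp_snd p.
pose g (k : mid c) : mid (couple_comp (couple_id G) c) :=
  @fp_pair G (mid c) G id (@lft _ _ c) (lft k) k erefl.
apply: (@couple_equivI _ _ _ _ f g) => //.
- exact: ghom_fp_snd.
- by move=> p; apply: val_fp => //=; rewrite -fpP.
- exact: snd_val_continuous.
- by apply: fp_continuous => /=; [exact: lft_continuous|move=> x; exact: cvg_id].
- by move=> p; rewrite /f /fp_snd -fpP.
Qed.

Lemma couple_comp_id_r (G H : etale_groupoid) (c : couple G H) :
  couple_equiv (couple_comp c (couple_id H)) c.
Proof.
pose f (p : mid (couple_comp c (couple_id H))) : mid c := fp_fst p.
pose g (k : mid c) : mid (couple_comp c (couple_id H)) :=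
  @fp_pair (mid c) H H (@rgt _ _ c) id k (rgt k) erefl.
apply: (@couple_equivI _ _ _ _ f g) => //.
- exact: ghom_fp_fst.
- by move=> p; apply: val_fp => //; exact: (fpP p).
- exact: fst_val_continuous.
- by apply: fp_continuous => /=; [move=> x; exact: cvg_id|exact: rgt_continuous].
- by move=> p; exact: (fpP p).
Qed.

Lemma couple_comp_assoc (G1 G2 G3 G4 : etale_groupoid)
    (c1 : couple G1 G2) (c2 : couple G2 G3) (c3 : couple G3 G4) :
  couple_equiv (couple_comp (couple_comp c1 c2) c3)
               (couple_comp c1 (couple_comp c2 c3)).
Proof.
set L := couple_comp (couple_comp c1 c2) c3.
set R := couple_comp c1 (couple_comp c2 c3).
have e23 (p : mid L) : rgt (fp_snd (fp_fst p)) = lft (fp_snd p) by exact: fpP.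
have e1 (p : mid L) :
    rgt (fp_fst (fp_fst p)) = @lft _ _ (couple_comp c2 c3) (fp_pair (e23 p)).
  exact: (fpP (fp_fst p)).
have e12 (p : mid R) : rgt (fp_fst p) = lft (fp_fst (fp_snd p)) by exact: fpP.
have e3 (p : mid R) :
    @rgt _ _ (couple_comp c1 c2) (fp_pair (e12 p)) = lft (fp_snd (fp_snd p)).
  exact: (fpP (fp_snd p)).
pose f (p : mid L) : mid R :=
  @fp_pair _ (mid (couple_comp c2 c3)) _ (@rgt _ _ c1)
    (@lft _ _ (couple_comp c2 c3)) _ _ (e1 p).
pose g (p : mid R) : mid L :=
  @fp_pair (mid (couple_comp c1 c2)) _ _ (@rgt _ _ (couple_comp c1 c2))
    (@lft _ _ c3) _ _ (e3 p).
have cf1 := @fst_val_continuous _ _ _ _ _ : continuous (fp_fst : mid L -> _).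
have cf2 := @snd_val_continuous _ _ _ _ _ : continuous (fp_snd : mid L -> _).
have cg1 := @fst_val_continuous _ _ _ _ _ : continuous (fp_fst : mid R -> _).
have cg2 := @snd_val_continuous _ _ _ _ _ : continuous (fp_snd : mid R -> _).
apply: (@couple_equivI _ _ L R f g).
- split=> [p|p|p q pq].
  + by do 2?[apply: val_fp => //].
  + by do 2?[apply: val_fp => //].
  + have [pq1 pq2] := fp_domrngP pq; have [pq3 pq4] := fp_domrngP pq1.
    have d23 : dom (fp_snd (f p)) = rng (fp_snd (f q)) by apply: val_fp.
    have d : dom (f p) = rng (f q) by apply: val_fp.
    have E1 := val_fp_mul pq; have E2 := val_fp_mul pq1.
    have E3 := val_fp_mul d; have E4 := val_fp_mul d23.
    apply: val_fp; first by rewrite E3 /= /fp_fst E1 /= E2.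
    rewrite E3 /=; apply: val_fp; rewrite E4 /= /fp_fst /fp_snd E1 //= E2 //.
- by move=> p; do 2?[apply: val_fp => //].
- by move=> p; do 2?[apply: val_fp => //].
- apply: fp_continuous; [|apply: fp_continuous] => /=.
  + exact: (continuous_comp_fun cf1 (@fst_val_continuous _ _ _ _ _)).
  + exact: (continuous_comp_fun cf1 (@snd_val_continuous _ _ _ _ _)).
  + exact: cf2.
- apply: fp_continuous; [apply: fp_continuous|] => /=.
  + exact: cg1.
  + exact: (continuous_comp_fun cg2 (@fst_val_continuous _ _ _ _ _)).
  + exact: (continuous_comp_fun cg2 (@snd_val_continuous _ _ _ _ _)).
- by [].
- by [].
Qed.

Record category := Category {
  cat_ob :> Type;
  cat_hom : cat_ob -> cat_ob -> Type;
  cat_id : forall a, cat_hom a a;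
  cat_comp : forall a b c, cat_hom b c -> cat_hom a b -> cat_hom a c;
  cat_comp1m : forall a b (f : cat_hom a b), cat_comp (cat_id b) f = f;
  cat_compm1 : forall a b (f : cat_hom a b), cat_comp f (cat_id a) = f;
  cat_compA : forall a b c d (h : cat_hom c d) (g : cat_hom b c)
    (f : cat_hom a b), cat_comp h (cat_comp g f) = cat_comp (cat_comp h g) f
}.
Arguments cat_id {_} _.

Record is_functor (C D : category) (F0 : C -> D)
    (F1 : forall a b : C, cat_hom a b -> cat_hom (F0 a) (F0 b)) : Prop :=
  IsFunctor {
    functor_id : forall a : C, F1 a a (cat_id a) = cat_id (F0 a);
    functor_comp : forall (a b c : C) (g : cat_hom b c) (f : cat_hom a b),
      F1 a c (cat_comp g f) = cat_comp (F1 b c g) (F1 a b f)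
  }.

Definition couple_class (G H : lcH_groupoid) (c : proper_couple G H) :
    proper_couple G H -> Prop :=
  fun c' => couple_equiv c c'.

(* Equivalence classes are bare predicates because the universe of the library's
   [set] is too small for [proper_couple G H]. *)
Record couple_morphism (G H : lcH_groupoid) := CoupleMorphism {
  cm_set : proper_couple G H -> Prop;
  cm_setP : exists c, cm_set = couple_class c
}.

Definition mor_of (G H : lcH_groupoid) (c : proper_couple G H) :
    couple_morphism G H :=
  CoupleMorphism (ex_intro _ c erefl).

Lemma cm_ext (G H : lcH_groupoid) (m m' : couple_morphism G H) :
  cm_set m = cm_set m' -> m = m'.
Proof.
by case: m m' => [s sP] [s' sP'] /= e; subst s'; congr CoupleMorphism; exact: Prop_irrelevance.
Qed.

Lemma mor_ofP (G H : lcH_groupoid) (c c' : proper_couple G H) :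
  mor_of c = mor_of c' <-> couple_equiv c c'.
Proof.
split=> [/(congr1 (@cm_set _ _)) /= e|cc'].
  have : couple_class c' c' by exact: couple_equiv_refl.
  by rewrite -e.
apply: cm_ext; apply/funext => d; apply/propext; split=> h.
  exact: couple_equiv_trans (couple_equiv_sym cc') h.
exact: couple_equiv_trans cc' h.
Qed.

Lemma mor_of_surj (G H : lcH_groupoid) (m : couple_morphism G H) :
  exists c, m = mor_of c.
Proof. by have [c mc] := cm_setP m; exists c; exact: cm_ext. Qed.

Definition mor_comp_set (G1 G2 G3 : lcH_groupoid)
    (m2 : couple_morphism G2 G3) (m1 : couple_morphism G1 G2) :
    proper_couple G1 G3 -> Prop :=
  fun c => exists c1 c2,
    [/\ cm_set m1 c1, cm_set m2 c2 & couple_equiv (proper_couple_comp c1 c2) c].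

Lemma mor_comp_setE (G1 G2 G3 : lcH_groupoid)
    (c2 : proper_couple G2 G3) (c1 : proper_couple G1 G2) :
  mor_comp_set (mor_of c2) (mor_of c1) =
  couple_class (proper_couple_comp c1 c2).
Proof.
apply/funext => d; apply/propext; split=> [[d1 [d2 [h1 h2 h]]]|h].
  exact: couple_equiv_trans (couple_comp_equiv h1 h2) h.
by exists c1, c2; split=> //; exact: couple_equiv_refl.
Qed.

Lemma mor_comp_subproof (G1 G2 G3 : lcH_groupoid)
    (m2 : couple_morphism G2 G3) (m1 : couple_morphism G1 G2) :
  exists c, mor_comp_set m2 m1 = couple_class c.
Proof.
have [c1 ->] := mor_of_surj m1; have [c2 ->] := mor_of_surj m2.
by exists (proper_couple_comp c1 c2); exact: mor_comp_setE.
Qed.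

Definition mor_comp (G1 G2 G3 : lcH_groupoid)
    (m2 : couple_morphism G2 G3) (m1 : couple_morphism G1 G2) :
    couple_morphism G1 G3 :=
  CoupleMorphism (mor_comp_subproof m2 m1).

Lemma mor_compE (G1 G2 G3 : lcH_groupoid)
    (c2 : proper_couple G2 G3) (c1 : proper_couple G1 G2) :
  mor_comp (mor_of c2) (mor_of c1) = mor_of (proper_couple_comp c1 c2).
Proof. by apply: cm_ext; exact: mor_comp_setE. Qed.

Definition mor_id (G : lcH_groupoid) : couple_morphism G G :=
  mor_of (proper_couple_id G).

Lemma mor_comp1m (G H : lcH_groupoid) (m : couple_morphism G H) :
  mor_comp (mor_id H) m = m.
Proof.
have [c ->] := mor_of_surj m; rewrite mor_compE; apply/mor_ofP.
exact: couple_comp_id_r.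
Qed.

Lemma mor_compm1 (G H : lcH_groupoid) (m : couple_morphism G H) :
  mor_comp m (mor_id G) = m.
Proof.
have [c ->] := mor_of_surj m; rewrite mor_compE; apply/mor_ofP.
exact: couple_comp_id_l.
Qed.

Lemma mor_compA (G1 G2 G3 G4 : lcH_groupoid) (m3 : couple_morphism G3 G4)
    (m2 : couple_morphism G2 G3) (m1 : couple_morphism G1 G2) :
  mor_comp m3 (mor_comp m2 m1) = mor_comp (mor_comp m3 m2) m1.
Proof.
have [c1 ->] := mor_of_surj m1; have [c2 ->] := mor_of_surj m2.
have [c3 ->] := mor_of_surj m3; rewrite !mor_compE; apply/mor_ofP.
exact: couple_comp_assoc.
Qed.

Definition EG_lcH : category := Category mor_comp1m mor_compm1 mor_compA.

(* The library puts no topology on R[i] itself, only on R[i]^o. *)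
HB.instance Definition _ (R : rcfType) := GRing.ComAlgebra.copy R[i] R[i]^o.
HB.instance Definition _ (R : rcfType) := Vector.copy R[i] R[i]^o.
HB.instance Definition _ (R : rcfType) := NormedModule.copy R[i] R[i]^o.

(* C*-algebras are not required to be unital. *)
Record cstar_algebra (R : realType) := CstarAlgebra {
  cstar_space :> completeNormedModType R[i];
  cmul : cstar_space -> cstar_space -> cstar_space;
  cstar : cstar_space -> cstar_space;
  cmulA : associative cmul;
  cmulDl : left_distributive cmul +%R;
  cmulDr : right_distributive cmul +%R;
  cmulZl : forall (z : R[i]) x y, cmul (z *: x) y = z *: cmul x y;
  cmulZr : forall (z : R[i]) x y, cmul x (z *: y) = z *: cmul x y;
  cstarK : involutive cstar;
  cstarD : {morph cstar : x y / x + y};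
  cstarZ : forall (z : R[i]) x, cstar (z *: x) = z^* *: cstar x;
  cstarM : forall x y, cstar (cmul x y) = cmul (cstar y) (cstar x);
  cnormM : forall x y, `|cmul x y| <= `|x| * `|y|;
  cnorm_star : forall x, `|cmul (cstar x) x| = `|x| ^+ 2
}.

Record star_hom (R : realType) (A B : cstar_algebra R) := StarHom {
  star_fun :> A -> B;
  star_homD : {morph star_fun : x y / x + y};
  star_homZ : forall (z : R[i]) x, star_fun (z *: x) = z *: star_fun x;
  star_homM : {morph star_fun : x y / cmul x y};
  star_hom_star : {morph star_fun : x / cstar x}
}.

Lemma star_hom_ext (R : realType) (A B : cstar_algebra R) (f g : star_hom A B) :
  (forall x, f x = g x) -> f = g.
Proof.
case: f g => [f fD fZ fM fs] [g gD gZ gM gs] /= /funext fg; subst g.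
by congr StarHom; exact: Prop_irrelevance.
Qed.

Definition star_id (R : realType) (A : cstar_algebra R) : star_hom A A :=
  @StarHom R A A id (fun _ _ => erefl) (fun _ _ => erefl) (fun _ _ => erefl)
    (fun _ => erefl).

Section StarComp.
Variables (R : realType) (A B C : cstar_algebra R).
Variables (g : star_hom B C) (f : star_hom A B).

Definition star_comp : star_hom A C.
Proof.
exists (g \o f) => [x y|z x|x y|x] /=.
- by rewrite !star_homD.
- by rewrite !star_homZ.
- by rewrite !star_homM.
- by rewrite !star_hom_star.
Defined.

End StarComp.

Lemma star_comp1m (R : realType) (A B : cstar_algebra R) (f : star_hom A B) :
  star_comp (star_id B) f = f.
Proof. exact: star_hom_ext. Qed.

Lemma star_compm1 (R : realType) (A B : cstar_algebra R) (f : star_hom A B) :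
  star_comp f (star_id A) = f.
Proof. exact: star_hom_ext. Qed.

Lemma star_compA (R : realType) (A B C D : cstar_algebra R)
    (h : star_hom C D) (g : star_hom B C) (f : star_hom A B) :
  star_comp h (star_comp g f) = star_comp (star_comp h g) f.
Proof. exact: star_hom_ext. Qed.

Definition Cstar_alg (R : realType) : category :=
  Category (@star_comp1m R) (@star_compm1 R) (@star_compA R).

(* [Cc U] is the space of compactly supported continuous functions on the
   subspace [U], extended by zero to [X]. *)
Definition Cc (R : realType) (X : topologicalType) (U : set X) :
    set (X -> R[i]) :=
  [set f | exists f0 : U -> R[i],
    [/\ continuous f0, compact (closure [set x : U | f0 x != 0]),
        forall x : U, f (val x) = f0 x & forall x, ~ U x -> f x = 0]].

Definition Qalg (R : realType) (G : top_groupoid) : set (G -> R[i]) :=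
  [set f | exists (n : nat) (z : 'I_n -> R[i]) (h : 'I_n -> G -> R[i]),
    (forall i, exists U : set G,
      [/\ open U, hausdorff_space (set_type U) & Cc U (h i)]) /\
    f = fun g => \sum_(i < n) z i * h i g].

(* The sums over sets below are [fsbig] sums, i.e. sums over the support of the
   summand, which is finite for functions in [Qalg]. *)
Definition convolution (R : realType) (G : top_groupoid) (f1 f2 : G -> R[i]) :
    G -> R[i] :=
  fun g => \sum_(p \in [set p : G * G | dom p.1 = rng p.2 /\ mul p.1 p.2 = g])
    f1 p.1 * f2 p.2.

Definition involution (R : realType) (G : top_groupoid) (f : G -> R[i]) :
    G -> R[i] :=
  fun g => (f (inv g))^*.

Definition pullback (R : realType) (K G : top_groupoid) (phi : K -> G)
    (f : G -> R[i]) : K -> R[i] :=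
  f \o phi.

Definition pushforward (R : realType) (K H : top_groupoid) (psi : K -> H)
    (f : K -> R[i]) : H -> R[i] :=
  fun h => \sum_(k \in [set k : K | psi k = h]) f k.

Record is_Q_hom (R : realType) (G : top_groupoid) (A : cstar_algebra R)
    (rho : (G -> R[i]) -> A) : Prop := IsQHom {
  Q_homD : forall f1 f2, Qalg f1 -> Qalg f2 ->
    rho (fun g => f1 g + f2 g) = rho f1 + rho f2;
  Q_homZ : forall (z : R[i]) f, Qalg f -> rho (fun g => z * f g) = z *: rho f;
  Q_homM : forall f1 f2, Qalg f1 -> Qalg f2 ->
    rho (convolution f1 f2) = cmul (rho f1) (rho f2);
  Q_hom_star : forall f, Qalg f -> rho (involution f) = cstar (rho f)
}.

(* A C*-algebra with the defining property of the groupoid C*-algebra of [G]: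
   only the values of [gcs_in] on [Qalg] are meaningful. *)
Record groupoid_cstar (R : realType) (G : lcH_groupoid) := GroupoidCstar {
  gcs_alg :> cstar_algebra R;
  gcs_in : (G -> R[i]) -> gcs_alg;
  gcs_hom : is_Q_hom gcs_in;
  gcs_inj : forall f1 f2, Qalg f1 -> Qalg f2 -> gcs_in f1 = gcs_in f2 ->
    f1 = f2;
  gcs_dense : closure [set gcs_in f | f in @Qalg R G] = setT;
  gcs_extend : forall (B : cstar_algebra R) (rho : (G -> R[i]) -> B),
    is_Q_hom rho ->
    exists! r : star_hom gcs_alg B, forall f, Qalg f -> r (gcs_in f) = rho f
}.
Arguments gcs_in {R G} _ _.

Definition extends_pullback (R : realType) (K G : lcH_groupoid)
    (CG : groupoid_cstar R G) (CK : groupoid_cstar R K) (phi : K -> G)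
    (sigma_phi : star_hom CG CK) : Prop :=
  forall f, Qalg f -> Qalg (pullback phi f) /\
    sigma_phi (gcs_in CG f) = gcs_in CK (pullback phi f).

Definition extends_pushforward (R : realType) (K H : lcH_groupoid)
    (CK : groupoid_cstar R K) (CH : groupoid_cstar R H) (psi : K -> H)
    (pi_psi : star_hom CK CH) : Prop :=
  forall f, Qalg f -> Qalg (pushforward psi f) /\
    pi_psi (gcs_in CK f) = gcs_in CH (pushforward psi f).

(* Main.v *)
From HB Require Import structures.
Require Import Defs.
From mathcomp Require Import all_boot all_order all_algebra.
From mathcomp Require Import all_classical all_reals all_analysis.
From mathcomp Require Import complex.
From mathcomp Require Import ring lra.
Import Defs.

(** Existence of the C*-algebras. The functions in [Qalg] are finite sums of
    elementary functions, carried by a compact subset of one bisection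
    ([Qalg_rect]); elementary functions are stable under convolution and
    involution, and since a product of two of them has a single term in each
    convolution sum, the *-algebra laws hold on them by inspection and extend
    by additivity. If [h] is elementary, then [f = h^* h] is a function on the
    units with values in some [[0, N]], and [z = f + i sqrt (f (N - f))] satisfies
    [z^* z = N f] and [f = (z + z^* ) / 2]. So [p f ^ 2 <= p z ^ 2 = N p f], that is
    [p h ^ 2 = p f <= N], for every C*-seminorm [p] ([elementary_csn_le]). Hence
    the supremum of all C*-seminorms is finite, and it is again a C*-seminorm. It
    is a norm, because evaluation at a unit [u] is a positive functional whose
    representation, the regular representation on the arrows with domain [u],
    gives a C*-seminorm that sees the values of a function on these arrows
    ([unit_seminorm_neq0]). The completion for this norm, made of Cauchy
    sequences modulo null sequences, is the C*-algebra of the groupoid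
    ([full_groupoid_cstar]): a *-homomorphism from [Qalg] to a C*-algebra is
    contractive for the supremum, so it extends.

    Uniqueness of the extension uses that a *-homomorphism of C*-algebras is
    automatically continuous, which follows from the same circle argument inside
    a C*-algebra: for a self-adjoint [a] of norm less than one, with
    [t = 1 - sqrt (1 - a ^ 2)] obtained as a fixed point, the element
    [w = a ^ 2 + i a (1 - t)] satisfies [w^* w = a ^ 2] and has real part [a ^ 2],
    so that every C*-seminorm is at most one at [a] ([cseminorm_le]).

    Functoriality. Pullback along the fibrewise bijective leg sends elementary
    functions to elementary functions because the leg is proper on units, and
    is multiplicative because it reindexes convolution sums. The other leg is a
    local homeomorphism that is injective on bisections and reflects
    composability, as it is open and injective on units; so pushforward is
    a *-homomorphism as well. Composition of couples is respected because
    pushing forward and then pulling back is the same as pulling back and then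
    pushing forward through the fibre product ([pullback_pushforward]), and
    equivalent couples give the same map on functions by reindexing
    ([couple_fun_equiv]). Each identity between maps of C*-algebras is checked
    on [Qalg], where the universal property determines them. *)

Set Implicit Arguments.
Unset Strict Implicit.
Unset Printing Implicit Defensive.

Import Order.TTheory GRing.Theory Num.Theory numFieldNormedType.Exports.

Local Open Scope classical_set_scope.
Local Open Scope ring_scope.

(** * Norms and C*-seminorms *)

Section RealNorm.
Variables (R : realType) (V : normedModType R[i]).
Implicit Types (x y : V) (z : R[i]).

(** Norms here take values in [R[i]]; suprema and limits are taken of the
    underlying real number. *)
Definition rnorm x : R := complex.Re `|x|.

Lemma rnormE x : `|x| = (real_complex R (rnorm x)).
Proof. by rewrite /rnorm RRe_real // ger0_real. Qed.

Lemma rnorm_ge0 x : 0 <= rnorm x.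
Proof. by rewrite -ler0c -rnormE. Qed.

Lemma ler_rnormD x y : rnorm (x + y) <= rnorm x + rnorm y.
Proof. by rewrite -lecR rmorphD /= -!rnormE ler_normD. Qed.

Lemma rnorm0_eq0 x : rnorm x = 0 -> x = 0.
Proof. by move=> x0; apply/normr0_eq0; rewrite rnormE x0. Qed.

Lemma rnorm0 : rnorm 0 = 0.
Proof. by apply: complexI; rewrite -rnormE normr0. Qed.

Lemma rnormN x : rnorm (- x) = rnorm x.
Proof. by rewrite /rnorm normrN. Qed.

Lemma rnormB x y : rnorm (x - y) = rnorm (y - x).
Proof. by rewrite -rnormN opprB. Qed.

Lemma cvg_rnormP (T : Type) (F : set_system T) {FF : Filter F} (f : T -> V) l :
  f @ F --> l <-> forall e : R, 0 < e -> \forall t \near F, rnorm (l - f t) < e.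
Proof.
split=> [fl e e0|fl].
  have e0' : 0 < real_complex R e by rewrite -(rmorph0 (real_complex R)) ltcR.
  have /cvgrPdist_lt/(_ _ e0') := fl; apply: filterS => t.
  by rewrite rnormE ltcR.
apply/cvgrPdist_lt => e e0.
have eE : e = real_complex R (complex.Re e) by rewrite RRe_real // gtr0_real.
have e0' : 0 < complex.Re e by rewrite -ltcR -eE.
by apply: filterS (fl _ e0') => t; rewrite rnormE eE ltcR.
Qed.

End RealNorm.

Section RealNormZ.
Variables (R : realType) (V : normedModType R[i]).

Lemma rnormZ (z : R[i]) (x : V) : rnorm (z *: x) = rnorm z * rnorm x.
Proof. by apply: complexI; rewrite rmorphM /= -!rnormE normrZ. Qed.

End RealNormZ.

(** The algebraic part of a C*-algebra. It is shared by C*-algebras and by the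
    convolution algebra of a groupoid. *)
Record star_algebra (R : realType) := StarAlgebra {
  sa_space :> lmodType R[i];
  smul : sa_space -> sa_space -> sa_space;
  sstar : sa_space -> sa_space;
  smulA : associative smul;
  smulDl : left_distributive smul +%R;
  smulDr : right_distributive smul +%R;
  smulZl : forall (z : R[i]) x y, smul (z *: x) y = z *: smul x y;
  smulZr : forall (z : R[i]) x y, smul x (z *: y) = z *: smul x y;
  sstarK : involutive sstar;
  sstarD : {morph sstar : x y / x + y};
  sstarZ : forall (z : R[i]) x, sstar (z *: x) = z^* *: sstar x;
  sstarM : forall x y, sstar (smul x y) = smul (sstar y) (sstar x)
}.

Section StarAlgebraTheory.
Variables (R : realType) (A : star_algebra R).
Implicit Types x y z : A.

Lemma smulBl x y z : smul (x - y) z = smul x z - smul y z.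
Proof. by rewrite smulDl -[- y]scaleN1r smulZl scaleN1r. Qed.

Lemma smulBr x y z : smul z (x - y) = smul z x - smul z y.
Proof. by rewrite smulDr -[- y]scaleN1r smulZr scaleN1r. Qed.

Lemma sstarB : {morph @sstar R A : x y / x - y}.
Proof.
by move=> x y; rewrite sstarD -[- y]scaleN1r sstarZ rmorphN rmorph1 scaleN1r.
Qed.

End StarAlgebraTheory.

Record cstar_seminorm (R : realType) (A : star_algebra R) (p : A -> R) :
    Prop := CstarSeminorm {
  csnD : forall x y, p (x + y) <= p x + p y;
  csnZ : forall (z : R[i]) x, p (z *: x) = rnorm z * p x;
  csnM : forall x y, p (smul x y) <= p x * p y;
  csn_star : forall x, p (smul (sstar x) x) = p x ^+ 2
}.

Section CstarSeminormTheory.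
Variables (R : realType) (A : star_algebra R) (p : A -> R).
Hypothesis pC : cstar_seminorm p.
Implicit Types x y : A.

Lemma csn0 : p 0 = 0.
Proof. by rewrite -(scale0r (0 : A)) (csnZ pC) rnorm0 mul0r. Qed.

Lemma csnN x : p (- x) = p x.
Proof. by rewrite -scaleN1r (csnZ pC) rnormN /rnorm normr1 mul1r. Qed.

Lemma csnB x y : p (x - y) = p (y - x).
Proof. by rewrite -csnN opprB. Qed.

Lemma csn_ge0 x : 0 <= p x.
Proof.
have := csnD pC x (- x); rewrite subrr csn0 csnN => h; lra.
Qed.

Lemma csnBD x y z : p (x - z) <= p (x - y) + p (y - z).
Proof. by rewrite (le_trans _ (csnD pC _ _)) // addrA subrK. Qed.

Lemma csn_dist x y : `|p x - p y| <= p (x - y).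
Proof.
rewrite ler_norml; apply/andP; split.
  rewrite -subr_ge0 opprK addrAC subr_ge0 csnB.
  by rewrite (le_trans _ (csnD pC _ _)) // addrC subrK.
rewrite lerBlDr; apply: le_trans (csnD pC _ _).
by rewrite subrK.
Qed.

(** From [p x ^ 2 = p (x^* x) <= p (x^* ) p x], used for [x] and for [x^*]. *)
Lemma csn_sstar x : p (sstar x) = p x.
Proof.
suff le_star y : p y <= p (sstar y).
  by apply/eqP; rewrite eq_le le_star -{2}[x]sstarK le_star.
have := csnM pC (sstar y) y; rewrite (csn_star pC) expr2.
have := csn_ge0 y; rewrite le_eqVlt => /orP[/eqP <- _|y0]; first exact: csn_ge0.
by rewrite ler_pM2r.
Qed.

End CstarSeminormTheory.

Lemma cvgMC (R : realType) (T : Type) (F : set_system T) {FF : Filter F}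
    (f h : T -> R[i]) (a b : R[i]) :
  f @ F --> a -> h @ F --> b -> (fun t => f t * h t) @ F --> a * b.
Proof. by move=> fa hb; exact: (@cvgM R[i] T F _ f h a b fa hb). Qed.

Lemma cvgDC (R : realType) (T : Type) (F : set_system T) {FF : Filter F}
    (f h : T -> R[i]) (a b : R[i]) :
  f @ F --> a -> h @ F --> b -> (fun t => f t + h t) @ F --> a + b.
Proof. by move=> fa hb; exact: (@cvgD R[i] R[i] T F _ f h a b fa hb). Qed.

Lemma cvgBC (R : realType) (T : Type) (F : set_system T) {FF : Filter F}
    (f h : T -> R[i]) (a b : R[i]) :
  f @ F --> a -> h @ F --> b -> (fun t => f t - h t) @ F --> a - b.
Proof. by move=> fa hb; exact: (@cvgB R[i] R[i] T F _ f h a b fa hb). Qed.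

Lemma cvg_real_complex (R : realType) (T : Type) (F : set_system T) {FF : Filter F}
    (f : T -> R) (a : R) :
  f @ F --> a -> (fun t => real_complex R (f t)) @ F --> real_complex R a.
Proof.
move=> fa; apply/cvg_rnormP => e e0.
have /cvgrPdist_lt/(_ _ e0) := fa; apply: filterS => t.
by rewrite -rmorphB /rnorm normc_def /= expr0n addr0 sqrtr_sqr.
Qed.

Lemma cvg_Re (R : realType) (T : Type) (F : set_system T) {FF : Filter F}
    (f : T -> R[i]) (a : R[i]) :
  f @ F --> a -> (fun t => complex.Re (f t)) @ F --> complex.Re a.
Proof.
move=> /cvg_rnormP fa; apply/cvgrPdist_lt => e /fa; apply: filterS => t.
apply: le_lt_trans; rewrite -lecR -rnormE -raddfB; exact: normc_ge_Re.
Qed.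

Lemma cvg_conjC (R : realType) (T : Type) (F : set_system T) {FF : Filter F} (f : T -> R[i]) (a : R[i]) :
  f @ F --> a -> (fun t => (f t)^*) @ F --> a^*.
Proof.
move=> /cvg_rnormP fa; apply/cvg_rnormP => e /fa; apply: filterS => t.
by rewrite -rmorphB /rnorm norm_conjC.
Qed.

(** Lets the value at [g] be computed after the limit. *)
Lemma continuous_at_lim (R : realType) (X : topologicalType) (h : X -> R[i])
    (g : X) (l : R[i]) : h @ g --> l -> l = h g -> {for g, continuous h}.
Proof. by move=> hl lE; rewrite lE in hl; exact: hl. Qed.

(** * Completion of a *-algebra in a C*-seminorm *)


(** Bundling a seminorm with its axioms lets the completion, a type depending
    on both, carry canonical instances. *)
Record cseminorm (R : realType) (A : star_algebra R) := Cseminorm {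
  csn_fun :> A -> R;
  csnP : cstar_seminorm csn_fun
}.

Section Completion.
Local Open Scope quotient_scope.
Variables (R : realType) (A : star_algebra R) (p : cseminorm A).
Let pC : cstar_seminorm p := csnP p.

(** One-index form of the Cauchy condition: such conditions combine by
    intersecting sets of indices, with no double limits. *)
Definition cauchy_seq : {pred (nat -> A)} := fun u =>
  `[< forall e : R, 0 < e -> exists a, \forall n \near \oo, p (u n - a) < e >].

Lemma cauchy_seqP (u : nat -> A) : reflect
  (forall e : R, 0 < e -> exists a, \forall n \near \oo, p (u n - a) < e)
  (u \in cauchy_seq).
Proof. exact: asboolP. Qed.

Lemma cauchy_cst (a : A) : (fun=> a) \in cauchy_seq.
Proof.
apply/cauchy_seqP => e e0; exists a; apply: nearW => n.
by rewrite subrr (csn0 pC).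
Qed.

Lemma cauchy_seq_submod : submod_closed cauchy_seq.
Proof.
split; first exact: cauchy_cst.
move=> z u v /cauchy_seqP cu /cauchy_seqP cv; apply/cauchy_seqP => e e0.
have z0 := rnorm_ge0 z.
have [|a ua] := cu (e / 2 / (rnorm z + 1)).
  by rewrite !divr_gt0 // ltr_wpDl.
have [|b vb] := cv (e / 2); first by rewrite divr_gt0.
exists (z *: a + b); apply: filterS2 ua vb => n ua vb.
have -> : (z *: u + v) n - (z *: a + b) = z *: (u n - a) + (v n - b).
  by rewrite scalerBr opprD addrACA.
apply: le_lt_trans (csnD pC _ _) _; rewrite (csnZ pC).
suff : rnorm z * p (u n - a) <= e / 2 by move=> h; lra.
rewrite ltr_pdivlMr ?ltr_wpDl // in ua; apply: le_trans (ltW ua).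
by rewrite mulrC ler_wpM2l ?lerDl // csn_ge0.
Qed.

HB.instance Definition _ :=
  GRing.isSubmodClosed.Build R[i] (nat -> A) cauchy_seq cauchy_seq_submod.

Definition cauchySeq := {u : nat -> A | u \in cauchy_seq}.
HB.instance Definition _ := SubChoice.on cauchySeq.
HB.instance Definition _ := [SubChoice_isSubLmodule of cauchySeq by <:].

Implicit Types u v w : cauchySeq.

Definition limp u : R := lim (p (val u n) @[n --> \oo]).

Lemma cauchy_seq_cvg u : p (val u n) @[n --> \oo] --> limp u.
Proof.
apply/cauchy_cvgP; apply: cauchy_exP => e e0.
have /cauchy_seqP/(_ _ e0)[a ua] := valP u; exists (p a).
apply: filterS ua => n; apply: le_lt_trans.
by rewrite distrC; exact: (csn_dist pC).
Qed.

Lemma limpE u l : p (val u n) @[n --> \oo] --> l -> limp u = l.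
Proof. by move=> /cvg_lim; apply. Qed.

Lemma limp_ge0 u : 0 <= limp u.
Proof.
apply: (cvgr_to_ge (@cauchy_seq_cvg u)); apply: nearW => n; exact: csn_ge0.
Qed.

Lemma limp_le u l : (\forall n \near \oo, p (val u n) <= l) -> limp u <= l.
Proof. exact: (cvgr_to_le (@cauchy_seq_cvg u)). Qed.

Lemma limpD u v : limp (u + v) <= limp u + limp v.
Proof.
apply: (ler_cvg_to (@cauchy_seq_cvg _)).
  exact: cvgD (@cauchy_seq_cvg u) (@cauchy_seq_cvg v).
by apply: nearW => n; exact: (csnD pC).
Qed.

Lemma limpZ (z : R[i]) u : limp (z *: u) = rnorm z * limp u.
Proof.
apply: limpE; rewrite (_ : (fun n => _) = (fun n => rnorm z * p (val u n))).
  exact: cvgMl_tmp (@cauchy_seq_cvg u).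
by apply/funext => n; exact: (csnZ pC).
Qed.

Lemma limp0 : limp 0 = 0.
Proof. by rewrite -(scale0r 0) limpZ rnorm0 mul0r. Qed.

Lemma limpN u : limp (- u) = limp u.
Proof. by rewrite -scaleN1r limpZ rnormN /rnorm normr1 mul1r. Qed.

Lemma limpB u v : limp (u - v) = limp (v - u).
Proof. by rewrite -limpN opprB. Qed.

Lemma limpBD u v w : limp (u - w) <= limp (u - v) + limp (v - w).
Proof. by rewrite (le_trans _ (limpD _ _)) // addrA subrK. Qed.

Definition null_dist : rel cauchySeq := fun u v => limp (u - v) == 0.

Lemma null_dist_equiv : equiv_class_of null_dist.
Proof.
split=> [u|u v|v u w].
- by rewrite /null_dist subrr limp0.
- by rewrite /null_dist limpB.
- move=> /eqP uv /eqP vw; apply/eqP/le_anti; rewrite limp_ge0 andbT.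
  by rewrite (le_trans (limpBD u v w)) // uv vw addr0.
Qed.

Definition null_dist_rel : equiv_rel cauchySeq :=
  EquivRelPack null_dist_equiv.

Definition cpl := {eq_quot null_dist_rel}.
HB.instance Definition _ := Choice.on cpl.
HB.instance Definition _ := EqQuotient.on cpl.

Definition ccl u : cpl := \pi_cpl u.

Lemma ccl_eq u v : ccl u = ccl v <-> limp (u - v) = 0.
Proof.
by rewrite /ccl; split=> [/eqquotP/eqP|uv] //; apply/eqquotP/eqP.
Qed.

Lemma limp_repr u : limp (repr (ccl u) - u) = 0.
Proof. by apply/ccl_eq; rewrite /ccl reprK. Qed.

Lemma limp_eq u v : limp (u - v) = 0 -> limp u = limp v.
Proof.
move=> uv; apply/le_anti/andP; split.
  by have := limpD (u - v) v; rewrite subrK uv add0r.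
by have := limpD (v - u) u; rewrite subrK limpB uv add0r.
Qed.

Lemma ccl_ind (P : cpl -> Prop) : (forall u, P (ccl u)) -> forall x, P x.
Proof. by move=> Pu x; rewrite -[x]reprK; exact: Pu. Qed.

Definition cpl_add (x y : cpl) : cpl := ccl (repr x + repr y).
Definition cpl_opp (x : cpl) : cpl := ccl (- repr x).
Definition cpl_scale (z : R[i]) (x : cpl) : cpl := ccl (z *: repr x).

Lemma ccl_add u v : cpl_add (ccl u) (ccl v) = ccl (u + v).
Proof.
apply/ccl_eq/le_anti; rewrite limp_ge0 andbT opprD addrACA.
by rewrite (le_trans (limpD _ _)) // !limp_repr addr0.
Qed.

Lemma ccl_opp u : cpl_opp (ccl u) = ccl (- u).
Proof. by apply/ccl_eq; rewrite -opprD limpN limp_repr. Qed.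

Lemma ccl_scale z u : cpl_scale z (ccl u) = ccl (z *: u).
Proof. by apply/ccl_eq; rewrite -scalerBr limpZ limp_repr mulr0. Qed.

Lemma cpl_addA : associative cpl_add.
Proof.
elim/ccl_ind=> u; elim/ccl_ind=> v; elim/ccl_ind=> w.
by rewrite !ccl_add addrA.
Qed.

Lemma cpl_addC : commutative cpl_add.
Proof. by elim/ccl_ind=> u; elim/ccl_ind=> v; rewrite !ccl_add addrC. Qed.

Lemma cpl_add0 : left_id (ccl 0) cpl_add.
Proof. by elim/ccl_ind=> u; rewrite ccl_add add0r. Qed.

Lemma cpl_addN : left_inverse (ccl 0) cpl_opp cpl_add.
Proof. by elim/ccl_ind=> u; rewrite ccl_opp ccl_add addNr. Qed.

HB.instance Definition _ :=
  GRing.isZmodule.Build cpl cpl_addA cpl_addC cpl_add0 cpl_addN.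

Lemma cclD u v : ccl u + ccl v = ccl (u + v).
Proof. exact: ccl_add. Qed.

Lemma cclN u : - ccl u = ccl (- u).
Proof. exact: ccl_opp. Qed.

Lemma cclB u v : ccl u - ccl v = ccl (u - v).
Proof. by rewrite cclN cclD. Qed.

Lemma cpl_scaleA z z' x : cpl_scale z (cpl_scale z' x) = cpl_scale (z * z') x.
Proof. by elim/ccl_ind: x => u; rewrite !ccl_scale scalerA. Qed.

Lemma cpl_scale1 : left_id 1 cpl_scale.
Proof. by elim/ccl_ind=> u; rewrite ccl_scale scale1r. Qed.

Lemma cpl_scaleDr : right_distributive cpl_scale +%R.
Proof.
move=> z; elim/ccl_ind=> u; elim/ccl_ind=> v.
by rewrite !(cclD, ccl_scale) scalerDr.
Qed.

Lemma cpl_scaleDl x : {morph cpl_scale^~ x : z z' / z + z'}.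
Proof.
by elim/ccl_ind: x => u z z'; rewrite !ccl_scale cclD scalerDl.
Qed.

HB.instance Definition _ := GRing.Zmodule_isLmodule.Build R[i] cpl
  cpl_scaleA cpl_scale1 cpl_scaleDr cpl_scaleDl.

Lemma cclZ z u : z *: ccl u = ccl (z *: u).
Proof. exact: ccl_scale. Qed.

Definition cpl_norm (x : cpl) : R[i] := real_complex R (limp (repr x)).

Lemma ccl_norm u : cpl_norm (ccl u) = real_complex R (limp u).
Proof. by rewrite /cpl_norm (limp_eq (limp_repr u)). Qed.

Lemma cpl_normD x y : cpl_norm (x + y) <= cpl_norm x + cpl_norm y.
Proof.
elim/ccl_ind: x => u; elim/ccl_ind: y => v.
by rewrite cclD !ccl_norm -rmorphD /= lecR limpD.
Qed.

Lemma cpl_normZ z x : cpl_norm (z *: x) = `|z| * cpl_norm x.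
Proof.
by elim/ccl_ind: x => u; rewrite cclZ !ccl_norm limpZ rmorphM /= -rnormE.
Qed.

Lemma cpl_norm0_eq0 x : cpl_norm x = 0 -> x = 0.
Proof.
elim/ccl_ind: x => u; rewrite ccl_norm => /complexI u0.
by apply: (proj2 (ccl_eq u 0)); rewrite subr0.
Qed.

HB.instance Definition _ :=
  Lmodule_isNormed.Build R[i] cpl cpl_normD cpl_normZ cpl_norm0_eq0.

Lemma rnorm_ccl u : rnorm (ccl u) = limp u.
Proof. by apply: complexI; rewrite -rnormE -ccl_norm. Qed.

Definition cstS (a : A) : cauchySeq := exist _ (fun=> a) (cauchy_cst a).
Definition cpl_in (a : A) : cpl := ccl (cstS a).

Lemma limp_cst a : limp (cstS a) = p a.
Proof. by apply: limpE => /=; apply: cvg_cst. Qed.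

Lemma rnorm_cpl_in a : rnorm (cpl_in a) = p a.
Proof. by rewrite rnorm_ccl limp_cst. Qed.

Lemma cpl_inD : {morph cpl_in : a b / a + b}.
Proof. by move=> a b; rewrite /cpl_in cclD; congr ccl; apply: val_inj. Qed.

Lemma cpl_inZ z : {morph cpl_in : a / z *: a}.
Proof. by move=> a; rewrite /cpl_in cclZ; congr ccl; apply: val_inj. Qed.

Lemma cpl_inB : {morph cpl_in : a b / a - b}.
Proof. by move=> a b; rewrite /cpl_in cclB; congr ccl; apply: val_inj. Qed.

Lemma cpl_in_cvg u : cpl_in (val u n) @[n --> \oo] --> ccl u.
Proof.
apply/cvg_rnormP => e e0.
have e4 : 0 < e / 4 by lra.
have /cauchy_seqP/(_ _ e4)[a ua] := valP u.
apply: filterS (ua) => n una; rewrite cclB rnorm_ccl.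
suff /le_lt_trans : limp (u - cstS (val u n)) <= e / 2 by apply; lra.
apply: limp_le; apply: filterS ua => m uma.
have := csnBD pC (val u m) a (val u n); rewrite (csnB pC a) /= => h.
apply: le_trans h _; lra.
Qed.

Lemma cpl_in_dense x (e : R) : 0 < e -> exists a, rnorm (x - cpl_in a) < e.
Proof.
elim/ccl_ind: x => u e0; have /cvg_rnormP/(_ _ e0)[N _ uN] := @cpl_in_cvg u.
by exists (val u N); exact: uN N (leqnn N).
Qed.

(** For each [n], some element of the algebra has its ball of radius [2 / (n + 1)]
    in the Cauchy filter; these elements form a Cauchy sequence, whose class is
    the limit. *)
Lemma cpl_complete (F : set_system cpl) : ProperFilter F -> cauchy F -> cvg F.
Proof.
move=> FF cF; pose h n : R := n.+1%:R^-1.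
have h0 n : 0 < h n by rewrite invr_gt0.
have /choice[a Fa] n : exists a : A, F [set y | rnorm (y - cpl_in a) < 2 * h n].
  have h0' : 0 < real_complex R (h n) by rewrite -(rmorph0 (real_complex R)) ltcR.
  have [x Fx] := (cauchyP F).1 cF _ h0'.
  have [a xa] := cpl_in_dense x (h0 n); exists a.
  apply: filterS Fx => y; rewrite -ball_normE /= rnormE ltcR => xy.
  have := ler_rnormD (y - x) (x - cpl_in a).
  rewrite addrA subrK (rnormB y x) => /le_lt_trans; apply; lra.
have hN (e : R) : 0 < e -> \forall n \near \oo, h n < e.
  by move=> e0; exact: near_infty_natSinv_lt (PosNum e0).
have pa n m : p (a n - a m) < 2 * h n + 2 * h m.
  have [y [yn ym]] := filter_ex (filterI (Fa n) (Fa m)).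
  rewrite -rnorm_cpl_in cpl_inB.
  have := ler_rnormD (cpl_in (a n) - y) (y - cpl_in (a m)).
  by rewrite addrA subrK (rnormB _ y) => /le_lt_trans; apply; exact: ltrD yn ym.
have ca : a \in cauchy_seq.
  apply/cauchy_seqP => e e0.
  have e4 : 0 < e / 4 by lra.
  have [N _ hNe] := hN _ e4; exists (a N); apply: filterS (hN _ e4) => n hn.
  have := hNe N (leqnn _) => /= hn'.
  by apply: lt_trans (pa n N) _; lra.
apply/cvg_ex; exists (ccl (exist _ a ca)).
apply/(@cvg_rnormP _ _ _ F _ id) => e e0.
have e4 : 0 < e / 4 by lra.
have /cvg_rnormP/(_ _ e4) := @cpl_in_cvg (exist _ a ca).
move=> /filterI/(_ (hN _ e4))[N _ /(_ N (leqnn _))[/= xN hNe]].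
apply: filterS (Fa N) => y /= yN.
have := ler_rnormD (ccl (exist _ a ca) - cpl_in (a N)) (cpl_in (a N) - y).
rewrite addrA subrK (rnormB (cpl_in _) y) => /le_lt_trans; apply; lra.
Qed.

HB.instance Definition _ := Uniform_isComplete.Build cpl cpl_complete.

End Completion.

Section CompletionAlgebra.
Variables (R : realType) (A : star_algebra R) (p : cseminorm A).
Let pC : cstar_seminorm p := csnP p.
Implicit Types u v w : cauchySeq p.

(** [u v - a b = u (v - b) + (u - a) b], where [b] is chosen after a bound for [u]
    and [a] after [b]. *)
Lemma cauchy_seq_mul u v :
  (fun n => smul (val u n) (val v n)) \in cauchy_seq p.
Proof.
apply/cauchy_seqP => e e0.
have /cauchy_seqP/(_ _ ltr01)[a0 ua0] := valP u.
have M0 : 0 < p a0 + 1 by rewrite ltr_wpDl // csn_ge0.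
have [|b vb] := (cauchy_seqP p _ (valP v)) (e / 2 / (p a0 + 1)).
  by rewrite !divr_gt0.
have N0 : 0 < p b + 1 by rewrite ltr_wpDl // csn_ge0.
have [|a ua] := (cauchy_seqP p _ (valP u)) (e / 2 / (p b + 1)).
  by rewrite !divr_gt0.
exists (smul a b); apply: filterS3 ua0 ua vb => n ua0 ua vb.
rewrite ltr_pdivlMr // in vb; rewrite ltr_pdivlMr // in ua.
have -> : smul (val u n) (val v n) - smul a b =
    smul (val u n) (val v n - b) + smul (val u n - a) b.
  by rewrite smulBl smulBr addrA subrK.
apply: le_lt_trans (csnD pC _ _) _.
have h1 := csnM pC (val u n) (val v n - b).
have h2 := csnM pC (val u n - a) b.
have h3 : p (val u n) <= p a0 + 1.
  have := csnD pC (val u n - a0) a0; rewrite subrK => h; lra.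
have p1 := csn_ge0 pC (val v n - b); have p2 := csn_ge0 pC (val u n - a).
have p3 := csn_ge0 pC b.
nra.
Qed.

Definition mulS u v : cauchySeq p :=
  exist (fun s => s \in cauchy_seq p) _ (cauchy_seq_mul u v).

Lemma cauchy_seq_star u : (fun n => sstar (val u n)) \in cauchy_seq p.
Proof.
apply/cauchy_seqP => e e0; have [a ua] := (cauchy_seqP p _ (valP u)) _ e0.
by exists (sstar a); apply: filterS ua => n; rewrite -sstarB (csn_sstar pC).
Qed.

Definition starS u : cauchySeq p :=
  exist (fun s => s \in cauchy_seq p) _ (cauchy_seq_star u).

Lemma limpM u v : limp (mulS u v) <= limp u * limp v.
Proof.
apply: (ler_cvg_to (@cauchy_seq_cvg _ _ _ _)).
  exact: cvgM (@cauchy_seq_cvg _ _ _ u) (@cauchy_seq_cvg _ _ _ v).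
by apply: nearW => n; exact: (csnM pC).
Qed.

Lemma limp_star u : limp (starS u) = limp u.
Proof.
by apply: limpE => /=; under eq_fun do rewrite (csn_sstar pC); exact: cauchy_seq_cvg.
Qed.

Lemma limp_star_mul u : limp (mulS (starS u) u) = limp u ^+ 2.
Proof.
apply: limpE => /=; under eq_fun do rewrite (csn_star pC).
exact: cvgM (@cauchy_seq_cvg _ _ _ u) (@cauchy_seq_cvg _ _ _ u).
Qed.

Definition cpl_mul (x y : cpl p) : cpl p := ccl (mulS (repr x) (repr y)).
Definition cpl_star (x : cpl p) : cpl p := ccl (starS (repr x)).

Lemma cclM u v : cpl_mul (ccl u) (ccl v) = ccl (mulS u v).
Proof.
set u' := repr (ccl u); set v' := repr (ccl v).
apply/ccl_eq; rewrite (_ : _ - _ = mulS (u' - u) v' + mulS u (v' - v)).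
  apply/le_anti; rewrite limp_ge0 andbT (le_trans (limpD _ _)) //.
  have h1 := limpM (u' - u) v'; have h2 := limpM u (v' - v).
  by move: h1 h2; rewrite !limp_repr mulr0 mul0r => h1 h2; lra.
apply: val_inj; apply/funext => n /=.
rewrite /GRing.add /GRing.opp /=.
by rewrite smulBl smulBr addrA subrK.
Qed.

Lemma ccl_star u : cpl_star (ccl u) = ccl (starS u).
Proof.
apply/ccl_eq; rewrite (_ : _ - _ = starS (repr (ccl u) - u)).
  by rewrite limp_star limp_repr.
by apply: val_inj; apply/funext => n /=; rewrite sstarB.
Qed.

Lemma cpl_mulA : associative cpl_mul.
Proof.
elim/ccl_ind=> u; elim/ccl_ind=> v; elim/ccl_ind=> w; rewrite !cclM.
by congr ccl; apply: val_inj; apply/funext => n /=; rewrite smulA.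
Qed.

Lemma cpl_mulDl : left_distributive cpl_mul +%R.
Proof.
elim/ccl_ind=> u; elim/ccl_ind=> v; elim/ccl_ind=> w; rewrite cclD !cclM cclD.
by congr ccl; apply: val_inj; apply/funext => n /=; rewrite smulDl.
Qed.

Lemma cpl_mulDr : right_distributive cpl_mul +%R.
Proof.
elim/ccl_ind=> u; elim/ccl_ind=> v; elim/ccl_ind=> w; rewrite cclD !cclM cclD.
by congr ccl; apply: val_inj; apply/funext => n /=; rewrite smulDr.
Qed.

Lemma cpl_mulZl (z : R[i]) x y : cpl_mul (z *: x) y = z *: cpl_mul x y.
Proof.
elim/ccl_ind: x => u; elim/ccl_ind: y => v; rewrite cclZ !cclM cclZ.
by congr ccl; apply: val_inj; apply/funext => n /=; rewrite smulZl.
Qed.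

Lemma cpl_mulZr (z : R[i]) x y : cpl_mul x (z *: y) = z *: cpl_mul x y.
Proof.
elim/ccl_ind: x => u; elim/ccl_ind: y => v; rewrite cclZ !cclM cclZ.
by congr ccl; apply: val_inj; apply/funext => n /=; rewrite smulZr.
Qed.

Lemma cpl_starK : involutive cpl_star.
Proof.
elim/ccl_ind=> u; rewrite !ccl_star.
by congr ccl; apply: val_inj; apply/funext => n /=; rewrite sstarK.
Qed.

Lemma cpl_starD : {morph cpl_star : x y / x + y}.
Proof.
elim/ccl_ind=> u; elim/ccl_ind=> v; rewrite cclD !ccl_star cclD.
by congr ccl; apply: val_inj; apply/funext => n /=; rewrite sstarD.
Qed.

Lemma cpl_starZ (z : R[i]) x : cpl_star (z *: x) = z^* *: cpl_star x.
Proof.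
elim/ccl_ind: x => u; rewrite cclZ !ccl_star cclZ.
by congr ccl; apply: val_inj; apply/funext => n /=; rewrite sstarZ.
Qed.

Lemma cpl_starM x y : cpl_star (cpl_mul x y) = cpl_mul (cpl_star y) (cpl_star x).
Proof.
elim/ccl_ind: x => u; elim/ccl_ind: y => v; rewrite cclM !ccl_star cclM.
by congr ccl; apply: val_inj; apply/funext => n /=; rewrite sstarM.
Qed.

Lemma cpl_normM x y : `|cpl_mul x y| <= `|x| * `|y|.
Proof.
elim/ccl_ind: x => u; elim/ccl_ind: y => v.
by rewrite cclM !rnormE !rnorm_ccl -rmorphM /= lecR limpM.
Qed.

Lemma cpl_norm_star x : `|cpl_mul (cpl_star x) x| = `|x| ^+ 2.
Proof.
elim/ccl_ind: x => u.
by rewrite ccl_star cclM !rnormE !rnorm_ccl limp_star_mul rmorphXn.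
Qed.

Definition completion : cstar_algebra R :=
  @CstarAlgebra R (cpl p) cpl_mul cpl_star cpl_mulA cpl_mulDl cpl_mulDr
    cpl_mulZl cpl_mulZr cpl_starK cpl_starD cpl_starZ cpl_starM
    cpl_normM cpl_norm_star.

Lemma cpl_inM a b : cpl_in p (smul a b) = cmul (cpl_in p a : completion) (cpl_in p b).
Proof. by rewrite /cmul /= cclM; congr ccl; exact: val_inj. Qed.

Lemma cpl_in_star a : cpl_in p (sstar a) = cstar (cpl_in p a : completion).
Proof. by rewrite /cstar /= ccl_star; congr ccl; exact: val_inj. Qed.

End CompletionAlgebra.

(** * Automatic continuity of *-homomorphisms *)

Section GeometricCauchy.
Variables (R : realType) (V : completeNormedModType R[i]).

Lemma geometric_cvg (u : nat -> V) (r : R) : 0 <= r < 1 ->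
  (forall n, rnorm (u n.+1 - u n) <= r ^+ n) -> cvg (u n @[n --> \oo]).
Proof.
move=> /andP[r0 r1] ur; have s0 : 0 < 1 - r by lra.
have um n m : rnorm (u (n + m)%N - u n) <= (r ^+ n - r ^+ (n + m)) / (1 - r).
  elim: m => [|m IH]; first by rewrite addn0 !subrr rnorm0 mul0r.
  rewrite addnS; have := ler_rnormD (u (n + m).+1 - u (n + m)%N) (u (n + m)%N - u n).
  rewrite addrA subrK => /le_trans; apply.
  apply: (le_trans (lerD (ur _) IH)).
  rewrite ler_pdivlMr // mulrDl divfK ?gt_eqF // exprS.
  by rewrite le_eqVlt; apply/orP; left; apply/eqP; ring.
apply/cauchy_cvgP; apply: cauchy_exP => e e0.
have eE : e = real_complex R (complex.Re e) by rewrite RRe_real // gtr0_real.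
have e0' : 0 < complex.Re e by rewrite -ltcR -eE.
have rr : `|r| < 1 by rewrite ger0_norm.
have /cvgrPdist_lt/(_ _ (mulr_gt0 e0' s0))[N _ rN] := cvg_expr rr.
exists (u N); exists N => // n /= Nn.
rewrite -ball_normE /= rnormE eE ltcR rnormB -(subnKC Nn).
apply: le_lt_trans (um _ _) _; rewrite ltr_pdivrMr //.
have := rN N (leqnn N); rewrite /= sub0r normrN ger0_norm ?exprn_ge0 //.
by apply: le_lt_trans; rewrite lerBlDr lerDl exprn_ge0.
Qed.

End GeometricCauchy.

Section AutomaticContinuity.
Variables (R : realType) (A : cstar_algebra R).
Implicit Types (a b t x y : A) (z : R[i]).

Definition cstar_sa : star_algebra R :=
  StarAlgebra (@cmulA R A) (@cmulDl R A) (@cmulDr R A) (@cmulZl R A)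
    (@cmulZr R A) (@cstarK R A) (@cstarD R A) (@cstarZ R A) (@cstarM R A).

Lemma rnorm_cstar : cstar_seminorm (@rnorm R A : cstar_sa -> R).
Proof.
split.
- exact: ler_rnormD.
- exact: rnormZ.
- move=> x y; rewrite -lecR rmorphM /= -!rnormE; exact: cnormM.
- by move=> x; apply: complexI; rewrite rmorphXn /= -!rnormE; exact: cnorm_star.
Qed.

Lemma rnorm_star x : rnorm (cstar x) = rnorm x.
Proof. exact: (csn_sstar rnorm_cstar). Qed.

Lemma rnormM x y : rnorm (cmul x y) <= rnorm x * rnorm y.
Proof. exact: (csnM rnorm_cstar). Qed.

Lemma cmulBl x y t : cmul (x - y) t = cmul x t - cmul y t.
Proof. exact: (@smulBl _ cstar_sa). Qed.

Lemma cmulBr x y t : cmul t (x - y) = cmul t x - cmul t y.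
Proof. exact: (@smulBr _ cstar_sa). Qed.

Lemma cstarB x y : cstar (x - y) = cstar x - cstar y.
Proof. exact: (@sstarB _ cstar_sa). Qed.

Lemma rnorm_small x : (forall e, 0 < e -> rnorm x <= e) -> x = 0.
Proof.
move=> xe; apply: rnorm0_eq0; apply/le_anti; rewrite rnorm_ge0 andbT.
by apply/ler_addgt0Pr => e e0; rewrite add0r xe.
Qed.

(** The element [1 - sqrt (1 - a ^ 2)], obtained without a unit or power series
    as the attracting fixed point of [t |-> (a ^ 2 + t ^ 2) / 2]. *)
Lemma one_minus_sqrt a : cstar a = a -> rnorm a < 1 ->
  exists t, [/\ cstar t = t, cmul a t = cmul t a &
    t = 2^-1 *: (cmul a a + cmul t t)].
Proof.
move=> sa r1; set r := rnorm a in r1; have r0 : 0 <= r := rnorm_ge0 a.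
pose f t := 2^-1 *: (cmul a a + cmul t t) : A.
pose u n := iter n f 0.
have half : rnorm (2^-1 : R[i]^o) = 2^-1 :> R.
  by apply: complexI; rewrite -rnormE normfV normr_nat fmorphV rmorph_nat.
have fB x y : rnorm x <= r -> rnorm y <= r ->
    rnorm (f x - f y) <= r * rnorm (x - y).
  move=> xr yr; rewrite /f -scalerBr opprD addrACA subrr add0r rnormZ half.
  have -> : cmul x x - cmul y y = cmul x (x - y) + cmul (x - y) y.
    by rewrite cmulBr cmulBl addrA subrK.
  have := ler_rnormD (cmul x (x - y)) (cmul (x - y) y).
  have := rnormM x (x - y); have := rnormM (x - y) y.
  have := rnorm_ge0 (x - y); nra.
have ur n : rnorm (u n) <= r.
  elim: n => [|n IH]; first by rewrite rnorm0.
  rewrite /= rnormZ half; have := ler_rnormD (cmul a a) (cmul (u n) (u n)).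
  have := rnormM a a; have := rnormM (u n) (u n); have := rnorm_ge0 (u n).
  rewrite -/r; nra.
have du n : rnorm (u n.+1 - u n) <= r ^+ n.
  elim: n => [|n IH]; last first.
    by rewrite exprS; apply: le_trans (fB (u n.+1) (u n) _ _) _ => //; rewrite ler_wpM2l.
  by rewrite subr0 expr0 (le_trans (ur 1%N)) // ltW.
have /cvg_ex[/= t ut] : cvg (u n @[n --> \oo]).
  by apply: (geometric_cvg (r := r)) => //; rewrite r0.
have ute e : 0 < e -> exists2 n, rnorm (u n - t) <= e & rnorm (u n.+1 - t) <= e.
  move=> e0; have /cvg_rnormP/(_ _ e0)[N _ uN] := ut.
  exists N; rewrite rnormB ltW //; first exact: uN (leqnn N).
  exact: uN (leqnSn N).
have su n : cstar (u n) = u n.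
  elim: n => [|n IH]; first by rewrite /u /= -(scale0r (0 : A)) cstarZ rmorph0 !scale0r.
  by rewrite /= /f cstarZ cstarD !cstarM sa IH fmorphV rmorph_nat.
have cu n : cmul a (u n) = cmul (u n) a.
  elim: n => [|n IH].
    by rewrite /u /= -(scale0r (0 : A)) cmulZl cmulZr !scale0r.
  rewrite /= /f cmulZl cmulZr cmulDl cmulDr -[cmul a (cmul _ _)]/(cmul a (cmul _ _)).
  by rewrite -[in RHS](cmulA (u n)) -IH !cmulA IH.
have tr : rnorm t <= r.
  apply/ler_addgt0Pr => e /ute[n un _].
  have := ler_rnormD (u n) (t - u n); rewrite addrC subrK (rnormB t).
  by move=> /le_trans; apply; apply: lerD.
exists t; split.
- apply/eqP; rewrite -subr_eq0; apply/eqP/rnorm_small => e e0.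
  have [|n un _] := ute (e / 2); first lra.
  have := ler_rnormD (cstar (t - u n)) (u n - t).
  rewrite cstarB su addrA subrK => /le_trans; apply.
  rewrite -{1}(su n) -cstarB rnorm_star (rnormB t); lra.
- apply/eqP; rewrite -subr_eq0; apply/eqP/rnorm_small => e e0.
  have [|n un _] := ute (e / 2); first lra.
  have := ler_rnormD (cmul a (t - u n)) (cmul (u n - t) a).
  rewrite cmulBr cmulBl cu addrA subrK => /le_trans; apply.
  rewrite -cu -cmulBr cu -cmulBl.
  have := rnormM a (t - u n); have := rnormM (u n - t) a.
  have := rnorm_ge0 (u n - t); rewrite (rnormB t) -/r; nra.
- apply/eqP; rewrite -subr_eq0; apply/eqP/rnorm_small => e e0.
  have [|n un un1] := ute (e / 2); first lra.
  have := ler_rnormD (t - u n.+1) (f (u n) - f t).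
  rewrite addrA subrK => /le_trans; apply.
  have := fB _ _ (ur n) tr; have := rnorm_ge0 (u n - t); rewrite (rnormB t).
  nra.
Qed.

Variable p : cstar_sa -> R.
Hypothesis pC : cstar_seminorm p.

(** With [t] as above, [w = a (a + i sqrt (1 - a ^ 2))] satisfies [w^* w = a ^ 2]
    and has real part [a ^ 2], so that [p a ^ 2 = p (a ^ 2) <= p w = p a]. *)
Lemma cseminorm_le1 a : cstar a = a -> rnorm a < 1 -> p a <= 1.
Proof.
move=> sa a1; have [t [st at_ tE]] := one_minus_sqrt sa a1.
have tE2 : cmul a a = 2 *: t - cmul t t.
  by rewrite {1}tE scalerA mulfV ?pnatr_eq0 // scale1r addrK.
pose x := a - cmul a t; pose b := cmul a a.
have sx : cstar x = x by rewrite /x cstarB cstarM sa st at_.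
have sb : cstar b = b by rewrite /b cstarM sa.
have ax : cmul a x = cmul x a by rewrite /x cmulBl cmulBr -cmulA -at_.
have bx : cmul b x = cmul x b by rewrite /b -cmulA ax !cmulA ax.
have xx : cmul x x = b - cmul b b.
  have bt : cmul (cmul a t) a = cmul b t by rewrite -cmulA -at_ cmulA.
  have btt : cmul (cmul a t) (cmul a t) = cmul b (cmul t t).
    by rewrite (cmulA (cmul a t)) bt cmulA.
  have att : cmul a (cmul a t) = cmul b t by rewrite cmulA.
  have -> : cmul b b = 2 *: cmul b t - cmul b (cmul t t).
    by rewrite -cmulZr -cmulBr -tE2.
  rewrite /x cmulBl !cmulBr btt bt att -/b scaler_nat mulr2n.
  by rewrite !opprB opprD -!addrA; congr (_ + _); exact: addrCA.
pose w := b + 'i *: x.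
have sw : cstar w = b - 'i *: x.
  by rewrite /w cstarD sb cstarZ sx conjCi scaleNr.
have ww : cmul (cstar w) w = b.
  rewrite sw /w cmulBl !cmulDr !(cmulZl, cmulZr) scalerA -expr2 sqrCi scaleN1r.
  by rewrite bx opprD opprK addrA addrK xx addrC subrK.
have pw : p w = p a.
  apply/eqP; rewrite -(eqrXn2 (_ : 0 < 2)%N) ?(csn_ge0 pC) // -!(csn_star pC).
  by rewrite /= ww sa.
have : p b <= p w.
  have bw : b = 2^-1 *: (w + cstar w).
    rewrite sw /w addrACA subrr addr0 -mulr2n -(@scaler_nat R[i] _ 2 b).
    by rewrite scalerA mulVf ?scale1r // pnatr_eq0.
  rewrite bw (csnZ pC) (_ : rnorm _ = 2^-1); last first.
    by apply: complexI; rewrite -rnormE normfV normr_nat fmorphV rmorph_nat.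
  have := csnD pC w (cstar w); have := csn_sstar pC w => /= ->.
  by move=> h; lra.
have := csn_star pC a; rewrite /= sa -/b pw => -> h.
have := csn_ge0 pC a; nra.
Qed.

(** The C*-identity reduces to self-adjoint elements, and rescaling to those of
    norm less than one. *)
Theorem cseminorm_le x : p x <= rnorm x.
Proof.
suff le_sa a : cstar a = a -> p a <= rnorm a.
  have := le_sa (cmul (cstar x) x); rewrite cstarM cstarK => /(_ erefl).
  rewrite (csn_star pC) (csn_star rnorm_cstar).
  by rewrite ler_pXn2r // nnegrE ?(csn_ge0 pC) ?rnorm_ge0.
move=> sa; apply/ler_addgt0Pr => e e0.
have r0 : 0 < rnorm a + e by rewrite ltr_wpDl // rnorm_ge0.
set r := rnorm a + e in r0 *.
have rE : rnorm (real_complex R r^-1 : R[i]^o) = r^-1.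
  by apply: complexI; rewrite -rnormE ger0_norm // ler0c invr_ge0 ltW.
have := @cseminorm_le1 (real_complex R r^-1 *: a).
rewrite cstarZ sa rnormZ rE (csnZ pC) rE.
have <- : real_complex R r^-1 = (real_complex R r^-1)^*.
  by apply/esym/conj_Creal/complex_realP; exists r^-1.
move=> /(_ erefl); rewrite mulrC ltr_pdivrMr // mul1r ltrDl => /(_ e0).
by rewrite mulrC ler_pdivrMr // mul1r.
Qed.

End AutomaticContinuity.

(** * The universal property of the completion *)

Section StarHomContinuity.
Variables (R : realType) (A B : cstar_algebra R) (f : star_hom A B).

Lemma star_homN x : f (- x) = - f x.
Proof. by rewrite -scaleN1r star_homZ scaleN1r. Qed.

Lemma star_homB x y : f (x - y) = f x - f y.
Proof. by rewrite star_homD star_homN. Qed.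

(** The norm of the target, pulled back along [f], is a C*-seminorm. *)
Lemma star_hom_contractive x : rnorm (f x) <= rnorm x.
Proof.
apply: (@cseminorm_le R A (fun y => rnorm (f y))).
have pB := rnorm_cstar B; split=> [y z|z y|y z|y] /=.
- by rewrite star_homD ler_rnormD.
- by rewrite star_homZ rnormZ.
- by rewrite star_homM; exact: (csnM pB).
- by rewrite star_homM star_hom_star; exact: (csn_star pB).
Qed.

Lemma star_hom_cvg (u : nat -> A) l :
  u n @[n --> \oo] --> l -> f (u n) @[n --> \oo] --> f l.
Proof.
move=> /cvg_rnormP ul; apply/cvg_rnormP => e /ul; apply: filterS => n.
by rewrite -star_homB; apply: le_lt_trans; exact: star_hom_contractive.
Qed.

End StarHomContinuity.

Section CstarContinuity.
Variables (R : realType) (A : cstar_algebra R).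

Lemma cstar_cvg (u : nat -> A) l :
  u n @[n --> \oo] --> l -> cstar (u n) @[n --> \oo] --> cstar l.
Proof.
move=> /cvg_rnormP ul; apply/cvg_rnormP => e /ul; apply: filterS => n.
by rewrite -cstarB rnorm_star.
Qed.

Lemma cmul_cvg (u v : nat -> A) a b :
  u n @[n --> \oo] --> a -> v n @[n --> \oo] --> b ->
  cmul (u n) (v n) @[n --> \oo] --> cmul a b.
Proof.
move=> /cvg_rnormP ua /cvg_rnormP vb; apply/cvg_rnormP => e e0.
have a1 : 0 < rnorm a + 1 by rewrite ltr_wpDl // rnorm_ge0.
have b1 : 0 < rnorm b + 1 by rewrite ltr_wpDl // rnorm_ge0.
have e1 : 0 < e / 2 / (rnorm b + 1) by rewrite !divr_gt0.
have e2 : 0 < e / 2 / (rnorm a + 1) by rewrite !divr_gt0.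
apply: filterS3 (ua _ e1) (vb _ e2) (vb _ ltr01) => n un vn v1.
rewrite ltr_pdivlMr // in un; rewrite ltr_pdivlMr // in vn.
have -> : cmul a b - cmul (u n) (v n) =
    cmul a (b - v n) + cmul (a - u n) (v n).
  by rewrite cmulBl cmulBr addrA subrK.
apply: le_lt_trans (ler_rnormD _ _) _.
have h3 := rnormM a (b - v n); have h4 := rnormM (a - u n) (v n).
have h5 : rnorm (v n) <= rnorm b + 1.
  have := ler_rnormD (v n - b) b; rewrite subrK rnormB => h; lra.
have p1 := rnorm_ge0 (a - u n); have p2 := rnorm_ge0 (b - v n).
nra.
Qed.

End CstarContinuity.

Section UniversalProperty.
Variables (R : realType) (A : star_algebra R) (p : cseminorm A).
Hypothesis pmax : forall q : A -> R, cstar_seminorm q -> forall a, q a <= p a.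
Variables (B : cstar_algebra R) (rho : A -> B).
Hypotheses (rhoD : {morph rho : x y / x + y})
  (rhoZ : forall (z : R[i]) x, rho (z *: x) = z *: rho x)
  (rhoM : forall x y, rho (smul x y) = cmul (rho x) (rho y))
  (rho_star : forall x, rho (sstar x) = cstar (rho x)).

Lemma rhoB x y : rho (x - y) = rho x - rho y.
Proof. by rewrite rhoD -scaleN1r rhoZ scaleN1r. Qed.

(** The norm of the image is one of the seminorms that [p] dominates. *)
Lemma rho_le a : rnorm (rho a) <= p a.
Proof.
apply: (@pmax (fun y => rnorm (rho y))).
have pB := rnorm_cstar B; split=> [y z|z y|y z|y] /=.
- by rewrite rhoD ler_rnormD.
- by rewrite rhoZ rnormZ.
- by rewrite rhoM; exact: (csnM pB).
- by rewrite rhoM rho_star; exact: (csn_star pB).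
Qed.

Lemma rho_cauchy_cvg (u : cauchySeq p) : cvg (rho (val u n) @[n --> \oo]).
Proof.
apply/cauchy_cvgP; apply: cauchy_exP => e e0.
have eE : e = real_complex R (complex.Re e) by rewrite RRe_real // gtr0_real.
have e0' : 0 < complex.Re e by rewrite -ltcR -eE.
have /cauchy_seqP/(_ _ e0')[a ua] := valP u; exists (rho a).
apply: filterS ua => n una; rewrite -ball_normE /= rnormE eE ltcR rnormB.
by rewrite -rhoB; apply: le_lt_trans una; exact: rho_le.
Qed.

Definition ext_fun (x : completion p) : B :=
  lim (rho (val (repr (x : cpl p)) n) @[n --> \oo]).

Lemma ext_cvg (u : cauchySeq p) :
  rho (val u n) @[n --> \oo] --> ext_fun (ccl u).
Proof.
set v := repr (ccl u).
have := @rho_cauchy_cvg v; rewrite -[cvg _]/(_ --> ext_fun (ccl u)).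
move=> /cvg_rnormP vl; apply/cvg_rnormP => e e0; have e2 : 0 < e / 2 by lra.
have : p (val (v - u) n) @[n --> \oo] --> 0.
  by rewrite -(limp_repr u); exact: cauchy_seq_cvg.
move=> /cvgrPdist_lt/(_ _ e2)/filterI/(_ (vl _ e2)); apply: filterS => n [].
rewrite sub0r normrN ger0_norm ?(csn_ge0 (csnP p)) // => h1 h2.
have := ler_rnormD (ext_fun (ccl u) - rho (val v n)) (rho (val v n) - rho (val u n)).
rewrite addrA subrK => /le_lt_trans; apply.
have := rho_le (val (v - u) n); rewrite rhoB /= in h1 *; lra.
Qed.

Lemma ext_unique (u : cauchySeq p) l :
  rho (val u n) @[n --> \oo] --> l -> ext_fun (ccl u) = l.
Proof. by move=> ul; apply: (@cvg_unique B (@norm_hausdorff _ _) _ _ _ _ (@ext_cvg u) ul). Qed.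

Definition ext_hom : star_hom (completion p) B.
Proof.
exists ext_fun.
- elim/ccl_ind=> u; elim/ccl_ind=> v; rewrite [ccl u + _]cclD.
  apply: ext_unique => /=; under eq_fun do rewrite rhoD.
  exact: cvgD (@ext_cvg u) (@ext_cvg v).
- move=> z; elim/ccl_ind=> u; rewrite [z *: _]cclZ.
  apply: ext_unique => /=; under eq_fun do rewrite rhoZ.
  exact: cvgZl_tmp (@ext_cvg u).
- elim/ccl_ind=> u; elim/ccl_ind=> v; rewrite [cmul _ _]cclM.
  apply: ext_unique => /=; under eq_fun do rewrite rhoM.
  exact: cmul_cvg (@ext_cvg u) (@ext_cvg v).
- elim/ccl_ind=> u; rewrite [cstar _]ccl_star.
  apply: ext_unique => /=; under eq_fun do rewrite rho_star.
  exact: cstar_cvg (@ext_cvg u).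
Defined.

(** The extension is the limit along Cauchy sequences. It is unique even among
    *-homomorphisms not assumed continuous, as these are contractive. *)
Theorem completion_universal :
  exists! r : star_hom (completion p) B, forall a, r (cpl_in p a) = rho a.
Proof.
exists ext_hom; split=> [a|r rE].
  by apply: (ext_unique (u := cstS p a)) => /=; apply: cvg_cst.
apply: star_hom_ext; elim/ccl_ind=> u; apply: ext_unique.
by under eq_fun do rewrite -rE; apply: star_hom_cvg; exact: cpl_in_cvg.
Qed.

End UniversalProperty.

(** * Plateau functions on locally compact Hausdorff spaces *)

Section Topology.

(** A compact neighbourhood and the complement of it, with the point at infinity
    added, separate a point from infinity. *)
Lemma opc_hausdorff (X : topologicalType) :
  locally_compact [set: X] -> hausdorff_space X ->
  hausdorff_space (one_point_compactification X).
Proof.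
move=> lcX hX.
have some_none (x : X) :
    ~ @cluster (one_point_compactification X) (nbhs (Some x : one_point_compactification X)) None.
  move=> xcl; have [K + [cK clK]] := lcX x I; rewrite withinET => xK.
  have [] := xcl (Some @` K) ((Some @` (~` K)) `|` [set None]).
  - exact: one_point_compactification_some_nbhs.
  - by exists K.
  by move=> _ [[y Ky <-] [[z Kz [zy]]|//]]; apply: Kz; rewrite zy.
move=> [x|] [y|] // xy.
- congr Some; apply: hX => A B xA yB.
  have [_ [[a Aa <-] [b Bb [ba]]]] := xy (Some @` A) (Some @` B)
    (one_point_compactification_some_nbhs _ _ xA)
    (one_point_compactification_some_nbhs _ _ yB).
  by exists a; split=> //; rewrite -ba.
- by case: (some_none x).
- case: (some_none y) => A B yA B0; rewrite setIC; exact: xy.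
Qed.

(** Urysohn's lemma in the one-point compactification, which is normal; the
    function it gives, zero at [x] and one far away, is then truncated between
    the levels [1 / 4] and [1 / 2]. *)
Lemma lcH_plateau (R : realType) (X : topologicalType) (x : X) (W : set X) :
  locally_compact [set: X] -> hausdorff_space X -> open W -> W x ->
  exists (chi : X -> R) (K : set X),
    [/\ continuous chi, compact K, K `<=` W, forall y, ~ K y -> chi y = 0 &
        \forall y \near x, chi y = 1].
Proof.
move=> lcX hX oW Wx; have hO := opc_hausdorff lcX hX.
have cO : compact [set: one_point_compactification X].
  exact: one_point_compactification_compact.
have crO := normal_completely_regular (compact_normal hO cO)
  (hausdorff_accessible hO).
have [K0 + [cK0 clK0]] := lcX x I; rewrite withinET => xK0.
pose W' := W `&` K0^°.
have oW' : open W' by apply: openI => //; exact: open_interior.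
have W'x : W' x by [].
have clB : @closed (one_point_compactification X) (~` (Some @` W')).
  by apply: open_closedC; exact: one_point_compactification_open_some.
have /uniform_separatorP-/(_ R)[f [cf f01 f0 f1]] :
    uniform_separator [set (Some x : one_point_compactification X)]
      (~` (Some @` W')).
  by apply: crO => //; apply; exists x.
pose g (y : X) : R := f (Some y).
have cg : continuous g.
  exact: (continuous_comp_fun (@one_point_compactification_some_continuous X) cf).
have gx : g x = 0 by apply: f0; exists (Some x).
have gW y : ~ W' y -> g y = 1.
  by move=> Wy; apply: f1; exists (Some y) => // -[z Wz [zy]]; apply: Wy; rewrite -zy.
pose chi : X -> R^o :=
  (fun=> 1 : R^o) \min ((fun=> 0 : R^o) \max (fun y => 2 - 4 * g y : R^o)).
exists chi, [set y | g y <= 1 / 2]; split.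
- move=> y; apply: (@continuous_min R X _ _ y); first exact: cvg_cst.
  apply: (@continuous_max R X _ _ y); first exact: cvg_cst.
  apply: cvgB; first exact: cvg_cst.
  by apply: cvgMl_tmp; exact: cg.
- apply: (subclosed_compact _ cK0).
    by apply: (@closed_comp _ _ g [set r | r <= 1 / 2]) => //; exact: closed_le.
  move=> y /= gy; have [[_ /interior_subset]|/gW g1] // := pselect (W' y); lra.
- by move=> y /= gy; have [[]|/gW g1] := pselect (W' y); [|lra].
- move=> y /= /negP; rewrite -ltNge => gy; rewrite /chi /= max_l ?min_r //; lra.
- have : \forall y \near x, g y < 1 / 4.
    have q0 : 0 < 1 / 4 :> R by lra.
    have /cvgrPdist_lt/(_ _ q0) := cg x; rewrite gx.
    by apply: filterS => y; rewrite sub0r normrN; apply: le_lt_trans; exact: ler_norm.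
  by apply: filterS => y gy; rewrite /chi /= max_r ?min_l //; lra.
Qed.

Lemma compact_val_preimage (X : topologicalType) (U S : set X) :
  S `<=` U -> compact S -> compact ((val : U -> X) @^-1` S).
Proof.
move=> SU cS F PF FS.
have [y [Sy cly]] : S `&` cluster ((val : U -> X) @ F) !=set0 by exact: cS.
pose x : U := exist _ y (mem_set (SU _ Sy)).
exists x; split=> // A B FA /nbhs_subtypeP[M yM MB].
have FjA : F (val @^-1` ((val : U -> X) @` A)).
  by apply: (filterS _ FA) => z Az; exists z.
by have [_ [[a Aa <-] Ma]] := cly _ _ FjA yM; exists a; split=> //; exact: MB.
Qed.

End Topology.

(** * Compact carriers and bisections *)

Section SupportedOn.
Variables (R : realType) (X : topologicalType).
Implicit Types (S U : set X) (f h : X -> R[i]).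

(** Membership in [Cc U] seen from the ambient space: continuity is only asked
    on the compact carrier, and then holds on every Hausdorff open set that
    contains it. *)
Definition supported_on S h :=
  [/\ compact S, forall g, S g -> {for g, continuous h} &
      forall g, ~ S g -> h g = 0].

Lemma open_val_nbhs U (W : set U) (x : U) :
  open U -> nbhs x W -> nbhs (val x) ((val : U -> X) @` W).
Proof.
move=> oU /nbhs_subtypeP[V xV VW].
have : nbhs (val x) (V `&` U).
  apply: filterI => //; apply: open_nbhs_nbhs; split=> //.
  exact/set_mem/valP.
apply: filterS => y [Vy Uy]; exists (exist _ y (mem_set Uy)) => //.
exact: VW.
Qed.

(** The restriction to the open set is continuous off the carrier as well,
    since a compact subset of a Hausdorff space is closed. *)
Lemma supported_on_near0 S U g : hausdorff_space (set_type U) -> open U ->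
  compact S -> S `<=` U -> U g -> ~ S g -> \forall y \near g, ~ S y.
Proof.
move=> hU oU cS SU Ug nSg; pose x : U := exist _ g (mem_set Ug).
have : closed ((val : U -> X) @^-1` S).
  by apply: compact_closed => //; exact: compact_val_preimage.
move=> /closed_openC oS.
have /open_val_nbhs : nbhs x (~` ((val : U -> X) @^-1` S)).
  by apply: open_nbhs_nbhs; split.
by move=> /(_ oU); apply: filterS => _ [y Sy <-].
Qed.

Lemma supported_on_continuous S U h g : hausdorff_space (set_type U) ->
  open U -> S `<=` U -> supported_on S h -> U g -> {for g, continuous h}.
Proof.
move=> hU oU SU [cS hS h0] Ug; have [|nSg] := pselect (S g); first exact: hS.
suff : h @ g --> (0 : R[i]) by rewrite -(h0 _ nSg).
apply: cvg_near_cst.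
by apply: filterS (supported_on_near0 hU oU cS SU Ug nSg) => y; exact: h0.
Qed.

Lemma CcP U f : open U -> hausdorff_space (set_type U) ->
  Cc U f <-> exists2 S, S `<=` U & supported_on S f.
Proof.
move=> oU hU; split=> [[f0 [cf cK fE fU]]|[S SU Sf]].
  exists (val @` closure [set x : U | f0 x != 0]).
    by move=> _ [x _ <-]; exact/set_mem/valP.
  split.
  - apply: continuous_compact => //.
    by apply: continuous_subspaceT; exact: val_continuous.
  - move=> _ [x _ <-] N; rewrite /= fE => /cf/(open_val_nbhs oU).
    by apply: filterS => _ [y Ny <-]; rewrite /preimage /= fE.
  - move=> g Sg; have [Ug|] := pselect (U g); last exact: fU.
    apply: contrapT => fg; apply: Sg; exists (exist _ g (mem_set Ug)) => //.
    apply: subset_closure => /=; apply/eqP => f0g; apply: fg.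
    by rewrite -f0g -fE.
have [cS fS f0] := Sf; exists (f \o val); split=> //.
- move=> x; apply: continuous_comp; first exact: val_continuous.
  by apply: (supported_on_continuous hU oU SU Sf); exact/set_mem/valP.
- have cS' : compact ((val : U -> X) @^-1` S) by exact: compact_val_preimage.
  apply: (subclosed_compact _ cS'); first exact: closed_closure.
  have clS : closed ((val : U -> X) @^-1` S) by exact: compact_closed.
  rewrite [X in _ `<=` X](closure_id _).1 //; apply: closureS => x /= fx.
  by apply: contrapT => /f0 fx0; rewrite fx0 eqxx in fx.
- by move=> g Ug; apply: f0 => /SU.
Qed.

End SupportedOn.

(** Compactness of the carrier, as a near-covering property along the filter of
    large real numbers. *)
Lemma supported_on_bounded (R : realType) (X : topologicalType) (S : set X) (h : X -> R[i]) :
  supported_on S h -> exists2 M, 0 <= M & forall g, rnorm (h g) <= M.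
Proof.
move=> [cS hS h0].
have PF : Filter (pinfty_nbhs R) by exact: filter_filter.
have := (compact_near_coveringP S).1 cS R (pinfty_nbhs R)
  (fun r x => rnorm (h x) <= r) PF.
case.
  move=> x Sx; exists ([set y | rnorm (h y) <= rnorm (h x) + 1],
      [set r | rnorm (h x) + 1 <= r]).
    split; last by apply: nbhs_pinfty_ge; exact: num_real.
    have /cvg_rnormP/(_ _ ltr01) := hS x Sx; apply: filterS => y /= hy.
    have := ler_rnormD (h y - h x) (h x); rewrite subrK rnormB; lra.
  by move=> [y r] /= [hy hr]; exact: le_trans hr.
move=> M [_ SM]; exists `|M + 1|%R => // g.
have [Sg|/h0 ->] := pselect (S g); last by rewrite rnorm0.
by apply: le_trans (ler_norm _); apply: SM => //; rewrite ltrDl.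
Qed.

Section GroupoidInverse.
Variable G : top_groupoid.
Implicit Types g h k : G.

Lemma ginvK : involutive (@inv G).
Proof.
move=> x; rewrite -[LHS]gmulr1 dom_inv rng_inv -gmulV gmulA ?dom_inv ?rng_inv //.
by rewrite gmulV dom_inv gmul1.
Qed.

Lemma ginvM g h : dom g = rng h -> inv (mul g h) = mul (inv h) (inv g).
Proof.
move=> gh; have e : dom (inv h) = rng (inv g) by rewrite dom_inv rng_inv.
have ei : dom (inv g) = rng (mul g h) by rewrite dom_inv rng_mul.
have e1 : dom (mul (inv h) (inv g)) = rng (mul g h) by rewrite dom_mul.
have e3 : mul (inv g) (mul g h) = h.
  by rewrite gmulA ?dom_inv // gmulV gh gmul1.
have e2 : mul (mul (inv h) (inv g)) (mul g h) = dom h.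
  by rewrite -gmulA // e3 gmulV.
rewrite -[RHS]gmulr1 e1 -gmulrV gmulA ?rng_inv // e2 -(dom_mul gh).
by rewrite -(rng_inv (mul g h)) gmul1.
Qed.

Lemma dom_unitE g : dom g = g -> rng g = g.
Proof. by move=> <-; exact: rng_dom. Qed.

Lemma inv_unit g : dom g = g -> inv g = g.
Proof.
move=> gu; have ru := dom_unitE gu.
by rewrite -[inv g]gmulr1 dom_inv ru gmulV.
Qed.

End GroupoidInverse.

Section Bisection.
Variable G : etale_groupoid.
Implicit Types (B W : set G) (g : G).

Lemma dom0_open_map : open_map (@dom0 G).
Proof.
move=> W oW; apply: open_map_local_at => x Wx.
have [U [oU iU opU] Ux] := etale_chart x.
have oWU : open (@dom0 G @` (W `&` U)) by apply: opU => //; exact: openI.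
apply: filterS (open_nbhs_nbhs (conj oWU _)); first by move=> _ [z [Wz _] <-]; exists z.
by exists x.
Qed.

Lemma dom0E g h : dom0 g = dom0 h <-> dom g = dom h.
Proof. by split=> [/(congr1 val)|gh] //; exact: val_inj. Qed.

(** As the domain map is open, it identifies a bisection with an open set of
    units. *)
Definition bisection B :=
  [/\ open B, forall g h, B g -> B h -> dom g = dom h -> g = h &
      forall g h, B g -> B h -> rng g = rng h -> g = h].

(** Intersect an injectivity domain of [dom] at [g] with the image under inversion
    of one at [inv g]. *)
Lemma bisection_nbhs g : exists2 B, bisection B & B g.
Proof.
have [U [oU iU _] Ug] := etale_chart g.
have [V [oV iV _] Vg] := etale_chart (inv g).
exists (U `&` @inv G @^-1` V) => //; split.
- by apply: openI => //; apply: open_comp => // ? _; exact: inv_continuous.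
- move=> x y [Ux _] [Uy _] xy; apply: iU; [exact/mem_set|exact/mem_set|].
  exact: val_inj.
- move=> x y [_ Vx] [_ Vy] xy; have xyi : inv x = inv y.
    apply: iV; [exact/mem_set|exact/mem_set|].
    by apply: val_inj; rewrite /= !dom_inv.
  by rewrite -[x]ginvK xyi ginvK.
Qed.

End Bisection.

(** * Elementary functions span the convolution algebra *)

Section BisectionTopology.
Variable G : etale_groupoid.
Implicit Types (B W : set G) (g : G).

Lemma dom0_nbhs (g : G) W : nbhs g W -> nbhs (dom0 g) (@dom0 G @` W).
Proof.
rewrite nbhsE => -[V [oV Vg] VW].
apply: (@filterS _ _ _ (@dom0 G @` V)); first exact: image_subset.
by apply: open_nbhs_nbhs; split; [exact: dom0_open_map|exists g].
Qed.

Lemma bisection_sub B W : bisection B -> open W -> W `<=` B -> bisection W.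
Proof.
move=> [_ iB jB] oW WB; split=> // g h /WB Bg /WB Bh; [exact: iB|exact: jB].
Qed.

(** The domain map restricts to a homeomorphism from [B] onto an open set of
    units. *)
Lemma bisection_compact B (K : set (unit_space G)) : bisection B ->
  compact K -> K `<=` @dom0 G @` B -> compact (B `&` @dom0 G @^-1` K).
Proof.
move=> [oB iB _] cK KB F PF FK.
have FKd : F (@dom0 G @^-1` K) by apply: filterS FK => z [].
have [y [Ky cly]]  : K `&` cluster (@dom0 G @ F) !=set0 by exact: cK.
have [x Bx xy] := KB _ Ky; subst y.
exists x; split=> // A N FA xN.
have FAB : F (@dom0 G @^-1` (@dom0 G @` (A `&` B))).
  by apply: filterS (filterI FA FK) => z [Az [Bz _]]; exists z.
have xNB : nbhs (dom0 x) (@dom0 G @` (N `&` B)).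
  by apply: dom0_nbhs; apply: filterI => //; apply: open_nbhs_nbhs.
have [_ [[a [Aa Ba] <-] [n [Nn Bn] /dom0E na]]] :=
  cly _ _ FAB xNB.
by exists a; split=> //; rewrite -(iB _ _ Bn Ba na).
Qed.

Lemma bisection_hausdorff B : hausdorff_space (unit_space G) ->
  bisection B -> hausdorff_space (set_type B).
Proof.
move=> hX [_ iB _] p q pq; apply: val_inj.
have cd : continuous (fun x : B => dom0 (val x)).
  exact: (continuous_comp_fun (@val_continuous _ B) (@dom0_continuous G)).
apply: iB; [exact/set_mem/valP|exact/set_mem/valP|apply/dom0E].
apply: hX => V W pV qW; have [x [Vx Wx]] := pq _ _ (cd _ _ pV) (cd _ _ qW).
by exists (dom0 (val x)).
Qed.

(** Near a unit, [g] and [dom g] lie in the same bisection and have the same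
    domain, so they agree. *)
Lemma open_units : open (units G).
Proof.
rewrite openE => u /unitsP uu.
have [B [oB iB _] Bu] := bisection_nbhs u.
have Bdom : nbhs u (@dom G @^-1` B).
  by apply: dom_continuous; rewrite uu; apply: open_nbhs_nbhs.
apply: filterS2 (open_nbhs_nbhs (conj oB Bu)) Bdom => g Bg Bdg.
by apply/unitsP; apply: iB => //; rewrite dom_dom.
Qed.

Lemma bisection_units : bisection (units G).
Proof.
split; [exact: open_units| |] => g h /unitsP gu /unitsP hu.
  by rewrite gu hu.
by rewrite (dom_unitE gu) (dom_unitE hu).
Qed.

End BisectionTopology.

(** These functions span [Qalg], and every construction on groupoids below
    respects them. *)
Definition elementary (R : realType) (G : etale_groupoid) (h : G -> R[i]) :=
  exists B S, [/\ bisection B, S `<=` B & supported_on S h].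

Section Span.
Variables (R : realType) (G : lcH_groupoid).
Implicit Types (f h : G -> R[i]).

Lemma elementary_Qalg h : elementary h -> Qalg h.
Proof.
move=> [B [S [bB SB Sh]]]; exists 1%N, (fun=> 1), (fun=> h); split=> [_|].
  have hB := bisection_hausdorff (@lcH_hausdorff G) bB.
  have oB : open B by case: bB.
  by exists B; split=> //; apply/CcP => //; exists S.
by apply/funext => g; rewrite big_ord1 mul1r.
Qed.

(** Lift a plateau function on the unit space along the domain map of a small
    bisection around [s]. *)
Lemma bisection_plateau (U : set G) (s : G) : open U -> U s ->
  exists B T (theta : G -> R[i]), [/\ bisection B, T `<=` B, B `<=` U,
    supported_on T theta & \forall g \near s, theta g = 1].
Proof.
move=> oU Us; have [B0 bB0 B0s] := bisection_nbhs s.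
pose B := B0 `&` U.
have oB : open B by apply: openI => //; case: bB0.
have bB : bisection B by apply: bisection_sub bB0 oB _; exact: subIsetl.
have Bs : B s by [].
have Ds : (@dom0 G @` B) (dom0 s) by exists s.
have [chi [K [cchi cK KB chi0 chi1]]] := @lcH_plateau R _ _ _
  (@lcH_locally_compact G) (@lcH_hausdorff G) (dom0_open_map oB) Ds.
pose T := B `&` @dom0 G @^-1` K.
pose theta g : R[i] := if `[< B g >] then real_complex R (chi (dom0 g)) else 0.
have near1 : nbhs s (B `&` @dom0 G @^-1` [set y | chi y = 1]).
  apply: filterI; first exact: open_nbhs_nbhs.
  exact: dom0_continuous.
exists B, T, theta; split=> //; [exact: subIsetl|exact: subIsetr| |]; last first.
  by apply: filterS near1 => g [Bg c1]; rewrite /theta asboolT // c1.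
split; first exact: bisection_compact.
- move=> g [Bg _].
  have cg : real_complex R (chi (dom0 h)) @[h --> g] -->
      real_complex R (chi (dom0 g)).
    apply: cvg_real_complex; apply: continuous_cvg; first exact: cchi.
    exact: dom0_continuous.
  have -> : {for g, continuous theta} =
      (theta @ g --> real_complex R (chi (dom0 g))).
    by rewrite /prop_for /continuous_at {2}/theta asboolT.
  apply: cvg_trans cg; apply: near_eq_cvg.
  by apply: filterS (open_nbhs_nbhs (conj oB Bg)) => h Bh; rewrite /theta asboolT.
- move=> g nT; rewrite /theta; case: asboolP => // Bg.
  by rewrite chi0 // => Kg; apply: nT.
Qed.

Section Ind.
Variable P : (G -> R[i]) -> Prop.
Hypotheses (P0 : P (fun=> 0))
  (PD : forall f h, P f -> P h -> P (fun g => f g + h g))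
  (PE : forall h, elementary h -> P h).

(** A partition of unity argument without division: given plateau functions
    [theta] equal to one on open sets that cover the carrier of [f], write
    [f = f * theta + f * (1 - theta)] and use induction, as the second term is
    carried by the part of the carrier that the remaining sets cover. *)
Lemma supported_on_split U : open U -> hausdorff_space (set_type U) ->
  forall f S, S `<=` U -> supported_on S f -> P f.
Proof.
move=> oU hU.
have plateau s : exists W (theta : G -> R[i]), U s -> [/\ open W, W s,
    (forall g, W g -> theta g = 1), (forall g, U g -> {for g, continuous theta}) &
    exists B K, [/\ bisection B, compact K, K `<=` B, K `<=` U &
        forall g, ~ K g -> theta g = 0]].
  have [Us|nUs] := pselect (U s); last by exists set0, (fun=> 0).
  have [B [T [theta [bB TB BU Ttheta theta1]]]] := bisection_plateau oU Us.
  have : nbhs s [set y | theta y = 1] by exact: theta1.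
  rewrite nbhsE => -[W [oW Ws] W1].
  exists W, theta => _; split=> //.
  - by move=> g Ug; apply: (supported_on_continuous hU oU _ Ttheta) => // h /TB/BU.
  - have [cT _ T0] := Ttheta; exists B, T; split=> //.
    by move=> g /TB/BU.
have /choice[W {}plateau] := plateau; have /choice[theta {}plateau] := plateau.
have cover_ind (l : seq G) : (forall s, s \in l -> U s) ->
    forall f S, S `<=` U -> supported_on S f ->
      S `<=` [set g | exists2 s, s \in l & W s g] -> P f.
  elim: l => [_ f S _ [_ _ f0] S0|s l IH lU f S SU Sf SW].
    by rewrite (_ : f = fun=> 0) //; apply/funext => g; apply: f0 => /S0[].
  have Us : U s by apply: lU; rewrite mem_head.
  have [oW _ th1 cth [B [K [bB cK KB KU th0]]]] := plateau _ Us.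
  have cS : compact S by case: Sf.
  have -> : f = fun g => f g * theta s g + f g * (1 - theta s g).
    by apply/funext => g; rewrite -mulrDr addrC subrK mulr1.
  apply: PD.
    apply: PE; exists B, K; split=> //; split=> [|g /KU Ug|g /th0 ->].
    - exact: cK.
    - exact: (cvgMC (supported_on_continuous hU oU SU Sf Ug) (cth _ Ug)).
    - by rewrite mulr0.
  apply: (IH _ _ (S `&` ~` W s)).
  - by move=> t tl; apply: lU; rewrite in_cons tl orbT.
  - by move=> g [/SU].
  - have [_ fS f0] := Sf; split=> [|g [Sg _]|g nSW].
    + by apply: compact_closedI => //; exact: open_closedC.
    + apply: (cvgMC (fS _ Sg)).
      have h1 : (fun=> 1 : R[i]) @ g --> (1 : R[i]) by exact: cvg_cst.
      exact: (cvgBC h1 (cth _ (SU _ Sg))).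
    + have [Sg|/f0 ->] := pselect (S g); last by rewrite mul0r.
      have [/th1 ->|nWg] := pselect (W s g); first by rewrite subrr mulr0.
      by case: nSW.
  - by move=> g [Sg nWs]; have [t] := SW _ Sg; rewrite in_cons => /orP[/eqP->//|tl Wt]; exists t.
move=> f S SU Sf; have := Sf => -[cS _ _].
(* A finite subcover comes from near-covering along the finite sets of points,
   directed by inclusion. *)
pose F := filter_from [set: seq G] (fun l => [set l' : seq G | {subset l <= l'}]).
have FF : Filter F.
  apply: filter_from_filter; first by exists [::].
  move=> l l' _ _; exists (l ++ l') => // k /= lk.
  by split=> s sl; apply: lk; rewrite mem_cat sl ?orbT.
have [//|l _ Sl] := (compact_near_coveringP S).1 cS _ F
  (fun l x => exists2 s, s \in l & U s /\ W s x) FF.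
  move=> x Sx; have [oW Wx _ _ _] := plateau _ (SU _ Sx).
  exists (W x, [set l : seq G | {subset [:: x] <= l}]).
    by split; [exact: open_nbhs_nbhs|exists [:: x]].
  move=> [y l] /= [Wy xl]; exists x; first by apply: xl; rewrite mem_head.
  by split=> //; exact: SU.
apply: (cover_ind [seq s <- l | `[< U s >]] _ f S) => //.
- by move=> s; rewrite mem_filter => /andP[/asboolP].
- move=> g /(Sl l)[//|s sl [Us Ws]]; exists s => //.
  by rewrite mem_filter sl andbT; apply/asboolP.
Qed.

Lemma Qalg_ind f : Qalg f -> P f.
Proof.
move=> [n [z [h [hC ->]]]].
have PZ i : P (fun g => z i * h i g).
  have [U [oU hU]] := hC i => /(CcP _ oU hU)[S SU [cS hS h0]].
  apply: (supported_on_split oU hU SU); split=> [|g Sg|g Sg]; first exact: cS.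
    have zi : (fun=> z i) @ g --> z i by exact: cvg_cst.
    exact: (cvgMC zi (hS _ Sg)).
  by rewrite (h0 _ Sg) mulr0.
elim: n => [|n IH] in z h hC PZ *.
  by rewrite (_ : (fun g => _) = fun=> 0) //; apply/funext => g; rewrite big_ord0.
rewrite (_ : (fun g => _) =
    fun g => z ord0 * h ord0 g + \sum_(i < n) z (lift ord0 i) * h (lift ord0 i) g).
  by apply: PD => //; apply: (IH (fun i => z (lift ord0 i))) => i; [exact: hC|exact: PZ].
by apply/funext => g; rewrite big_ord_recl.
Qed.

End Ind.

Lemma Qalg0 : @Qalg R G (fun=> 0).
Proof.
exists 0%N, (fun=> 0), (fun _ _ => 0); split=> [[]//|].
by apply/funext => g; rewrite big_ord0.
Qed.

Lemma QalgZ (z : R[i]) f : Qalg f -> Qalg (fun g => z * f g).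
Proof.
move=> [n [w [h [hC ->]]]]; exists n, (fun i => z * w i), h; split=> //.
by apply/funext => g; rewrite mulr_sumr; apply: eq_bigr => i _; rewrite mulrA.
Qed.

Lemma QalgD f h : Qalg f -> Qalg h -> Qalg (fun g => f g + h g).
Proof.
move=> [n [w [k [kC ->]]]] [m [w' [k' [kC' ->]]]].
exists (n + m)%N, (fun i => match fintype.split i with inl j => w j | inr j => w' j end),
  (fun i => match fintype.split i with inl j => k j | inr j => k' j end); split=> [i|].
  by case: fintype.split.
apply/funext => g; rewrite big_split_ord /=; congr (_ + _); apply: eq_bigr => i _.
  by rewrite -[lshift m i]/(unsplit (inl i)) unsplitK.
by rewrite -[rshift n i]/(unsplit (inr i)) unsplitK.
Qed.

(** The induction principle behind all later statements on [Qalg]: additivity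
    reduces them to elementary functions. *)
Lemma Qalg_rect (P : (G -> R[i]) -> Prop) : P (fun=> 0) ->
  (forall f h, Qalg f -> Qalg h -> P f -> P h -> P (fun g => f g + h g)) ->
  (forall h, elementary h -> P h) -> forall f, Qalg f -> P f.
Proof.
move=> P0 PD PE f Qf; suff [] : Qalg f /\ P f by [].
elim/Qalg_ind: f / Qf => [|f h [Qf Pf] [Qh Ph]|h eh].
- by split=> //; exact: Qalg0.
- by split; [exact: QalgD|exact: PD].
- by split; [exact: elementary_Qalg|exact: PE].
Qed.

End Span.

(** * Convolution on slices *)

Section FiniteSums.
Variables (V : nmodType) (I : choiceType).
Implicit Types (A : set I) (F : I -> V).

Lemma fsum_single A F i : A i -> (forall j, A j -> j <> i -> F j = 0) ->
  \sum_(j \in A) F j = F i.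
Proof.
move=> Ai F0; rewrite -(fsbig_widen [set i]) ?fsbig_set1 //.
  by move=> j ->.
by move=> j [Aj ji]; exact: F0.
Qed.

Lemma fsum0 A F : (forall j, A j -> F j = 0) -> \sum_(j \in A) F j = 0.
Proof. exact: fsbig1. Qed.

Lemma fsumD A F F' : finite_set (A `&` [set i | F i != 0]) ->
  finite_set (A `&` [set i | F' i != 0]) ->
  \sum_(i \in A) (F i + F' i) = \sum_(i \in A) F i + \sum_(i \in A) F' i.
Proof.
move=> fF fF'; set D := (A `&` [set i | F i != 0]) `|` (A `&` [set i | F' i != 0]).
have fD : finite_set D by rewrite finite_setU.
have DA : D `<=` A by move=> i [[]|[]].
have e i : (A `\` D) i -> F i = 0 /\ F' i = 0.
  move=> [Ai nD]; split; apply: contrapT => /eqP Fi; apply: nD.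
    by left.
  by right.
have w F'' : (forall i, (A `\` D) i -> F'' i = 0) ->
    \sum_(i \in A) F'' i = \sum_(i \in D) F'' i.
  by move=> F0; rewrite (fsbig_widen D A).
rewrite !w ?fsbig_split // => i /e[Fi F'i] //.
by rewrite Fi F'i addr0.
Qed.

End FiniteSums.

Lemma fsum_ge_term (R : numDomainType) (I : choiceType) (A : set I) (F : I -> R) i :
  finite_set (A `&` [set j | F j != 0]) -> (forall j, A j -> 0 <= F j) -> A i ->
  F i <= \sum_(j \in A) F j.
Proof.
move=> fF F0 Ai; pose F1 j := if j == i then F i else 0.
pose F2 j := if j == i then 0 else F j.
have F12 j : F j = F1 j + F2 j.
  by rewrite /F1 /F2; case: eqP => [->|_]; rewrite ?addr0 ?add0r.
under eq_fsbigr do rewrite F12.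
have f1 : finite_set (A `&` [set j | F1 j != 0]).
  apply: (@sub_finite_set _ _ [set i]) => // j [_ /=]; rewrite /F1.
  by have [->|_] := eqVneq j i; rewrite ?eqxx.
have f2 : finite_set (A `&` [set j | F2 j != 0]).
  apply: sub_finite_set fF => j [Aj /=]; rewrite /F2.
  by have [_|_] := eqVneq j i; rewrite ?eqxx.
rewrite fsumD // (@fsum_single _ _ A F1 i) //; last first.
  by move=> j _ ji; rewrite /F1; case: eqP.
rewrite (_ : F1 i = F i); last by rewrite /F1 eqxx.
rewrite lerDl; apply: fsumr_ge0 => j Aj.
by rewrite /F2; case: eqP => // _; exact: F0.
Qed.

Lemma ler_fsum (R : numDomainType) (I : choiceType) (A : set I) (F F' : I -> R) :
  finite_set (A `&` [set j | F j != 0]) -> finite_set (A `&` [set j | F' j != 0]) ->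
  (forall j, A j -> F j <= F' j) ->
  \sum_(j \in A) F j <= \sum_(j \in A) F' j.
Proof.
move=> fF fF' FF'.
have e : \sum_(j \in A) F' j = \sum_(j \in A) (F j + (F' j - F j)).
  by apply: eq_fsbigr => j _; rewrite addrC subrK.
rewrite e fsumD //.
  by rewrite lerDl; apply: fsumr_ge0 => j /FF'; rewrite subr_ge0.
apply: (@sub_finite_set _ _ ((A `&` [set j | F j != 0]) `|`
    (A `&` [set j | F' j != 0]))); last by rewrite finite_setU.
move=> j [Aj /= d]; have [Fj|Fj] := eqVneq (F j) 0; last by left.
by right; split=> //=; move: d; rewrite Fj subr0.
Qed.

Section GroupoidCancellation.
Variable G : top_groupoid.
Implicit Types g h k : G.

Lemma gmulKV g k : dom k = dom g -> mul (mul g (inv k)) k = g.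
Proof.
move=> kg; rewrite -gmulA ?rng_inv ?dom_inv // gmulV kg; exact: gmulr1.
Qed.

Lemma gmulK g k : dom g = rng k -> mul (mul g k) (inv k) = g.
Proof. by move=> gk; rewrite -gmulA ?rng_inv // gmulrV -gk gmulr1. Qed.

Lemma dom_mulV g k : dom k = dom g -> dom (mul g (inv k)) = rng k.
Proof. by move=> kg; rewrite dom_mul ?dom_inv // rng_inv. Qed.

End GroupoidCancellation.

Section Convolution.
Variables (R : realType) (G : top_groupoid).
Implicit Types (f h : G -> R[i]) (g k : G) (B : set G).

(** Factorizations of [g] correspond to their right factors. *)
Lemma convolutionE f1 f2 g : convolution f1 f2 g =
  \sum_(k \in [set k | dom k = dom g]) f1 (mul g (inv k)) * f2 k.
Proof.
rewrite /convolution (@reindex_fsbig _ _ _ _ _ (fun k => (mul g (inv k), k))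
  [set k | dom k = dom g]) //; split.
- by move=> k /= kg; rewrite dom_mulV // gmulKV.
- by move=> k l _ _ [].
- move=> [a b] /= [ab abg]; exists b; last by rewrite -abg gmulK.
  by rewrite /= -abg dom_mul.
Qed.

(** Finiteness on the fibres of the domain or range map is what makes the
    convolution sums finite, hence additive; [\sum_(_ \in _)] is zero on infinite
    supports. *)
Definition dom_finite f :=
  forall u, finite_set [set g | dom g = u /\ f g != 0].
Definition rng_finite f :=
  forall u, finite_set [set g | rng g = u /\ f g != 0].

Lemma conv_finl f1 f2 g : rng_finite f1 -> finite_set
  ([set p : G * G | dom p.1 = rng p.2 /\ mul p.1 p.2 = g] `&`
   [set p | f1 p.1 * f2 p.2 != 0]).
Proof.
move=> /(_ (rng g)) /(finite_image (fun k => (k, mul (inv k) g))).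
apply: sub_finite_set => -[a b] [/= [ab abg] ne]; exists a => /=.
  split; first by rewrite -abg rng_mul.
  by apply: contraNneq ne => ->; rewrite mul0r.
by rewrite -abg gmulA ?dom_inv // gmulV ab gmul1.
Qed.

Lemma conv_finr f1 f2 g : dom_finite f2 -> finite_set
  ([set p : G * G | dom p.1 = rng p.2 /\ mul p.1 p.2 = g] `&`
   [set p | f1 p.1 * f2 p.2 != 0]).
Proof.
move=> /(_ (dom g)) /(finite_image (fun k => (mul g (inv k), k))).
apply: sub_finite_set => -[a b] [/= [ab abg] ne]; exists b => /=.
  split; first by rewrite -abg dom_mul.
  by apply: contraNneq ne => ->; rewrite mulr0.
by rewrite -abg gmulK.
Qed.

Lemma convDl f1 f2 h : dom_finite h ->
  convolution (fun g => f1 g + f2 g) h =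
  fun g => convolution f1 h g + convolution f2 h g.
Proof.
move=> hf; apply/funext => g; rewrite /convolution.
under eq_fsbigr do rewrite mulrDl.
by apply: fsumD; exact: conv_finr.
Qed.

Lemma convDr f1 f2 h : rng_finite h ->
  convolution h (fun g => f1 g + f2 g) =
  fun g => convolution h f1 g + convolution h f2 g.
Proof.
move=> hf; apply/funext => g; rewrite /convolution.
under eq_fsbigr do rewrite mulrDr.
by apply: fsumD; exact: conv_finl.
Qed.

Lemma conv0l h : convolution (fun=> 0) h = fun=> 0.
Proof. by apply/funext => g; apply: fsum0 => j _; rewrite mul0r. Qed.

Lemma conv0r h : convolution h (fun=> 0) = fun=> 0.
Proof. by apply/funext => g; apply: fsum0 => j _; rewrite mulr0. Qed.

Lemma convZl (z : R[i]) f h : convolution (fun g => z * f g) h =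
  fun g => z * convolution f h g.
Proof.
apply/funext => g; rewrite /convolution mulr_fsumr.
by apply: eq_fsbigr => p _; rewrite mulrA.
Qed.

Lemma convZr (z : R[i]) f h : convolution f (fun g => z * h g) =
  fun g => z * convolution f h g.
Proof.
apply/funext => g; rewrite /convolution mulr_fsumr.
by apply: eq_fsbigr => p _; rewrite mulrCA.
Qed.

(** Slices are the algebraic shadow of bisections. A function that vanishes
    off a slice has at most one nonzero value on each fibre, so that a
    convolution of two of them has at most one term. *)
Definition slice B :=
  (forall g k, B g -> B k -> dom g = dom k -> g = k) /\
  (forall g k, B g -> B k -> rng g = rng k -> g = k).

Definition carried B h := forall g, ~ B g -> h g = 0.

Lemma carried_neq0 B h g : carried B h -> h g != 0 -> B g.
Proof. by move=> hB; apply: contraNP => /hB ->; exact: eqxx. Qed.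

Lemma carried_dom_finite B h : slice B -> carried B h -> dom_finite h.
Proof.
move=> [iB _] hB u; apply: (@sub_finite_set _ _ (xget u [set g | B g /\ dom g = u] |` set0)).
  move=> g [gu /(carried_neq0 hB) Bg]; left.
  case: xgetP => [y _ [By yu]|/(_ g)[]//]; apply: iB => //; by rewrite gu yu.
by rewrite setU0; exact: finite_set1.
Qed.

Lemma carried_rng_finite B h : slice B -> carried B h -> rng_finite h.
Proof.
move=> [_ iB] hB u; apply: (@sub_finite_set _ _ (xget u [set g | B g /\ rng g = u] |` set0)).
  move=> g [gu /(carried_neq0 hB) Bg]; left.
  case: xgetP => [y _ [By yu]|/(_ g)[]//]; apply: iB => //; by rewrite gu yu.
by rewrite setU0; exact: finite_set1.
Qed.

Definition slice_mul B1 B2 : set G :=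
  [set g | exists a b, [/\ B1 a, B2 b, dom a = rng b & mul a b = g]].

Lemma slice_mulP B1 B2 : slice B1 -> slice B2 -> slice (slice_mul B1 B2).
Proof.
move=> [i1 j1] [i2 j2]; split=> g h [a [b [Ba Bb ab <-]]] [a' [b' [Ba' Bb' ab' <-]]].
  rewrite !dom_mul // => bb; have bE : b = b' by exact: i2.
  by congr mul => //; apply: i1 => //; rewrite ab ab' bE.
rewrite !rng_mul // => aa; have aE : a = a' by exact: j1.
by congr mul => //; apply: j2 => //; rewrite -ab -ab' aE.
Qed.

Lemma conv_carried B1 B2 h1 h2 a b : slice B1 -> carried B1 h1 -> carried B2 h2 ->
  slice B2 -> B1 a -> B2 b -> dom a = rng b ->
  convolution h1 h2 (mul a b) = h1 a * h2 b.
Proof.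
move=> [_ j1] c1 c2 [i2 _] Ba Bb ab.
rewrite /convolution (@fsum_single _ _ _ (fun p => h1 p.1 * h2 p.2) (a, b)) //.
move=> [a' b'] /= [ab' abE] ne; have [Ba'|/c1 ->] := pselect (B1 a'); last by rewrite mul0r.
have [Bb'|/c2 ->] := pselect (B2 b'); last by rewrite mulr0.
case: ne; congr (_, _).
  by apply: j1 => //; rewrite -(rng_mul ab') abE rng_mul.
by apply: i2 => //; rewrite -(dom_mul ab') abE dom_mul.
Qed.

Lemma conv_carried0 B1 B2 h1 h2 : carried B1 h1 -> carried B2 h2 ->
  carried (slice_mul B1 B2) (convolution h1 h2).
Proof.
move=> c1 c2 g ng; apply: fsum0 => -[a b] /= [ab abg].
have [Ba|/c1 ->] := pselect (B1 a); last by rewrite mul0r.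
have [Bb|/c2 ->] := pselect (B2 b); last by rewrite mulr0.
by case: ng; exists a, b.
Qed.

(** Both sides are carried by the products [a (b c)], and there equal
    [h1 a * h2 b * h3 c]. *)
Lemma conv_carriedA B1 B2 B3 h1 h2 h3 : slice B1 -> slice B2 -> slice B3 ->
  carried B1 h1 -> carried B2 h2 -> carried B3 h3 ->
  convolution h1 (convolution h2 h3) = convolution (convolution h1 h2) h3.
Proof.
move=> s1 s2 s3 c1 c2 c3.
have s12 := slice_mulP s1 s2; have s23 := slice_mulP s2 s3.
have c12 := conv_carried0 c1 c2; have c23 := conv_carried0 c2 c3.
apply/funext => g.
have [[a [b [c [[Ba Bb Bc] ab bc <-]]]]|ng] := pselect (exists a b c,
  [/\ [/\ B1 a, B2 b & B3 c], dom a = rng b, dom b = rng c &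
      mul a (mul b c) = g]).
  have e1 : dom a = rng (mul b c) by rewrite rng_mul.
  have e2 : dom (mul a b) = rng c by rewrite dom_mul.
  rewrite (conv_carried s1 c1 c23 s23) //; last by exists b, c.
  rewrite (conv_carried s2 c2 c3 s3) // gmulA //.
  rewrite (conv_carried s12 c12 c3 s3) //; last by exists a, b.
  by rewrite (conv_carried s1 c1 c2 s2) // mulrA.
rewrite (conv_carried0 c1 c23) ?(conv_carried0 c12 c3) // => -[a [b [Ba Bb ab abg]]].
  case: Ba => a1 [a2 [B1a1 B2a2 a12 aE]]; apply: ng; exists a1, a2, b.
  by rewrite -abg -aE gmulA // -ab -aE dom_mul.
case: Bb => b1 [b2 [B2b1 B3b2 b12 bE]]; apply: ng; exists a, b1, b2.
by rewrite -abg -bE; split=> //; rewrite ab -bE rng_mul.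
Qed.

Definition slice_inv B : set G := @inv G @^-1` B.

Lemma slice_invP B : slice B -> slice (slice_inv B).
Proof.
move=> [iB jB]; split=> g h Bg Bh gh; apply: (can_inj (@ginvK G)).
  by apply: jB => //; rewrite !rng_inv.
by apply: iB => //; rewrite !dom_inv.
Qed.

Lemma involution_carried B h : carried B h -> carried (slice_inv B) (involution h).
Proof. by move=> hB g nB; rewrite /involution hB // conjC0. Qed.

Lemma involution_conv_carried B1 B2 h1 h2 : slice B1 -> slice B2 ->
  carried B1 h1 -> carried B2 h2 ->
  involution (convolution h1 h2) = convolution (involution h2) (involution h1).
Proof.
move=> s1 s2 c1 c2; apply/funext => g.
have [[a [b [Ba Bb ab gE]]]|ng] := pselect (slice_mul B1 B2 (inv g)).
  have -> : g = mul (inv b) (inv a) by rewrite -ginvM // gE ginvK.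
  rewrite (conv_carried (slice_invP s2) (involution_carried c2)
    (involution_carried c1) (slice_invP s1)) ?/slice_inv /= ?ginvK //.
    rewrite /involution -ginvM // ginvK (conv_carried s1 c1 c2 s2) //.
    by rewrite rmorphM mulrC !ginvK.
  by rewrite dom_inv rng_inv.
rewrite /involution (conv_carried0 c1 c2) // conjC0.
rewrite (conv_carried0 (involution_carried c2) (involution_carried c1)) //.
move=> [b [a [Bb Ba ba gE]]]; apply: ng; exists (inv a), (inv b).
split=> //; first by rewrite dom_inv rng_inv.
by rewrite -gE ginvM.
Qed.

Lemma involutionK h : involution (involution h) = h.
Proof. by apply/funext => g; rewrite /involution ginvK conjCK. Qed.

Lemma involutionD f h : involution (fun g => f g + h g) =
  fun g => involution f g + involution h g.
Proof. by apply/funext => g; rewrite /involution rmorphD. Qed.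

Lemma involution0 : involution (fun=> 0 : R[i]) = (fun=> 0) :> (G -> R[i]).
Proof. by apply/funext => g; rewrite /involution conjC0. Qed.

End Convolution.

(** * The convolution algebra is a *-algebra *)

Section LocalSection.
Variable G : etale_groupoid.
Implicit Types (B : set G) (g : G).

Lemma bisection_slice B : bisection B -> slice B.
Proof. by move=> [_ iB jB]; split. Qed.

(** The inverse of the domain map on a bisection. It takes any arrow with the
    right domain, so that no point of a subtype has to be formed. *)
Definition local_section B g : G := xget g [set b | B b /\ dom b = dom g].

Lemma local_sectionP B g b : B b -> dom b = dom g ->
  B (local_section B g) /\ dom (local_section B g) = dom g.
Proof. by rewrite /local_section => Bb bg; case: xgetP => [y _ []|/(_ b)[]]. Qed.

Lemma local_sectionE B g b : bisection B -> B b -> dom b = dom g ->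
  local_section B g = b.
Proof.
move=> [_ iB _] Bb bg; have [Bs sg] := local_sectionP Bb bg.
by apply: iB => //; rewrite sg.
Qed.

Lemma local_section_cvg B g b : bisection B -> B b -> dom b = dom g ->
  local_section B @ g --> b.
Proof.
move=> bB Bb bg N bN; have oB : open B by case: bB.
have : nbhs (dom0 b) (@dom0 G @` (N `&` B)).
  by apply: dom0_nbhs; exact: filterI bN (open_nbhs_nbhs (conj oB Bb)).
rewrite (_ : dom0 b = dom0 g); last exact/dom0E.
move=> gN; have : nbhs g (@dom0 G @^-1` (@dom0 G @` (N `&` B))).
  exact: dom0_continuous.
apply: filterS => k [n [Nn Bn] /dom0E nk].
by rewrite /preimage /= (local_sectionE bB Bn nk).
Qed.

Lemma local_section_near B g b : bisection B -> B b -> dom b = dom g ->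
  \forall k \near g, exists2 c, B c & dom c = dom k.
Proof.
move=> bB Bb bg; have oB : open B by case: bB.
have : nbhs (dom0 b) (@dom0 G @` B) by apply: dom0_nbhs; exact: (open_nbhs_nbhs (conj oB Bb)).
rewrite (_ : dom0 b = dom0 g); last exact/dom0E.
move=> gB; have : nbhs g (@dom0 G @^-1` (@dom0 G @` B)).
  exact: dom0_continuous.
by apply: filterS => k [n Bn /dom0E nk]; exists n.
Qed.

End LocalSection.

Lemma gmul_cvg (G : top_groupoid) (T : topologicalType) (t0 : T) (u v : T -> G) a b :
  u @ t0 --> a -> v @ t0 --> b -> dom a = rng b ->
  (\forall t \near t0, dom (u t) = rng (v t)) ->
  (fun t => mul (u t) (v t)) @ t0 --> mul a b.
Proof.
move=> ua vb ab uv N mN.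
pose D : set (G * G) := [set p | dom p.1 = rng p.2].
have mc := @mul_continuous G : {within D, continuous (fun p => mul p.1 p.2)}.
have : within D (nbhs (a, b)) ((fun p => mul p.1 p.2) @^-1` N).
  rewrite (nbhs_subspace_in (ab : D (a, b))).
  exact: (mc (a, b) N mN).
have uvab : (fun t => (u t, v t)) @ t0 --> (a, b) by exact: cvg_pair.
move=> wN; have := uvab _ wN; rewrite nbhs_simpl /= => w.
by apply: filterS2 w uv => t w uvt; exact: w.
Qed.

Section ElementaryProduct.
Variables (R : realType) (G : etale_groupoid).
Hypothesis hX : hausdorff_space (unit_space G).
Implicit Types (B S : set G) (g : G) (h : G -> R[i]).

(** Near a product of two arrows of bisections, the factorization through these
    bisections exists and depends continuously on the product. *)
Lemma slice_mul_decomp B1 B2 a b : bisection B1 -> bisection B2 ->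
  B1 a -> B2 b -> dom a = rng b ->
  [/\ (fun g => mul g (inv (local_section B2 g))) @ mul a b --> a,
      local_section B2 @ mul a b --> b &
      \forall g \near mul a b, let k := local_section B2 g in
        [/\ B1 (mul g (inv k)), B2 k, dom (mul g (inv k)) = rng k &
            mul (mul g (inv k)) k = g]].
Proof.
move=> b1 b2 Ba Bb ab; have dg : dom b = dom (mul a b) by rewrite dom_mul.
have c2 := local_section_cvg b2 Bb dg.
have n2 := local_section_near b2 Bb dg.
have c1 : (fun g => mul g (inv (local_section B2 g))) @ mul a b --> a.
  rewrite -[X in _ --> X](gmulK ab); apply: gmul_cvg.
  - exact: cvg_id.
  - by apply: cvg_comp c2 _; exact: inv_continuous.
  - by rewrite rng_inv dg.
  - apply: filterS n2 => g [c Bc cg]; have [_ sg] := local_sectionP Bc cg.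
    by rewrite rng_inv sg.
have oB1 : open B1 by case: b1.
have n1 : nbhs (mul a b) ((fun g => mul g (inv (local_section B2 g))) @^-1` B1).
  by apply: c1; exact: open_nbhs_nbhs.
split=> //; apply: filterS2 n1 n2 => g B1g [c Bc cg]; have [Bs sg] := local_sectionP Bc cg.
by split=> //; [rewrite dom_mulV|rewrite gmulKV].
Qed.

Lemma slice_mul_bisection B1 B2 : bisection B1 -> bisection B2 ->
  bisection (slice_mul B1 B2).
Proof.
move=> b1 b2; have [iB jB] := slice_mulP (bisection_slice b1) (bisection_slice b2).
split=> //; rewrite openE => _ [a [b [Ba Bb ab <-]]].
have [_ _] := slice_mul_decomp b1 b2 Ba Bb ab.
by apply: filterS => g /= [? ? ? ?]; eexists; eexists; split; eassumption.
Qed.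

Lemma supported_on_carried B S h : S `<=` B -> supported_on S h -> carried B h.
Proof. by move=> SB [_ _ h0] g nB; apply: h0 => /SB. Qed.

(** The carrier is the image under multiplication of the composable pairs of
    the two carriers; these pairs form a compact set because the unit space is
    Hausdorff. *)
Lemma elementary_conv h1 h2 : elementary h1 -> elementary h2 ->
  elementary (convolution h1 h2).
Proof.
move=> [B1 [S1 [b1 SB1 Sh1]]] [B2 [S2 [b2 SB2 Sh2]]].
have s1 := bisection_slice b1; have s2 := bisection_slice b2.
have c1 := supported_on_carried SB1 Sh1; have c2 := supported_on_carried SB2 Sh2.
pose E : set (G * G) := [set p | dom p.1 = rng p.2].
pose D := (S1 `*` S2) `&` E.
exists (slice_mul B1 B2), ((fun p => mul p.1 p.2) @` D); split.
- exact: slice_mul_bisection.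
- move=> _ [[a b] [[/= Sa Sb] ab] <-]; exists a, b.
  by split=> //; [exact: SB1|exact: SB2].
have [cS1 h1S h10] := Sh1; have [cS2 h2S h20] := Sh2; split.
- apply: continuous_compact.
    apply: (@continuous_subspaceW _ _ D E); first by move=> p [].
    exact: mul_continuous.
  apply: compact_closedI; first exact: compact_setX.
  have -> : E = [set p | dom0 p.1 = dom0 (inv p.2)].
    apply/seteqP; split=> -[a b] /=; rewrite /E /= dom0E dom_inv //.
  apply: closed_equalizer => //.
    exact: (continuous_comp_fun (@continuous_fst _ _) (@dom0_continuous G)).
  apply: (continuous_comp_fun _ (@dom0_continuous G)).
  exact: (continuous_comp_fun (@continuous_snd _ _) (@inv_continuous G)).
- move=> _ [[a b] [[/= Sa Sb] ab] <-].
  have Ba := SB1 _ Sa; have Bb := SB2 _ Sb.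
  have [ca cb near_ab] := slice_mul_decomp b1 b2 Ba Bb ab.
  have h12 : (fun g => h1 (mul g (inv (local_section B2 g))) *
      h2 (local_section B2 g)) @ mul a b --> h1 a * h2 b.
    exact: (cvgMC (cvg_comp _ _ ca (h1S _ Sa)) (cvg_comp _ _ cb (h2S _ Sb))).
  apply: (@continuous_at_lim _ _ _ _ (h1 a * h2 b)); last first.
    by rewrite (conv_carried s1 c1 c2 s2 Ba Bb ab).
  apply: cvg_trans h12; apply: near_eq_cvg.
  apply: filterS near_ab => g /= [Bg1 Bg2 dg gE].
  by rewrite -[in RHS]gE (conv_carried s1 c1 c2 s2).
- move=> g nD; apply: fsum0 => -[a b] /= [ab abg].
  have [Sa|/h10 ->] := pselect (S1 a); last by rewrite mul0r.
  have [Sb|/h20 ->] := pselect (S2 b); last by rewrite mulr0.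
  by case: nD; exists (a, b).
Qed.

Lemma elementary_involution h : elementary h -> elementary (involution h).
Proof.
move=> [B [S [bB SB [cS hS h0]]]].
have [oB _ _] := bB; have [iB jB] := slice_invP (bisection_slice bB).
exists (slice_inv B), (@inv G @` S); split.
- split=> //; apply: open_comp => // ? _; exact: inv_continuous.
- by move=> _ [s Ss <-]; rewrite /slice_inv /= ginvK; exact: SB.
split.
- apply: continuous_compact => //.
  by apply: continuous_subspaceT; exact: inv_continuous.
- move=> _ [s Ss <-].
  have ic : @inv G @ inv s --> s.
    by have := @inv_continuous G (inv s); rewrite /continuous_at ginvK.
  apply: continuous_at_lim (cvg_conjC (cvg_comp _ _ ic (hS _ Ss))) _.
  by rewrite /involution /= ginvK.
- move=> g nS; rewrite /involution h0 ?conjC0 // => Sg; apply: nS.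
  by exists (inv g) => //; rewrite ginvK.
Qed.

Lemma elementary_dom_finite h : elementary h -> dom_finite h.
Proof.
move=> [B [S [bB SB Sh]]]; exact: carried_dom_finite (bisection_slice bB)
  (supported_on_carried SB Sh).
Qed.

Lemma elementary_rng_finite h : elementary h -> rng_finite h.
Proof.
move=> [B [S [bB SB Sh]]]; exact: carried_rng_finite (bisection_slice bB)
  (supported_on_carried SB Sh).
Qed.

End ElementaryProduct.

Section QalgAlgebra.
Variables (R : realType) (G : lcH_groupoid).
Implicit Types (f h : G -> R[i]).

Lemma finite_support_add (P : set G) f1 f2 :
  finite_set (P `&` [set g | f1 g != 0]) -> finite_set (P `&` [set g | f2 g != 0]) ->
  finite_set (P `&` [set g | f1 g + f2 g != 0]).
Proof.
move=> F1 F2; apply: (@sub_finite_set _ _ ((P `&` [set g | f1 g != 0]) `|`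
  (P `&` [set g | f2 g != 0]))); last by rewrite finite_setU.
move=> g [Pg /= ne]; have [f10|f10] := eqVneq (f1 g) 0; last by left.
by right; split=> //=; move: ne; rewrite f10 add0r.
Qed.

Lemma finite_support0 (P : set G) : finite_set (P `&` [set g : G | (0 : R[i]) != 0]).
Proof. by rewrite (_ : _ `&` _ = set0) //; apply/seteqP; split=> g // [_]; rewrite /= eqxx. Qed.

Lemma Qalg_dom_finite f : Qalg f -> dom_finite f.
Proof.
apply: Qalg_ind => [u|f1 f2 F1 F2 u|h /elementary_dom_finite//].
  exact: (finite_support0 [set g | dom g = u]).
exact: (finite_support_add (F1 u) (F2 u)).
Qed.

Lemma Qalg_rng_finite f : Qalg f -> rng_finite f.
Proof.
apply: Qalg_ind => [u|f1 f2 F1 F2 u|h /elementary_rng_finite//].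
  exact: (finite_support0 [set g | rng g = u]).
exact: (finite_support_add (F1 u) (F2 u)).
Qed.

Lemma Qalg_conv f h : Qalg f -> Qalg h -> Qalg (convolution f h).
Proof.
move=> Qf; move: h; apply: Qalg_rect => [|h1 h2 _ _ Q1 Q2|h eh].
- by rewrite conv0r; exact: Qalg0.
- by rewrite convDr; [exact: QalgD|exact: Qalg_rng_finite].
move: f Qf; apply: Qalg_rect => [|f1 f2 _ _ Q1 Q2|f ef].
- by rewrite conv0l; exact: Qalg0.
- by rewrite convDl; [exact: QalgD|exact: elementary_dom_finite].
- by apply: elementary_Qalg; apply: elementary_conv => //; exact: lcH_hausdorff.
Qed.

Lemma Qalg_involution f : Qalg f -> Qalg (involution f).
Proof.
move: f; apply: Qalg_rect => [|f1 f2 _ _ Q1 Q2|h eh].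
- by rewrite involution0; exact: Qalg0.
- by rewrite involutionD; exact: QalgD.
- by apply: elementary_Qalg; exact: elementary_involution.
Qed.

(** Associativity is multilinear, so it is enough to have it on slices. *)
Lemma convolutionA f1 f2 f3 : Qalg f1 -> Qalg f2 -> Qalg f3 ->
  convolution f1 (convolution f2 f3) = convolution (convolution f1 f2) f3.
Proof.
have rf := Qalg_rng_finite; have df := Qalg_dom_finite.
move=> Q1 Q2; move: f3; apply: Qalg_rect => [|f h Qf Qh IHf IHh|f3 e3].
- by rewrite !conv0r.
- by rewrite !(convDr _ _ (rf _ _)) ?IHf ?IHh //; exact: Qalg_conv.
have Q3 := elementary_Qalg e3; move: f2 Q2.
apply: Qalg_rect => [|f h Qf Qh IHf IHh|f2 e2].
- by rewrite conv0l !conv0r conv0l.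
- rewrite (convDl f h (df _ Q3)) !(convDr _ _ (rf _ Q1)).
  by rewrite (convDl _ _ (df _ Q3)) IHf IHh.
have Q2 := elementary_Qalg e2; move: f1 Q1.
apply: Qalg_rect => [|f h Qf Qh IHf IHh|f1 [B1 [S1 [b1 SB1 Sh1]]]].
- by rewrite !conv0l.
- rewrite (convDl f h (df _ Q2)) (convDl _ _ (df _ Q3)).
  by rewrite (convDl f h (df _ (Qalg_conv Q2 Q3))) IHf IHh.
have [B2 [S2 [b2 SB2 Sh2]]] := e2; have [B3 [S3 [b3 SB3 Sh3]]] := e3.
apply: (conv_carriedA (bisection_slice b1) (bisection_slice b2)
  (bisection_slice b3)); by [exact: supported_on_carried Sh1
  |exact: supported_on_carried Sh2|exact: supported_on_carried Sh3].
Qed.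

Lemma involution_conv f1 f2 : Qalg f1 -> Qalg f2 ->
  involution (convolution f1 f2) = convolution (involution f2) (involution f1).
Proof.
have rf := Qalg_rng_finite; have df := Qalg_dom_finite.
have Qi := Qalg_involution.
move=> Q1; move: f2; apply: Qalg_rect => [|f h Qf Qh IHf IHh|f2 e2].
- by rewrite conv0r !involution0 conv0l.
- rewrite (convDr _ _ (rf _ Q1)) !involutionD IHf IHh.
  by rewrite (convDl _ _ (df _ (Qi _ Q1))).
have Q2 := elementary_Qalg e2; move: f1 Q1.
apply: Qalg_rect => [|f h Qf Qh IHf IHh|f1 [B1 [S1 [b1 SB1 Sh1]]]].
- by rewrite conv0l !involution0 conv0r.
- rewrite (convDl _ _ (df _ Q2)) !involutionD IHf IHh.
  by rewrite (convDr _ _ (rf _ (Qi _ Q2))).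
have [B2 [S2 [b2 SB2 Sh2]]] := e2.
by apply: (involution_conv_carried (bisection_slice b1) (bisection_slice b2));
  [exact: supported_on_carried Sh1|exact: supported_on_carried Sh2].
Qed.

End QalgAlgebra.

(** * Pullback and pushforward *)

Section Pullback.
Variables (R : realType) (K G : etale_groupoid) (phi : K -> G).
Hypotheses (hphi : is_ghom phi) (cphi : continuous phi).
Hypothesis bphi : fibrewise_bijective phi.

Lemma fibrewise_inj k l : dom k = dom l -> phi k = phi l -> k = l.
Proof.
have uk : units K (dom k) by exists k.
have [_ iphi _] := bphi uk => kl.
by apply: iphi; apply/mem_set.
Qed.

Lemma fibrewise_surj u g : dom u = u -> dom g = phi u ->
  exists2 k, dom k = u & phi k = g.
Proof.
move=> uu gu; have /bphi[_ _ sphi] : units K u by apply/unitsP.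
by have [k ku <-] := sphi g gu; exists k.
Qed.

Lemma pullback_bisection B : bisection B -> bisection (phi @^-1` B).
Proof.
move=> [oB iB jB]; split.
- by apply: open_comp => // ? _; exact: cphi.
- move=> k l Bk Bl kl; apply: fibrewise_inj => //.
  by apply: iB => //; rewrite -!(ghom_dom hphi) kl.
- move=> k l Bk Bl kl; apply: (can_inj (@ginvK K)); apply: fibrewise_inj.
    by rewrite !dom_inv.
  by rewrite !(ghom_inv hphi); congr inv; apply: jB => //; rewrite -!(ghom_rng hphi) kl.
Qed.

(** Properness keeps the carrier compact: it is the part of [phi^-1 B] over the
    preimage of a compact set of units. *)
Lemma elementary_pullback (h : G -> R[i]) : proper_map (unit_map hphi) ->
  elementary h -> elementary (pullback phi h).
Proof.
move=> pphi [B [S [bB SB [cS hS h0]]]].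
have bB' := pullback_bisection bB.
pose D := @dom0 G @` S.
have cD : compact D.
  apply: continuous_compact => //; apply: continuous_subspaceT.
  exact: dom0_continuous.
pose S' := phi @^-1` B `&` @dom0 K @^-1` (unit_map hphi @^-1` D).
have SE k : S' k <-> S (phi k).
  split=> [[Bk [s Ss /(congr1 val)/= sk]]|Sk].
    have [_ iB _] := bB; rewrite (_ : phi k = s) //.
    by apply: iB => //; [exact: SB|rewrite sk (ghom_dom hphi)].
  split; first exact: SB.
  by exists (phi k) => //; apply: val_inj; rewrite /= (ghom_dom hphi).
exists (phi @^-1` B), S'; split=> //; first by move=> k [].
split.
- apply: bisection_compact => //; first exact: pphi.
  move=> u [s Ss /(congr1 val)/= su].
  have [k ku ks] := fibrewise_surj (dom_unit u) su.
  by exists k; [rewrite /preimage /= ks; exact: SB|apply: val_inj].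
- by move=> k /SE Sk; apply: (@continuous_comp K G R[i] phi h k); [exact: cphi|exact: hS].
- by move=> k nS; apply: h0 => /SE.
Qed.

(** Fibrewise bijectivity turns one convolution sum into the other. *)
Lemma pullback_conv (f1 f2 : G -> R[i]) :
  pullback phi (convolution f1 f2) =
  convolution (pullback phi f1) (pullback phi f2).
Proof.
apply/funext => k; rewrite /pullback /= !convolutionE.
have /bphi : units K (dom k) by exists k.
rewrite (ghom_dom hphi) => bk.
rewrite (reindex_fsbig _ _ _ _ bk); apply: eq_fsbigr => l /set_mem/= lk.
by rewrite (ghom_mul hphi) ?rng_inv // (ghom_inv hphi).
Qed.

Lemma pullback_involution (f : G -> R[i]) :
  pullback phi (involution f) = involution (pullback phi f).
Proof. by apply/funext => k; rewrite /pullback /involution /= (ghom_inv hphi). Qed.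

End Pullback.

Lemma Qalg_pullback (R : realType) (K G : lcH_groupoid) (phi : K -> G)
    (hphi : is_ghom phi) (f : G -> R[i]) : continuous phi ->
  fibrewise_bijective phi -> proper_map (unit_map hphi) ->
  Qalg f -> Qalg (pullback phi f).
Proof.
move=> cphi bphi pphi; move: f; apply: Qalg_rect => [|f h _ _|h eh].
- exact: Qalg0.
- exact: QalgD.
- apply: elementary_Qalg; exact: elementary_pullback eh.
Qed.

Section Pushforward.
Variables (R : realType) (K H : top_groupoid) (psi : K -> H).
Hypotheses (hpsi : is_ghom psi) (ipsi : injective (unit_map hpsi)).
Implicit Types (f h : K -> R[i]) (B : set K).

Lemma psi_inj_dom k l : dom (psi k) = dom (psi l) -> dom k = dom l.
Proof.
move=> kl; have : dom0 k = dom0 l.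
  by apply: ipsi; apply: val_inj; rewrite /= !(ghom_dom hpsi).
by move=> /(congr1 val).
Qed.

Lemma psi_inj_rng k l : rng (psi k) = rng (psi l) -> rng k = rng l.
Proof.
by rewrite -!dom_inv -!(ghom_inv hpsi) => /psi_inj_dom; rewrite !dom_inv.
Qed.

(** Injectivity on units reflects composability, without which the pushforward
    would not be multiplicative. *)
Lemma psi_comp k l : dom (psi k) = rng (psi l) -> dom k = rng l.
Proof.
by rewrite -(dom_inv (psi l)) -(ghom_inv hpsi) => /psi_inj_dom; rewrite dom_inv.
Qed.

Lemma slice_image B : slice B -> slice (psi @` B).
Proof.
move=> [iB jB]; split=> _ _ [k Bk <-] [l Bl <-] kl; congr psi.
  by apply: iB => //; exact: psi_inj_dom.
by apply: jB => //; exact: psi_inj_rng.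
Qed.

(** On a slice, [psi] is injective because it is so on units: the sum that
    defines the pushforward has one term. *)
Lemma pushforward_carried B h k : slice B -> carried B h -> B k ->
  pushforward psi h (psi k) = h k.
Proof.
move=> [iB _] hB Bk; apply: fsum_single => // l /= lk ne.
by apply: hB => Bl; apply: ne; apply: iB => //; apply: psi_inj_dom; rewrite lk.
Qed.

Lemma pushforward_carried0 B h : carried B h ->
  carried (psi @` B) (pushforward psi h).
Proof.
move=> hB y ny; apply: fsum0 => k /= ky; apply: hB => Bk; apply: ny.
by exists k.
Qed.

Lemma pushforwardD f1 f2 : dom_finite f1 -> dom_finite f2 ->
  pushforward psi (fun k => f1 k + f2 k) =
  fun y => pushforward psi f1 y + pushforward psi f2 y.
Proof.
have fin f y : dom_finite f -> finite_set ([set k | psi k = y] `&` [set k | f k != 0]).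
  move=> ff; have [[k0 k0y]|nk] := pselect (exists k, psi k = y).
    apply: sub_finite_set (ff (dom k0)) => k [/= ky fk]; split=> //.
    by apply: psi_inj_dom; rewrite ky k0y.
  by apply: (@sub_finite_set _ _ set0) => // k [ky _]; case: nk; exists k.
by move=> ff1 ff2; apply/funext => y; apply: fsumD; exact: fin.
Qed.

Lemma pushforwardZ (z : R[i]) f : pushforward psi (fun k => z * f k) =
  fun y => z * pushforward psi f y.
Proof. by apply/funext => y; rewrite /pushforward mulr_fsumr. Qed.

Lemma pushforward0 : pushforward psi (fun=> 0) = fun=> 0 :> R[i].
Proof. by apply/funext => y; apply: fsum0. Qed.

Lemma pushforward_conv_carried B1 B2 h1 h2 : slice B1 -> slice B2 ->
  carried B1 h1 -> carried B2 h2 ->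
  pushforward psi (convolution h1 h2) =
  convolution (pushforward psi h1) (pushforward psi h2).
Proof.
move=> s1 s2 c1 c2; apply/funext => y.
have p1 := pushforward_carried0 c1; have p2 := pushforward_carried0 c2.
have c12 := conv_carried0 c1 c2.
have [[_ [[a [b [Ba Bb ab <-]]] <-]]|ny] :=
    pselect (exists k, slice_mul B1 B2 k /\ psi k = y).
  rewrite (pushforward_carried (slice_mulP s1 s2) c12); last by exists a, b.
  have pab : dom (psi a) = rng (psi b).
    by rewrite -(ghom_dom hpsi) -(ghom_rng hpsi) ab.
  rewrite (conv_carried s1 c1 c2 s2) // (ghom_mul hpsi) //.
  rewrite (conv_carried (slice_image s1) p1 p2 (slice_image s2)) //.
  by rewrite (pushforward_carried s1 c1 Ba) (pushforward_carried s2 c2 Bb).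
rewrite (pushforward_carried0 c12); last by move=> [k kB ky]; apply: ny; exists k.
rewrite (conv_carried0 p1 p2) //.
move=> [_ [_ [[a Ba <-] [b Bb <-] pab pE]]]; apply: ny; exists (mul a b).
have ab := psi_comp pab; split; first by exists a, b.
by rewrite (ghom_mul hpsi).
Qed.

Lemma pushforward_involution_carried B h : slice B -> carried B h ->
  pushforward psi (involution h) = involution (pushforward psi h).
Proof.
move=> sB hB; apply/funext => y.
have [[k Bk ky]|ny] := pselect ((psi @` B) (inv y)).
  have yE : y = psi (inv k) by rewrite (ghom_inv hpsi) ky ginvK.
  rewrite {1}yE (pushforward_carried (slice_invP sB) (involution_carried hB)).
    by rewrite /involution -ky ginvK (pushforward_carried sB hB).
  by rewrite /slice_inv /= ginvK.
rewrite /involution (pushforward_carried0 hB) // conjC0.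
apply: (pushforward_carried0 (involution_carried hB)) => -[k Bk ky]; apply: ny.
by exists (inv k) => //; rewrite (ghom_inv hpsi) ky.
Qed.

End Pushforward.

Section PushforwardTopology.
Variables (R : realType) (K H : etale_groupoid) (psi : K -> H).
Hypotheses (hpsi : is_ghom psi) (cpsi : continuous psi).
Hypotheses (opsi : open_map (unit_map hpsi)) (ipsi : injective (unit_map hpsi)).

(** As [psi] lies over the open map of unit spaces, and both domain maps are
    local homeomorphisms, it is itself open. *)
Lemma psi_nbhs k N : nbhs k N -> nbhs (psi k) (psi @` N).
Proof.
move=> kN; have [V [oV iV _] Vk] := bisection_nbhs (psi k).
have kNV : nbhs k (N `&` psi @^-1` V).
  by apply: filterI => //; apply: cpsi; exact: open_nbhs_nbhs.
have := dom0_nbhs kNV; rewrite nbhsE => -[W [oW Wk] WN].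
have oW' := opsi oW.
have W'k : nbhs (psi k) (@dom0 H @^-1` (unit_map hpsi @` W)).
  apply: dom0_continuous; apply: open_nbhs_nbhs; split=> //.
  by exists (dom0 k) => //; apply: val_inj; rewrite /= (ghom_dom hpsi).
apply: filterS2 (open_nbhs_nbhs (conj oV Vk)) W'k => v Vv [w /WN[l [Nl Vl] lw]].
move=> /(congr1 val) /= wv; exists l => //; apply: iV => //.
by rewrite -wv -lw /= (ghom_dom hpsi).
Qed.

Lemma elementary_pushforward (h : K -> R[i]) : elementary h ->
  elementary (pushforward psi h).
Proof.
move=> [B [S [bB SB Sh]]]; have sB := bisection_slice bB.
have hB := supported_on_carried SB Sh; have [oB _ _] := bB.
have [i' j'] := slice_image ipsi sB.
exists (psi @` B), (psi @` S); split.
- split=> //; apply: open_map_local_at => k Bk.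
  by apply: psi_nbhs; exact: open_nbhs_nbhs.
- by move=> _ [s Ss <-]; exists s => //; exact: SB.
have [cS hS h0] := Sh; split.
- by apply: continuous_compact => //; exact: continuous_subspaceT.
- move=> _ [s Ss <-].
  apply: (@continuous_at_lim _ _ _ _ (h s)); last first.
    by rewrite (pushforward_carried ipsi sB hB) //; exact: SB.
  move=> N hN; have sN : nbhs s (B `&` h @^-1` N).
    apply: filterI; first by apply: open_nbhs_nbhs; split=> //; exact: SB.
    exact: hS.
  apply: filterS (psi_nbhs sN) => _ [k [Bk Nk] <-].
  by rewrite /preimage /= (pushforward_carried ipsi sB hB).
- apply: pushforward_carried0 => k; exact: h0.
Qed.

End PushforwardTopology.

Section QalgPushforward.
Variables (R : realType) (K H : lcH_groupoid) (psi : K -> H).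
Hypotheses (hpsi : is_ghom psi) (cpsi : continuous psi).
Hypotheses (opsi : open_map (unit_map hpsi)) (ipsi : injective (unit_map hpsi)).
Implicit Types (f : K -> R[i]).

Lemma Qalg_pushforward f : Qalg f -> Qalg (pushforward psi f).
Proof.
move: f; apply: Qalg_rect => [|f h Qf Qh Pf Ph|h eh].
- by rewrite pushforward0; exact: Qalg0.
- rewrite (pushforwardD ipsi); try exact: Qalg_dom_finite.
  exact: QalgD.
- by apply: elementary_Qalg; exact: elementary_pushforward eh.
Qed.

Lemma pushforward_conv f1 f2 : Qalg f1 -> Qalg f2 ->
  pushforward psi (convolution f1 f2) =
  convolution (pushforward psi f1) (pushforward psi f2).
Proof.
have df := Qalg_dom_finite; have rf := Qalg_rng_finite.
move=> Q1; move: f2; apply: Qalg_rect => [|f h Qf Qh IHf IHh|f2 e2].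
- by rewrite conv0r pushforward0 conv0r.
- rewrite (convDr _ _ (rf _ _ _ Q1)) (pushforwardD ipsi) ?IHf ?IHh; last 2 first.
  + by apply: df; exact: Qalg_conv.
  + by apply: df; exact: Qalg_conv.
  rewrite (pushforwardD ipsi (df _ _ _ Qf) (df _ _ _ Qh)).
  by rewrite (convDr _ _ (rf _ _ _ (Qalg_pushforward Q1))).
have Q2 := elementary_Qalg e2; move: f1 Q1.
apply: Qalg_rect => [|f h Qf Qh IHf IHh|f1 [B1 [S1 [b1 SB1 Sh1]]]].
- by rewrite conv0l pushforward0 conv0l.
- rewrite (convDl _ _ (df _ _ _ Q2)) (pushforwardD ipsi) ?IHf ?IHh; last 2 first.
  + by apply: df; exact: Qalg_conv.
  + by apply: df; exact: Qalg_conv.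
  rewrite (pushforwardD ipsi (df _ _ _ Qf) (df _ _ _ Qh)).
  by rewrite (convDl _ _ (df _ _ _ (Qalg_pushforward Q2))).
have [B2 [S2 [b2 SB2 Sh2]]] := e2.
by apply: (pushforward_conv_carried ipsi (bisection_slice b1) (bisection_slice b2));
  [exact: supported_on_carried Sh1|exact: supported_on_carried Sh2].
Qed.

Lemma pushforward_involution f : Qalg f ->
  pushforward psi (involution f) = involution (pushforward psi f).
Proof.
have df := Qalg_dom_finite.
move: f; apply: Qalg_rect => [|f h Qf Qh IHf IHh|f [B [S [bB SB Sh]]]].
- by rewrite involution0 pushforward0 involution0.
- rewrite involutionD (pushforwardD ipsi) ?IHf ?IHh; last 2 first.
  + by apply: df; exact: Qalg_involution.
  + by apply: df; exact: Qalg_involution.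
  by rewrite (pushforwardD ipsi (df _ _ _ Qf) (df _ _ _ Qh)) involutionD.
apply: (pushforward_involution_carried ipsi (bisection_slice bB)).
exact: supported_on_carried Sh.
Qed.

End QalgPushforward.

(** * Suprema of C*-seminorms and positive functionals *)

Section SupSeminorm.
Variables (R : realType) (A : star_algebra R).
Hypothesis bounded : forall a : A, exists M,
  forall p : A -> R, cstar_seminorm p -> p a <= M.

Definition sup_csn (a : A) : R :=
  sup [set r | exists p : A -> R, cstar_seminorm p /\ r = p a].

Lemma cstar_seminorm0 : @cstar_seminorm R A (fun=> 0).
Proof.
split=> *; rewrite ?addr0 ?mulr0 ?mul0r // expr2 mulr0 //.
Qed.

Lemma sup_csn_ge p a : cstar_seminorm p -> p a <= sup_csn a.
Proof.
move=> pC; apply: ub_le_sup; last by exists p.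
by have [M pM] := bounded a; exists M => _ [q [qC ->]]; exact: pM.
Qed.

Lemma sup_csn_le a M : (forall p, cstar_seminorm p -> p a <= M) -> sup_csn a <= M.
Proof.
move=> pM; apply: ge_sup; last by move=> _ [p [pC ->]]; exact: pM.
by exists 0, (fun=> 0); split=> //; exact: cstar_seminorm0.
Qed.

Lemma sup_csn_ge0 a : 0 <= sup_csn a.
Proof. exact: (sup_csn_ge a cstar_seminorm0). Qed.

Lemma sup_csnP : cstar_seminorm sup_csn.
Proof.
split=> [x y|z x|x y|x].
- apply: sup_csn_le => p pC; apply: le_trans (csnD pC _ _) _.
  by apply: lerD; exact: sup_csn_ge.
- have z0 := rnorm_ge0 z; apply/le_anti/andP; split.
    apply: sup_csn_le => p pC; rewrite (csnZ pC).
    by apply: ler_wpM2l => //; exact: sup_csn_ge.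
  have [->|rz] := eqVneq (rnorm z) 0; first by rewrite mul0r sup_csn_ge0.
  have {z0 rz}z0 : 0 < rnorm z by rewrite lt_neqAle eq_sym rz.
  rewrite -ler_pdivlMl //; apply: sup_csn_le => p pC.
  by rewrite ler_pdivlMl // -(csnZ pC); exact: sup_csn_ge.
- apply: sup_csn_le => p pC; apply: le_trans (csnM pC _ _) _.
  by apply: ler_pM; rewrite ?(csn_ge0 pC) ?sup_csn_ge.
- apply/le_anti/andP; split.
    apply: sup_csn_le => p pC; rewrite (csn_star pC).
    by rewrite ler_pXn2r ?nnegrE ?(csn_ge0 pC) ?sup_csn_ge0 ?sup_csn_ge.
  rewrite -[leRHS]sqr_sqrtr ?sup_csn_ge0 //.
  rewrite ler_pXn2r ?nnegrE ?sqrtr_ge0 ?sup_csn_ge0 //.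
  apply: sup_csn_le => p pC; rewrite -[leLHS](ger0_norm (csn_ge0 pC _)).
  by rewrite -sqrtr_sqr -(csn_star pC) ler_wsqrtr // sup_csn_ge.
Qed.

End SupSeminorm.

(** The operator seminorm of the representation that a positive functional
    defines on the algebra itself, without forming a Hilbert space. *)
Section FunctionalSeminorm.
Variables (R : realType) (A : star_algebra R) (t : A -> R[i]).
Hypotheses (tD : forall x y, t (x + y) = t x + t y)
  (tZ : forall z x, t (z *: x) = z * t x)
  (t_star : forall x, t (sstar x) = (t x)^*)
  (t_ge0 : forall x, 0 <= t (smul (sstar x) x)).
Implicit Types a x y : A.

Let q x : R := complex.Re (t (smul (sstar x) x)).
Hypothesis bounded :
  forall a, exists M, forall x, q (smul a x) <= M * q x.

Let b x y : R := complex.Re (t (smul (sstar x) y)).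

Definition form_norm x : R := Num.sqrt (q x).

Lemma form_ge0 x : 0 <= q x.
Proof. by move: (t_ge0 x); rewrite lecE => /andP[]. Qed.

Lemma form_normK x : form_norm x ^+ 2 = q x.
Proof. exact/sqr_sqrtr/form_ge0. Qed.

Lemma formC x y : b x y = b y x.
Proof.
rewrite /b -[smul (sstar x) y]sstarK sstarM sstarK t_star.
by case: (t _).
Qed.

Lemma real_part_mulC (r : R) (z : R[i]) : complex.Re (real_complex R r * z) = r * complex.Re z.
Proof. by case: z => u v /=; rewrite mul0r subr0. Qed.

Lemma form_combination (r s : R) x y :
  q (real_complex R r *: x + real_complex R s *: y) =
  r ^+ 2 * q x + 2 * r * s * b x y + s ^+ 2 * q y.
Proof.
have cr (v : R) : (real_complex R v)^* = real_complex R v.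
  by apply: conj_Creal; apply/complex_realP; exists v.
have byx := formC y x; rewrite /b in byx.
rewrite /q sstarD !sstarZ !cr !(smulDl, smulDr) !(smulZl, smulZr) !(tD, tZ).
rewrite !raddfD /= !real_part_mulC -/(b x y) byx -/(b x y); ring.
Qed.

(** Only the real part of the form is needed: its nonnegativity on real
    combinations of [x] and [y] gives the Cauchy-Schwarz inequality. *)
Lemma form_CS x y : b x y <= form_norm x * form_norm y.
Proof.
have Q r s := form_ge0 (real_complex R r *: x + real_complex R s *: y).
have {}Q r s : 0 <= r ^+ 2 * q x + 2 * r * s * b x y + s ^+ 2 * q y.
  by rewrite -form_combination.
have n1 := form_normK x; have n2 := form_normK y.
have s1 : 0 <= form_norm x := sqrtr_ge0 _.
have s2 : 0 <= form_norm y := sqrtr_ge0 _.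
have [bn|bp] := leP (b x y) 0; first by rewrite (le_trans bn) // mulr_ge0.
have qx : 0 < q x.
  rewrite lt_neqAle form_ge0 andbT eq_sym; apply/eqP => qx0.
  (* With these coefficients the form would take the value [-1]. *)
  have := Q ((q y + 1) / (2 * b x y)) (-1); rewrite qx0 mulr0 add0r.
  rewrite (_ : 2 * _ * -1 * b x y = - (q y + 1)); first by move=> h; lra.
  by field; rewrite gt_eqF.
have h : b x y ^+ 2 <= q x * q y.
  (* A multiple of the component of [y] orthogonal to [x]. *)
  have := Q (b x y) (- q x).
  rewrite (_ : _ + _ + _ = q x * (q x * q y - b x y ^+ 2)); last by ring.
  by rewrite pmulr_rge0 // subr_ge0.
rewrite -(ler_pXn2r (_ : 0 < 2)%N) // ?nnegrE ?mulr_ge0 ?(ltW bp) //.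
by rewrite exprMn n1 n2.
Qed.

Definition gns_seminorm a : R :=
  sup [set form_norm (smul a x) | x in [set x | q x <= 1]].

Lemma form0 : q 0 = 0.
Proof. by rewrite /q -(scale0r (0 : A)) smulZr tZ mul0r. Qed.

Lemma gns_has_sup a : has_sup [set form_norm (smul a x) | x in [set x | q x <= 1]].
Proof.
split; first by exists (form_norm (smul a 0)), 0 => //=; rewrite form0.
have [M aM] := bounded a; exists (Num.sqrt `|M|) => _ [x /= qx <-].
apply: ler_wsqrtr; apply: le_trans (aM x) _.
apply: le_trans (ler_wpM2r (form_ge0 x) (ler_norm M)) _.
by rewrite -[leRHS]mulr1 ler_wpM2l.
Qed.

Lemma gns_ge0 a : 0 <= gns_seminorm a.
Proof.
apply: le_trans (sqrtr_ge0 (q (smul a 0))) _.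
by apply: ub_le_sup; [exact: (gns_has_sup a).2|exists 0 => //=; rewrite form0].
Qed.

Lemma form_normZ (z : R[i]) x : form_norm (z *: x) = rnorm z * form_norm x.
Proof.
rewrite /form_norm; have -> : q (z *: x) = rnorm z ^+ 2 * q x.
  rewrite /q sstarZ smulZl smulZr !tZ mulrA -normCKC rnormE.
  by rewrite -rmorphXn /= real_part_mulC.
by rewrite sqrtrM ?sqr_ge0 // sqrtr_sqr ger0_norm ?rnorm_ge0.
Qed.

Lemma gns_bound a x : form_norm (smul a x) <= gns_seminorm a * form_norm x.
Proof.
have nx' : 0 <= form_norm x by exact: sqrtr_ge0.
have [nx0|nx] := leP (form_norm x) 0.
  have {nx' nx0}nx0 : form_norm x = 0 by apply/le_anti; rewrite nx0.
  have [M aM] := bounded a; rewrite nx0 mulr0.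
  have := aM x; rewrite -(form_normK x) nx0 expr0n mulr0 /= => h.
  by rewrite /form_norm -[leRHS]sqrtr0 ler_wsqrtr.
have rE : rnorm (real_complex R (form_norm x)^-1 : R[i]^o) = (form_norm x)^-1.
  by apply: complexI; rewrite -rnormE ger0_norm // ler0c invr_ge0 ltW.
rewrite -ler_pdivrMr // mulrC -[X in X * _]rE -form_normZ -smulZr.
apply: ub_le_sup; first exact: (gns_has_sup a).2.
exists (real_complex R (form_norm x)^-1 *: x) => //=.
rewrite -form_normK form_normZ rE mulVf ?gt_eqF // expr1n //.
Qed.

Lemma gns_le a M : 0 <= M -> (forall x, form_norm (smul a x) <= M * form_norm x) ->
  gns_seminorm a <= M.
Proof.
move=> M0 aM; apply: ge_sup; first exact: (gns_has_sup a).1.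
move=> _ [x /= qx <-]; apply: le_trans (aM x) _.
rewrite -[leRHS]mulr1 ler_wpM2l // -[leRHS]sqrtr1; exact: ler_wsqrtr.
Qed.

Lemma form_normD x y : form_norm (x + y) <= form_norm x + form_norm y.
Proof.
have := form_combination 1 1 x y; rewrite !scale1r => e.
rewrite -(ler_pXn2r (_ : 0 < 2)%N) ?nnegrE ?addr_ge0 ?sqrtr_ge0 //.
rewrite form_normK e sqrrD !form_normK; have := form_CS x y; lra.
Qed.

Lemma form_adjoint a x : q (smul a x) = b x (smul (smul (sstar a) a) x).
Proof. by rewrite /q /b sstarM !smulA. Qed.

Lemma form_normM_star a x :
  form_norm (smul a x) ^+ 2 <= form_norm x * form_norm (smul (smul (sstar a) a) x).
Proof. by rewrite form_normK form_adjoint; exact: form_CS. Qed.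

(** [|a^* x| ^ 2 = <x, a a^* x> <= |x| p(a) |a^* x|], with [p] the operator
    seminorm. *)
Lemma gns_star_le a : gns_seminorm (sstar a) <= gns_seminorm a.
Proof.
apply: gns_le; first exact: gns_ge0.
move=> x; have := form_normM_star (sstar a) x; rewrite sstarK -smulA => h1.
have h2 := gns_bound a (smul (sstar a) x).
have n0 : 0 <= form_norm (smul (sstar a) x) := sqrtr_ge0 _.
have nx : 0 <= form_norm x := sqrtr_ge0 _.
have [n0'|{}n0] := leP (form_norm (smul (sstar a) x)) 0.
  by apply: le_trans n0' _; rewrite mulr_ge0 // gns_ge0.
rewrite -(ler_pM2r n0) -expr2; apply: (le_trans h1).
by apply: (le_trans (ler_wpM2l nx h2)); rewrite mulrCA mulrA.
Qed.

Lemma gns_seminormP : cstar_seminorm gns_seminorm.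
Proof.
have gM x y : gns_seminorm (smul x y) <= gns_seminorm x * gns_seminorm y.
  apply: gns_le; first by rewrite mulr_ge0 ?gns_ge0.
  move=> z; rewrite -smulA; apply: le_trans (gns_bound x _) _.
  by rewrite -mulrA ler_wpM2l ?gns_ge0 // gns_bound.
have gZ z x : gns_seminorm (z *: x) <= rnorm z * gns_seminorm x.
  apply: gns_le; first by rewrite mulr_ge0 ?rnorm_ge0 ?gns_ge0.
  by move=> y; rewrite smulZl form_normZ -mulrA ler_wpM2l ?rnorm_ge0 // gns_bound.
split=> [x y|z x||x] //.
- apply: gns_le; first by rewrite addr_ge0 ?gns_ge0.
  move=> z; rewrite smulDl; apply: le_trans (form_normD _ _) _.
  by rewrite mulrDl lerD // gns_bound.
- apply/le_anti/andP; split; first exact: gZ.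
  have [->|z0] := eqVneq z 0; first by rewrite rnorm0 mul0r gns_ge0.
  have rz : 0 < rnorm z.
    rewrite lt_neqAle rnorm_ge0 andbT eq_sym; apply: contraNneq z0 => /rnorm0_eq0 ->.
    by rewrite eqxx.
  have := gZ z^-1 (z *: x); rewrite scalerA mulVf // scale1r.
  rewrite (_ : rnorm z^-1 = (rnorm z)^-1) ?ler_pdivlMl //.
  by apply: complexI; rewrite -rnormE normfV rnormE fmorphV.
- apply/le_anti/andP; split.
    by rewrite expr2 (le_trans (gM _ _)) // ler_wpM2r ?gns_ge0 // gns_star_le.
  rewrite -[leRHS]sqr_sqrtr ?gns_ge0 // ler_pXn2r ?nnegrE ?sqrtr_ge0 ?gns_ge0 //.
  apply: gns_le; first exact: sqrtr_ge0.
  move=> y; rewrite -(ler_pXn2r (_ : 0 < 2)%N) ?nnegrE ?mulr_ge0 ?sqrtr_ge0 //.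
  apply: le_trans (form_normM_star x y) _.
  rewrite exprMn sqr_sqrtr ?gns_ge0 // mulrC expr2 mulrA.
  by rewrite ler_wpM2r ?sqrtr_ge0 // gns_bound.
Qed.

End FunctionalSeminorm.

(** * A bound for all C*-seminorms on the convolution algebra *)

Section GroupoidAlgebra.
Variables (R : realType) (G : lcH_groupoid).

Definition Qpred : {pred (G -> R[i])} := fun f => `[< Qalg f >].

Lemma QpredP (f : G -> R[i]) : reflect (Qalg f) (f \in Qpred).
Proof. exact: asboolP. Qed.

Lemma Qpred_submod : submod_closed Qpred.
Proof.
split; first exact/QpredP/Qalg0.
by move=> z f h /QpredP Qf /QpredP Qh; apply/QpredP/QalgD => //; exact: QalgZ.
Qed.

HB.instance Definition _ :=
  GRing.isSubmodClosed.Build R[i] (G -> R[i]) Qpred Qpred_submod.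

Definition Qtype := {f : G -> R[i] | f \in Qpred}.
HB.instance Definition _ := SubChoice.on Qtype.
HB.instance Definition _ := [SubChoice_isSubLmodule of Qtype by <:].

Definition Qin f (Qf : Qalg f) : Qtype := exist (fun h => h \in Qpred) f (introT (QpredP f) Qf).

Lemma QtypeP (f : Qtype) : Qalg (val f).
Proof. exact/QpredP/valP. Qed.

Definition Qmul (f h : Qtype) : Qtype := Qin (Qalg_conv (QtypeP f) (QtypeP h)).
Definition Qstar (f : Qtype) : Qtype := Qin (Qalg_involution (QtypeP f)).

Lemma QmulA : associative Qmul.
Proof. by move=> f h k; apply: val_inj; rewrite /= convolutionA //; exact: QtypeP. Qed.

Lemma QmulDl : left_distributive Qmul +%R.
Proof.
move=> f h k; apply: val_inj; rewrite /=; apply: convDl.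
exact/Qalg_dom_finite/QtypeP.
Qed.

Lemma QmulDr : right_distributive Qmul +%R.
Proof.
move=> f h k; apply: val_inj; rewrite /=; apply: convDr.
exact/Qalg_rng_finite/QtypeP.
Qed.

Lemma QmulZl (z : R[i]) f h : Qmul (z *: f) h = z *: Qmul f h.
Proof. by apply: val_inj; exact: convZl. Qed.

Lemma QmulZr (z : R[i]) f h : Qmul f (z *: h) = z *: Qmul f h.
Proof. by apply: val_inj; exact: convZr. Qed.

Lemma QstarK : involutive Qstar.
Proof. by move=> f; apply: val_inj; exact: involutionK. Qed.

Lemma QstarD : {morph Qstar : f h / f + h}.
Proof. by move=> f h; apply: val_inj; exact: involutionD. Qed.

Lemma QstarZ (z : R[i]) f : Qstar (z *: f) = z^* *: Qstar f.
Proof. by apply: val_inj; apply/funext => g; rewrite /= /involution rmorphM. Qed.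

Lemma QstarM f h : Qstar (Qmul f h) = Qmul (Qstar h) (Qstar f).
Proof. by apply: val_inj; apply: involution_conv; exact: QtypeP. Qed.

Definition Qstar_algebra : star_algebra R :=
  StarAlgebra QmulA QmulDl QmulDr QmulZl QmulZr QstarK QstarD QstarZ QstarM.

End GroupoidAlgebra.

Section UnitFunctions.
Variables (R : realType) (G : top_groupoid).
Implicit Types (f h c : G -> R[i]) (g k : G).

Lemma conv_unitl c h k : carried (units G) c ->
  convolution c h k = c (rng k) * h k.
Proof.
move=> cu; rewrite /convolution.
rewrite (@fsum_single _ _ _ (fun p => c p.1 * h p.2) (rng k, k)) //=.
  by rewrite dom_rng gmul1.
move=> [a b] /= [ab abk] ne.
have [/unitsP au|/cu ->] := pselect (units G a); last by rewrite mul0r.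
case: ne; have ra : a = rng b by rewrite -ab au.
have bk : b = k by rewrite -abk ra gmul1.
by rewrite ra bk.
Qed.

Lemma conv_unitr c h k : carried (units G) c ->
  convolution h c k = h k * c (dom k).
Proof.
move=> cu; rewrite /convolution.
rewrite (@fsum_single _ _ _ (fun p => h p.1 * c p.2) (k, dom k)) //=.
  by rewrite rng_dom gmulr1.
move=> [a b] /= [ab abk] ne.
have [/unitsP bu|/cu ->] := pselect (units G b); last by rewrite mulr0.
case: ne; have ra : b = dom a by rewrite ab dom_unitE.
have bk : a = k by rewrite -abk ra gmulr1.
by rewrite ra bk.
Qed.

Lemma star_conv_carried (B : set G) h b : slice B -> carried B h -> B b ->
  convolution (involution h) h (dom b) = `|h b| ^+ 2.
Proof.
move=> sB hB Bb.
rewrite -gmulV (conv_carried (slice_invP sB) (involution_carried hB) hB sB) //.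
- by rewrite /involution ginvK normCKC.
- by rewrite /slice_inv /= ginvK.
- exact: dom_inv.
Qed.

Lemma star_conv_carried0 (B : set G) h : slice B -> carried B h ->
  carried (@dom G @` B) (convolution (involution h) h).
Proof.
move=> [_ jB] hB g ng; apply: (conv_carried0 (involution_carried hB) hB).
move=> [a [b [Ba Bb ab abg]]]; apply: ng; exists b => //.
have ba : inv a = b by apply: jB => //; rewrite rng_inv.
by rewrite -abg -ba dom_inv gmulrV.
Qed.

End UnitFunctions.

Section ElementaryBound.
Variables (R : realType) (G : lcH_groupoid).
Implicit Types (f h c : G -> R[i]) (g k : G).

(** Near [dom s], the value at a unit [g] is that of [|h| ^ 2] at the arrow of
    [B] with domain [g]. *)
Lemma star_conv_supported (B S : set G) h : bisection B -> S `<=` B ->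
  supported_on S h ->
  supported_on (@dom G @` S) (convolution (involution h) h).
Proof.
move=> bB SB Sh; have [cS hS h0] := Sh; have sB := bisection_slice bB.
have hB := supported_on_carried SB Sh; split.
- apply: continuous_compact => //; apply: continuous_subspaceT.
  exact: dom_continuous.
- move=> _ [s Ss <-]; have Bs := SB _ Ss.
  have ds : dom s = dom (dom s) by rewrite dom_dom.
  have cs := local_section_cvg bB Bs ds; have ns := local_section_near bB Bs ds.
  have hs : (fun g => h (local_section B g)) @ dom s --> h s.
    exact: (cvg_comp _ _ cs (hS _ Ss)).
  apply: (@continuous_at_lim _ _ _ _ ((h s)^* * h s)); last first.
    by rewrite (star_conv_carried sB hB Bs) normCKC.
  apply: cvg_trans (cvgMC (cvg_conjC hs) hs); apply: near_eq_cvg.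
  have us : nbhs (dom s) (units G).
    by apply: open_nbhs_nbhs; split; [exact: open_units|exists s].
  apply: filterS2 ns us => g [c Bc cg] /unitsP gu.
  have [Bs' sg] := local_sectionP Bc cg.
  by rewrite -normCKC -(star_conv_carried sB hB Bs') sg gu.
- move=> g nS; have [[b Bb bg]|] := pselect ((@dom G @` B) g); last first.
    exact: star_conv_carried0.
  rewrite -bg (star_conv_carried sB hB Bb) h0 ?normr0 ?expr0n //.
  by move=> Sb; apply: nS; exists b.
Qed.

Lemma supported_on_units (S : set G) f : S `<=` units G -> supported_on S f ->
  elementary f.
Proof. by move=> SU Sf; exists (units G), S; split=> //; exact: bisection_units. Qed.

Lemma star_conv_range (B : set G) h (M : R) g : slice B -> carried B h ->
  0 <= M -> (forall k, rnorm (h k) <= M) ->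
  exists2 r, convolution (involution h) h g = real_complex R r & 0 <= r <= M ^+ 2.
Proof.
move=> sB hB M0 hM.
have [[b Bb <-]|ng] := pselect ((@dom G @` B) g); last first.
  by exists 0; [rewrite (star_conv_carried0 sB hB)|rewrite lexx exprn_ge0].
exists (rnorm (h b) ^+ 2).
  by rewrite (star_conv_carried sB hB) // rnormE rmorphXn.
by rewrite exprn_ge0 ?rnorm_ge0 //= ler_pXn2r ?nnegrE ?rnorm_ge0.
Qed.

(** For real [w] in [[0, N]], the point with real part [w] on the circle with
    diameter [[0, N]]; its squared modulus is [N w]. *)
Definition half_circle (N : R) (w : R[i]) : R[i] :=
  w + 'i * real_complex R (Num.sqrt (complex.Re w * (N - complex.Re w))).

Lemma half_circle0 N : half_circle N 0 = 0.
Proof. by rewrite /half_circle /= mul0r sqrtr0 rmorph0 mulr0 addr0. Qed.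

Lemma cvg_half_circle N (T : Type) (F : set_system T) {FF : Filter F}
    (f : T -> R[i]) (a : R[i]) :
  f @ F --> a -> (fun t => half_circle N (f t)) @ F --> half_circle N a.
Proof.
move=> fa; have ra := @cvg_Re R T F FF f a fa.
have na : (fun t => N - complex.Re (f t)) @ F --> N - complex.Re a.
  have Nc : (fun=> N) @ F --> N by exact: cvg_cst.
  exact: (@cvgB _ R^o _ F _ (fun=> N) (fun t => complex.Re (f t)) _ _ Nc ra).
have sa : (fun t => Num.sqrt (complex.Re (f t) * (N - complex.Re (f t)))) @ F -->
    Num.sqrt (complex.Re a * (N - complex.Re a)).
  apply: (cvg_comp _ _ (cvgM ra na)); exact: sqrt_continuous.
have ic : (fun=> 'i : R[i]) @ F --> ('i : R[i]) by exact: cvg_cst.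
exact: (cvgDC fa (cvgMC ic (cvg_real_complex sa))).
Qed.

Lemma half_circle_norm (N r : R) : 0 <= r <= N ->
  (half_circle N (real_complex R r))^* * half_circle N (real_complex R r) =
  real_complex R (N * r).
Proof.
move=> /andP[r0 rN]; rewrite -normCKC /half_circle /=.
set s := Num.sqrt _.
have s2 : s ^+ 2 = r * (N - r) by rewrite sqr_sqrtr // mulr_ge0 // subr_ge0.
rewrite normC2_rect; try by apply/complex_realP; eexists.
by rewrite -!rmorphXn -rmorphD /= s2; congr (real_complex R _); ring.
Qed.

Lemma half_circle_Re (N r : R) :
  half_circle N (real_complex R r) + (half_circle N (real_complex R r))^* =
  2 * real_complex R r.
Proof.
rewrite /half_circle /= rmorphD rmorphM /= conjCi mulNr.
have cr (v : R) : (real_complex R v)^* = real_complex R v.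
  by apply: conj_Creal; apply/complex_realP; exists v.
by rewrite !cr addrACA subrr addr0 -mulr2n mulr_natl.
Qed.

(** With [f = h^* h], a function on the units with values in [[0, N]], the
    function [z = half_circle N f] satisfies [z^* z = N f] and
    [f = (z + z^* ) / 2], so that [p f ^ 2 <= p z ^ 2 = N p f]. *)
Lemma elementary_csn_le (M : R) (h : G -> R[i]) (Qh : Qalg h) :
  elementary h -> 0 <= M -> (forall g, rnorm (h g) <= M) ->
  forall p : Qstar_algebra R G -> R, cstar_seminorm p -> p (Qin Qh) <= M.
Proof.
move=> [B [S [bB SB Sh]]] M0 hM p pC; have sB := bisection_slice bB.
have hB := supported_on_carried SB Sh; pose N := M ^+ 2.
set a : Qstar_algebra R G := Qin Qh.
pose f := convolution (involution h) h.
have Sf : supported_on (@dom G @` S) f by exact: star_conv_supported bB SB Sh.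
have SU : @dom G @` S `<=` units G by move=> _ [s _ <-]; exists s.
have fU := supported_on_carried SU Sf.
have fE g : exists2 r, f g = real_complex R r & 0 <= r <= N.
  exact: star_conv_range sB hB M0 hM.
pose z g := half_circle N (f g).
have zU : carried (units G) z by move=> g /fU fg; rewrite /z fg half_circle0.
have Qz : Qalg z.
  apply: elementary_Qalg; apply: (supported_on_units SU).
  have [cS fS f0] := Sf; split=> [|g Sg|g /f0 fg]; first exact: cS.
    exact: (@cvg_half_circle N _ (nbhs g) _ f (f g) (fS _ Sg)).
  by rewrite /z fg half_circle0.
set za : Qstar_algebra R G := Qin Qz.
set fa : Qstar_algebra R G := smul (sstar a) a.
have zz : smul (sstar za) za = real_complex R N *: fa.
  apply: val_inj; apply/funext => g; rewrite /= conv_unitl; last first.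
    move=> k nk; rewrite /involution zU ?conjC0 // => ku; apply: nk.
    by rewrite -[k]ginvK inv_unit //; exact/unitsP.
  have [gu|ng] := pselect (units G g); last first.
    rewrite zU // mulr0; transitivity (real_complex R N * f g); last by [].
    by rewrite fU // mulr0.
  have {}gu := (unitsP g).1 gu.
  rewrite (dom_unitE gu) /involution inv_unit // /z.
  have [r fr r01] := fE g; transitivity (real_complex R N * f g); last by [].
  by rewrite fr half_circle_norm // rmorphM.
have zf : za + sstar za = 2 *: fa.
  apply: val_inj; apply/funext => g; transitivity (z g + (z (inv g))^*); first by [].
  transitivity (2 * f g); last by [].
  have [gu|ng] := pselect (units G g); last first.
    rewrite zU // zU; first by rewrite fU // conjC0 addr0 mulr0.
    by move=> iu; apply: ng; rewrite -[g]ginvK inv_unit //; exact/unitsP.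
  have {}gu := (unitsP g).1 gu; rewrite (inv_unit gu).
  by have [r fr r01] := fE g; rewrite /z fr half_circle_Re.
have rC (r : R) : 0 <= r -> rnorm (real_complex R r : R[i]^o) = r.
  by move=> r0; apply: complexI; rewrite -rnormE ger0_norm // ler0c.
have N0 : 0 <= N by exact: exprn_ge0.
have pz : p za ^+ 2 = N * p fa by rewrite -(csn_star pC) zz (csnZ pC) rC.
have pf : p fa <= p za.
  have := csnD pC za (sstar za); rewrite zf (csnZ pC) (csn_sstar pC).
  rewrite (_ : rnorm (2 : R[i]) = 2) => [h1|]; first lra.
  by apply: complexI; rewrite -rnormE normr_nat rmorph_nat.
have pa : p fa = p a ^+ 2 by rewrite -(csn_star pC).
have fa0 := csn_ge0 pC fa; have za0 := csn_ge0 pC za.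
have fN : p fa <= N by nra.
by rewrite -(ler_pXn2r (_ : 0 < 2)%N) ?nnegrE ?(csn_ge0 pC) // -pa.
Qed.

Lemma Qalg_csn_bounded (a : Qstar_algebra R G) : exists M,
  forall p : Qstar_algebra R G -> R, cstar_seminorm p -> p a <= M.
Proof.
suff H f : Qalg f -> exists M, forall p : Qstar_algebra R G -> R,
    cstar_seminorm p -> forall b : Qstar_algebra R G, val b = f -> p b <= M.
  by have [M aM] := H _ (QtypeP a); exists M => p pC; exact: aM.
move: f {a}; apply: Qalg_rect => [|f h Qf Qh [M1 fM] [M2 hM]|h eh].
- exists 0 => p pC b b0; rewrite (_ : b = 0) ?(csn0 pC) //; exact: val_inj.
- exists (M1 + M2) => p pC b bE.
  have -> : b = (Qin Qf : Qstar_algebra R G) + Qin Qh by exact: val_inj.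
  by apply: le_trans (csnD pC _ _) _; apply: lerD; [exact: fM|exact: hM].
- have [B [S [_ _ Sh]]] := eh; have [M M0 hM] := supported_on_bounded Sh.
  exists M => p pC b bE.
  have -> : b = Qin (elementary_Qalg eh) by exact: val_inj.
  exact: elementary_csn_le.
Qed.

End ElementaryBound.

(** * Faithfulness and the groupoid C*-algebra *)

Section UnitFunctional.
Variables (R : realType) (G : lcH_groupoid) (u : G).
Hypothesis uu : dom u = u.
Local Notation A := (Qstar_algebra R G).
Implicit Types a x y : A.

(** Evaluation at a unit [u] of the restriction to the units: the
    representation it defines is the regular representation on the arrows with
    domain [u]. *)
Definition unit_eval a : R[i] := val a u.

Lemma unit_eval_form x y : unit_eval (smul (sstar x) y) =
  \sum_(k \in [set k | dom k = u]) (val x k)^* * val y k.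
Proof.
rewrite /unit_eval /= convolutionE uu; apply: eq_fsbigr => k /set_mem/= ku.
rewrite /involution (_ : mul u (inv k) = inv k) ?ginvK //.
by rewrite -{1}ku -rng_inv gmul1.
Qed.

Lemma unit_fibre_finite x : finite_set [set k | dom k = u /\ val x k != 0].
Proof. exact: (Qalg_dom_finite (QtypeP x)). Qed.

Lemma unit_eval_ge0 x : 0 <= unit_eval (smul (sstar x) x).
Proof.
rewrite unit_eval_form; apply: fsumr_ge0 => k _.
by rewrite -normCKC exprn_ge0.
Qed.

Lemma unit_evalD x y : unit_eval (x + y) = unit_eval x + unit_eval y.
Proof. by []. Qed.

Lemma unit_evalZ (z : R[i]) x : unit_eval (z *: x) = z * unit_eval x.
Proof. by []. Qed.

Lemma unit_eval_star x : unit_eval (sstar x) = (unit_eval x)^*.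
Proof. by rewrite /unit_eval /= /involution inv_unit. Qed.

Let q x : R := complex.Re (unit_eval (smul (sstar x) x)).

(** [<h x, h x> = <x, (h^* h) x>], and [h^* h] is a function on the units with
    values in [[0, M ^ 2]]. *)
Lemma elementary_unit_bounded (h : G -> R[i]) (Qh : Qalg h) : elementary h ->
  exists M, forall x, q (smul (Qin Qh : A) x) <= M * q x.
Proof.
move=> [B [S [bB SB Sh]]]; have [M M0 hM] := supported_on_bounded Sh.
have sB := bisection_slice bB; have hB := supported_on_carried SB Sh.
pose f := convolution (involution h) h.
have fU : carried (units G) f.
  move=> g ng; apply: (star_conv_carried0 sB hB) => -[b _ bg]; apply: ng.
  by exists b.
exists (M ^+ 2) => x; set a : A := Qin Qh.
have e1 : unit_eval (smul (sstar (smul a x)) (smul a x)) =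
    \sum_(k \in [set k | dom k = u]) f (rng k) * ((val x k)^* * val x k).
  have -> : smul (sstar (smul a x)) (smul a x) =
      smul (sstar x) (smul (smul (sstar a) a) x) by rewrite sstarM !smulA.
  rewrite unit_eval_form; apply: eq_fsbigr => k _.
  by rewrite [val (smul _ x) k]conv_unitl // mulrCA.
suff : unit_eval (smul (sstar (smul a x)) (smul a x)) <=
    real_complex R (M ^+ 2) * unit_eval (smul (sstar x) x).
  by rewrite lecE real_part_mulC => /andP[].
rewrite e1 unit_eval_form mulr_fsumr; apply: ler_fsum => [||k _].
- apply: sub_finite_set (unit_fibre_finite x) => k [ku /= ne]; split=> //.
  by apply: contraNneq ne => ->; rewrite !mulr0.
- apply: sub_finite_set (unit_fibre_finite x) => k [ku /= ne]; split=> //.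
  by apply: contraNneq ne => ->; rewrite !mulr0.
- have [r fr /andP[r0 rM]] : exists2 r, f (rng k) = real_complex R r & 0 <= r <= M ^+ 2.
    exact: star_conv_range sB hB M0 hM.
  by rewrite fr ler_wpM2r ?lecR // -normCKC exprn_ge0.
Qed.

(** For a sum of two operators, use the parallelogram inequality. *)
Lemma unit_bounded a : exists M, forall x, q (smul a x) <= M * q x.
Proof.
suff H f : Qalg f -> exists M, forall b : A, val b = f ->
    forall x, q (smul b x) <= M * q x.
  by have [M aM] := H _ (QtypeP a); exists M; exact: aM.
move: f {a}; apply: Qalg_rect => [|f h Qf Qh [M1 fM] [M2 hM]|h eh].
- exists 0 => b b0 x; rewrite (_ : b = 0); last exact: val_inj.
  rewrite (_ : smul _ x = 0); last by rewrite -(scale0r (0 : A)) smulZl !scale0r.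
  by rewrite mul0r /q (form0 unit_evalZ).
- exists (2 * M1 + 2 * M2) => b bE x.
  have -> : b = (Qin Qf : A) + Qin Qh by exact: val_inj.
  set y := smul (Qin Qf : A) x; set z := smul (Qin Qh : A) x.
  rewrite smulDl -/y -/z.
  pose c : R := complex.Re (unit_eval (smul (sstar y) z)).
  have e1 : q (real_complex R 1 *: y + real_complex R 1 *: z) =
      1 ^+ 2 * q y + 2 * 1 * 1 * c + 1 ^+ 2 * q z.
    exact: (form_combination unit_evalD unit_evalZ unit_eval_star).
  have e2 : q (real_complex R 1 *: y + real_complex R (-1) *: z) =
      1 ^+ 2 * q y + 2 * 1 * -1 * c + (-1) ^+ 2 * q z.
    exact: (form_combination unit_evalD unit_evalZ unit_eval_star).
  have h0 : 0 <= q (real_complex R 1 *: y + real_complex R (-1) *: z).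
    exact: (form_ge0 unit_eval_ge0).
  have -> : y + z = real_complex R 1 *: y + real_complex R 1 *: z.
    by rewrite rmorph1 !scale1r.
  rewrite e1; rewrite {}e2 in h0.
  have := fM _ (erefl : val (Qin Qf : A) = f) x.
  have := hM _ (erefl : val (Qin Qh : A) = h) x.
  rewrite -/y -/z; lra.
- have [M hM] := elementary_unit_bounded (elementary_Qalg eh) eh.
  exists M => b bE; rewrite (_ : b = Qin (elementary_Qalg eh)) //; exact: val_inj.
Qed.

Definition unit_seminorm : A -> R := gns_seminorm unit_eval.

Lemma unit_seminormP : cstar_seminorm unit_seminorm.
Proof.
exact: (gns_seminormP unit_evalD unit_evalZ unit_eval_star unit_eval_ge0 unit_bounded).
Qed.

(** Apply [a] to a function on the units that is one at [u]: at an arrow with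
    domain [u] the result is the value of [a]. *)
Lemma unit_seminorm_neq0 a g : dom g = u -> val a g != 0 -> unit_seminorm a != 0.
Proof.
move=> gu ag; have Uu : units G u by apply/unitsP.
have [B [T [xi [bB TB BU Txi xi1]]]] := bisection_plateau R (open_units G) Uu.
have exi : elementary xi by exists B, T.
have xiU := supported_on_carried (subset_trans TB BU) Txi.
have xiu : xi u = 1 := nbhs_singleton xi1.
set x : A := Qin (elementary_Qalg exi); apply: contraNneq ag => a0.
have := gns_bound unit_evalZ unit_eval_ge0 unit_bounded a x.
rewrite -/(unit_seminorm a) a0 mul0r => n0.
have n1 : 0 <= form_norm unit_eval (smul a x) := sqrtr_ge0 _.
have q0 : q (smul a x) = 0.
  have -> : q (smul a x) = form_norm unit_eval (smul a x) ^+ 2.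
    exact/esym/(form_normK unit_eval_ge0).
  by rewrite (_ : form_norm _ _ = 0) ?expr0n //; apply/le_anti; rewrite n0.
have e0 : unit_eval (smul (sstar (smul a x)) (smul a x)) = 0.
  by rewrite -[LHS]RRe_real ?ger0_real ?unit_eval_ge0 // -/(q _) q0.
have ax : val (smul a x) g = val a g by rewrite /= conv_unitr // gu xiu mulr1.
have : `|val a g| ^+ 2 <= 0.
  rewrite -e0 unit_eval_form -ax normCKC.
  apply: (@fsum_ge_term _ _ [set k | dom k = u]
    (fun k => (val (smul a x) k)^* * val (smul a x) k)) => //.
    apply: sub_finite_set (unit_fibre_finite (smul a x)) => k [ku /= ne].
    by split=> //; apply: contraNneq ne => ->; rewrite mulr0.
  by move=> k _; rewrite -normCKC exprn_ge0.
move=> ag0; have : `|val a g| ^+ 2 = 0 by apply/le_anti; rewrite ag0 exprn_ge0.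
by move=> /eqP; rewrite sqrf_eq0 normr_eq0.
Qed.

End UnitFunctional.

Section GroupoidCstar.
Variables (R : realType) (G : lcH_groupoid).
Local Notation A := (Qstar_algebra R G).

(** The supremum of all C*-seminorms; it is finite by the uniform bound, and a
    norm because the regular representations separate functions. *)
Definition max_seminorm : cseminorm A :=
  Cseminorm (sup_csnP (@Qalg_csn_bounded R G)).

Lemma max_seminorm_ge (p : A -> R) : cstar_seminorm p ->
  forall a, p a <= max_seminorm a.
Proof. by move=> pC a; exact: (sup_csn_ge (@Qalg_csn_bounded R G) a pC). Qed.

Lemma max_seminorm_eq0 (a : A) : max_seminorm a = 0 -> a = 0.
Proof.
move=> a0; apply: val_inj; apply/funext => g; apply: contrapT => /eqP ag.
have du : dom (dom g) = dom g by exact: dom_dom.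
have /eqP[] := unit_seminorm_neq0 du erefl ag.
apply/le_anti; rewrite (csn_ge0 (unit_seminormP R du)) andbT -a0.
exact: (max_seminorm_ge (unit_seminormP R du)).
Qed.

Definition gcs_map (f : G -> R[i]) : completion max_seminorm :=
  if pselect (Qalg f) is left Qf then cpl_in max_seminorm (Qin Qf) else 0.

Lemma gcs_mapE f (Qf : Qalg f) : gcs_map f = cpl_in max_seminorm (Qin Qf).
Proof.
rewrite /gcs_map; case: pselect => // Qf'; congr cpl_in; exact: val_inj.
Qed.

Lemma gcs_map_val (a : A) : gcs_map (val a) = cpl_in max_seminorm a.
Proof. by rewrite (gcs_mapE (QtypeP a)); congr cpl_in; exact: val_inj. Qed.

Lemma gcs_map_hom : is_Q_hom gcs_map.
Proof.
split=> [f h Qf Qh|z f Qf|f h Qf Qh|f Qf].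
- rewrite (gcs_mapE (QalgD Qf Qh)) (gcs_mapE Qf) (gcs_mapE Qh).
  by rewrite -[RHS]cpl_inD; congr cpl_in; exact: val_inj.
- rewrite (gcs_mapE (QalgZ z Qf)) (gcs_mapE Qf).
  by rewrite -[RHS]cpl_inZ; congr cpl_in; exact: val_inj.
- rewrite (gcs_mapE (Qalg_conv Qf Qh)) (gcs_mapE Qf) (gcs_mapE Qh).
  by rewrite -cpl_inM; congr cpl_in; exact: val_inj.
- rewrite (gcs_mapE (Qalg_involution Qf)) (gcs_mapE Qf).
  by rewrite -cpl_in_star; congr cpl_in; exact: val_inj.
Qed.

Lemma gcs_map_inj f h : Qalg f -> Qalg h -> gcs_map f = gcs_map h -> f = h.
Proof.
move=> Qf Qh; rewrite (gcs_mapE Qf) (gcs_mapE Qh) => e.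
have : max_seminorm (Qin Qf - Qin Qh : A) = 0.
  by rewrite -rnorm_cpl_in cpl_inB e subrr rnorm0.
by move=> /max_seminorm_eq0/eqP; rewrite subr_eq0 => /eqP/(congr1 val).
Qed.

Lemma gcs_map_dense : closure [set gcs_map f | f in @Qalg R G] = setT.
Proof.
apply/seteqP; split=> // x _ N /nbhs_ballP[e /= e0 eN].
have eE : e = real_complex R (complex.Re e) by rewrite RRe_real // gtr0_real.
have e0' : 0 < complex.Re e by rewrite -ltcR -eE.
have [a xa] := cpl_in_dense x e0'.
exists (cpl_in max_seminorm a); split.
  by exists (val a); [exact: QtypeP|exact: gcs_map_val].
by apply: eN; rewrite -ball_normE /= rnormE eE ltcR.
Qed.

Lemma gcs_map_extend (B : cstar_algebra R) (rho : (G -> R[i]) -> B) :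
  is_Q_hom rho -> exists! r : star_hom (completion max_seminorm) B,
    forall f, Qalg f -> r (gcs_map f) = rho f.
Proof.
move=> [rD rZ rM rS].
have [r [rE ru]] := @completion_universal R A max_seminorm max_seminorm_ge B
  (fun a => rho (val a)) (fun a b => rD _ _ (QtypeP a) (QtypeP b))
  (fun z a => rZ z _ (QtypeP a)) (fun a b => rM _ _ (QtypeP a) (QtypeP b))
  (fun a => rS _ (QtypeP a)).
exists r; split=> [f Qf|s sE]; first by rewrite (gcs_mapE Qf) rE.
by apply: ru => a; rewrite -gcs_map_val sE //; exact: QtypeP.
Qed.

Definition full_groupoid_cstar : groupoid_cstar R G :=
  GroupoidCstar gcs_map_hom gcs_map_inj gcs_map_dense gcs_map_extend.

End GroupoidCstar.

(** * The functor *)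

Section ExtendQHom.
Variables (R : realType) (G : lcH_groupoid) (CG : groupoid_cstar R G).

(** Both sides extend the same *-homomorphism on [Qalg]. *)
Lemma gcs_hom_ext (B : cstar_algebra R) (r s : star_hom CG B) :
  (forall f, Qalg f -> r (gcs_in CG f) = s (gcs_in CG f)) -> r = s.
Proof.
move=> rs; have [iD iZ iM iS] := gcs_hom CG.
have hs : is_Q_hom (fun f => s (gcs_in CG f)).
  split=> [f h Qf Qh|z f Qf|f h Qf Qh|f Qf].
  - by rewrite iD // star_homD.
  - by rewrite iZ // star_homZ.
  - by rewrite iM // star_homM.
  - by rewrite iS // star_hom_star.
have [t [_ tU]] := @gcs_extend R G CG B _ hs.
by rewrite -(tU r) // -(tU s).
Qed.

End ExtendQHom.

Section InducedHoms.
Variables (R : realType) (K G H : lcH_groupoid).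
Variables (CK : groupoid_cstar R K) (CG : groupoid_cstar R G) (CH : groupoid_cstar R H).

Lemma pullback_star_hom (phi : K -> G) (hphi : is_ghom phi) : continuous phi ->
  fibrewise_bijective phi -> proper_map (unit_map hphi) ->
  exists s : star_hom CG CK, extends_pullback phi s.
Proof.
move=> cphi bphi pphi; have [iD iZ iM iS] := gcs_hom CK.
have Qp f (Qf : Qalg f) : Qalg (pullback phi f) := Qalg_pullback cphi bphi pphi Qf.
have hp : is_Q_hom (fun f : G -> R[i] => gcs_in CK (pullback phi f)).
  split=> [f h Qf Qh|z f Qf|f h Qf Qh|f Qf].
  - by rewrite -iD //; exact: Qp.
  - by rewrite -iZ //; exact: Qp.
  - by rewrite (pullback_conv hphi bphi) iM //; exact: Qp.
  - by rewrite (pullback_involution hphi) iS //; exact: Qp.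
have [s [sE _]] := @gcs_extend R G CG _ _ hp.
by exists s => f Qf; split; [exact: Qp|exact: sE].
Qed.

Lemma pushforward_star_hom (psi : K -> H) (hpsi : is_ghom psi) : continuous psi ->
  open_map (unit_map hpsi) -> injective (unit_map hpsi) ->
  exists r : star_hom CK CH, extends_pushforward psi r.
Proof.
move=> cpsi opsi ipsi; have [iD iZ iM iS] := gcs_hom CH.
have Qp f (Qf : Qalg f) : Qalg (pushforward psi f) :=
  Qalg_pushforward cpsi opsi ipsi Qf.
have df := Qalg_dom_finite.
have hp : is_Q_hom (fun f : K -> R[i] => gcs_in CH (pushforward psi f)).
  split=> [f h Qf Qh|z f Qf|f h Qf Qh|f Qf].
  - rewrite (pushforwardD ipsi (df _ _ _ Qf) (df _ _ _ Qh)).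
    by rewrite iD //; exact: Qp.
  - by rewrite pushforwardZ iZ //; exact: Qp.
  - by rewrite (pushforward_conv cpsi opsi ipsi) // iM //; exact: Qp.
  - by rewrite (pushforward_involution ipsi) // iS //; exact: Qp.
have [r [rE _]] := @gcs_extend R K CK _ _ hp.
by exists r => f Qf; split; [exact: Qp|exact: rE].
Qed.

End InducedHoms.

Section CoupleHom.
Variables (R : realType) (C : forall G : lcH_groupoid, groupoid_cstar R G).

Lemma couple_sigma_exists (G H : lcH_groupoid) (c : proper_couple G H) :
  exists s : star_hom (C G) (C (mid_lcH c)),
    @extends_pullback R (mid_lcH c) G _ _ (@lft _ _ c) s.
Proof.
exact: (pullback_star_hom (C (mid_lcH c)) (C G) (@lft_continuous _ _ c)
  (@lft_bijective _ _ c) (@pc_proper _ _ c)).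
Qed.

Lemma couple_pi_exists (G H : lcH_groupoid) (c : proper_couple G H) :
  exists r : star_hom (C (mid_lcH c)) (C H),
    @extends_pushforward R (mid_lcH c) H _ _ (@rgt _ _ c) r.
Proof.
exact: (@pushforward_star_hom R (mid_lcH c) H (C (mid_lcH c)) (C H) _ _
  (@rgt_continuous _ _ c) (@rgt_open _ _ c) (@rgt_injective _ _ c)).
Qed.

Definition couple_sigma (G H : lcH_groupoid) (c : proper_couple G H) :=
  sval (cid (couple_sigma_exists c)).
Definition couple_pi (G H : lcH_groupoid) (c : proper_couple G H) :=
  sval (cid (couple_pi_exists c)).

Definition couple_hom (G H : lcH_groupoid) (c : proper_couple G H) :
  star_hom (C G) (C H) := star_comp (couple_pi c) (couple_sigma c).

Definition couple_fun (G H : etale_groupoid) (c : couple G H) (f : G -> R[i]) :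
  H -> R[i] := pushforward (@rgt _ _ c) (pullback (@lft _ _ c) f).

Lemma couple_homE (G H : lcH_groupoid) (c : proper_couple G H) (f : G -> R[i]) :
  Qalg f -> Qalg (couple_fun c f) /\
    couple_hom c (gcs_in (C G) f) = gcs_in (C H) (couple_fun c f).
Proof.
move=> Qf; rewrite /couple_hom /= /couple_pi /couple_sigma.
case: cid => r rE; case: cid => s sE /=.
by have [Qs ->] := sE _ Qf; have [Qr ->] := rE _ Qs.
Qed.

(** The isomorphism of the middle groupoids reindexes the sum. *)
Lemma couple_fun_equiv (G H : etale_groupoid) (c c' : couple G H) f :
  couple_equiv c c' -> couple_fun c f = couple_fun c' f.
Proof.
move=> [iota [_ [j [ij ji _ _]] il ir]]; apply/funext => y.
rewrite /couple_fun /pushforward; apply/esym.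
rewrite (@reindex_fsbig _ _ _ _ _ iota [set k | rgt k = y]) //.
  by apply: eq_fsbigr => k _; rewrite /pullback /= il.
split=> [k /= ky|k l _ _|k /= ky]; first by rewrite ir.
  exact: (can_inj ij).
by exists (j k) => //=; rewrite -ir ji.
Qed.

Lemma couple_hom_equiv (G H : lcH_groupoid) (c c' : proper_couple G H) :
  couple_equiv c c' -> couple_hom c = couple_hom c'.
Proof.
move=> cc'; apply: gcs_hom_ext => f Qf.
have [_ ->] := couple_homE c Qf; have [_ ->] := couple_homE c' Qf.
by rewrite (couple_fun_equiv f cc').
Qed.

Lemma couple_hom_id (G : lcH_groupoid) : couple_hom (proper_couple_id G) = star_id (C G).
Proof.
apply: gcs_hom_ext => f Qf; have [_ ->] := couple_homE (proper_couple_id G) Qf.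
congr gcs_in; apply/funext => g; rewrite /couple_fun /pushforward /=.
by rewrite (@fsum_single _ _ _ _ g).
Qed.

(** Base change: both sides sum over the same fibre. *)
Lemma pullback_pushforward (K1 K2 G : top_groupoid) (a : K1 -> G) (b : K2 -> G)
    (ha : is_ghom a) (hb : is_ghom b) (f : K1 -> R[i]) :
  pullback b (pushforward a f) =
  pushforward (@fp_snd K1 K2 G a b ha hb) (pullback (@fp_fst K1 K2 G a b ha hb) f).
Proof.
apply/funext => k2; rewrite /pullback /pushforward /=.
rewrite (@reindex_fsbig _ _ _ _ _ (@fp_fst K1 K2 G a b ha hb)
  [set p | @fp_snd K1 K2 G a b ha hb p = k2]) //; split.
- by move=> p /= <-; exact: fpP.
- move=> p p' /set_mem /= pk /set_mem /= pk' pp'; apply: val_fp => //.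
  by rewrite -[(val p).2]/(fp_snd p) pk -pk'.
- by move=> k1 /= e; exists (fp_pair e : fibre_product ha hb).
Qed.

Lemma fp_snd_unit_injective (K1 K2 G : top_groupoid) (a : K1 -> G) (b : K2 -> G)
    (ha : is_ghom a) (hb : is_ghom b) : injective (unit_map ha) ->
  injective (unit_map (ghom_fp_snd ha hb)).
Proof.
move=> ia x y /(congr1 val)/= xy; apply: val_inj; apply: val_fp => //.
pose x1 := unit_map (ghom_fp_fst ha hb) x; pose y1 := unit_map (ghom_fp_fst ha hb) y.
suff : x1 = y1 by move=> /(congr1 val).
apply: ia; apply: val_inj; rewrite /= /fp_fst !fpP.
by congr b.
Qed.

(** On functions carried by a slice both sides move the values along the two
    maps; additivity gives the general case. *)
Lemma pushforward_comp (K L H : lcH_groupoid) (psi : K -> L) (chi : L -> H)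
    (hpsi : is_ghom psi) (hchi : is_ghom chi) (f : K -> R[i]) :
  continuous psi -> open_map (unit_map hpsi) ->
  injective (unit_map hpsi) -> injective (unit_map hchi) -> Qalg f ->
  pushforward chi (pushforward psi f) = pushforward (chi \o psi) f.
Proof.
move=> cpsi opsi ipsi ichi; have hc := ghom_comp hpsi hchi.
have ic : injective (unit_map hc).
  move=> x y /(congr1 val)/= e; apply: ipsi; apply: ichi; exact: val_inj.
have df := Qalg_dom_finite.
move: f; apply: Qalg_rect => [|f h Qf Qh IHf IHh|h eh].
- by rewrite !pushforward0.
- rewrite (pushforwardD ipsi (df _ _ _ Qf) (df _ _ _ Qh)).
  rewrite (pushforwardD ichi); try by apply: df; exact: Qalg_pushforward.
  by rewrite (pushforwardD ic (df _ _ _ Qf) (df _ _ _ Qh)) IHf IHh.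
have [B [S [bB SB Sh]]] := eh; have sB := bisection_slice bB.
have hB := supported_on_carried SB Sh.
have sB' := slice_image ipsi sB; have hB' := pushforward_carried0 hB (psi := psi).
apply/funext => y; have [[k Bk <-]|ny] := pselect (((chi \o psi) @` B) y).
  have B'k : (psi @` B) (psi k) by exists k.
  rewrite (pushforward_carried ic sB hB Bk) (pushforward_carried ichi sB' hB' B'k).
  exact: (pushforward_carried ipsi sB hB Bk).
rewrite (pushforward_carried0 hB) // (pushforward_carried0 hB') //.
by rewrite image_comp.
Qed.

Lemma couple_fun_comp (G1 G2 G3 : lcH_groupoid) (c1 : proper_couple G1 G2)
    (c2 : proper_couple G2 G3) (f : G1 -> R[i]) : Qalg f ->
  couple_fun (proper_couple_comp c1 c2) f = couple_fun c2 (couple_fun c1 f).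
Proof.
move=> Qf; pose c12 := proper_couple_comp c1 c2.
rewrite /couple_fun (pullback_pushforward (rgt_hom c1) (lft_hom c2)).
have Q12 : Qalg (pullback (@lft _ _ c12) f).
  exact: (@Qalg_pullback R (mid_lcH c12) G1 _ _ _ (@lft_continuous _ _ c12)
    (@lft_bijective _ _ c12) (@pc_proper _ _ c12) Qf).
apply/esym; apply: (@pushforward_comp (mid_lcH c12) (mid_lcH c2) G3 _ _
  (ghom_fp_snd (rgt_hom c1) (lft_hom c2)) (rgt_hom c2)) => //.
- exact: snd_val_continuous.
- exact: comp_snd_open.
- exact: fp_snd_unit_injective (@rgt_injective _ _ c1).
- exact: rgt_injective.
Qed.

Lemma couple_hom_comp (G1 G2 G3 : lcH_groupoid) (c1 : proper_couple G1 G2)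
    (c2 : proper_couple G2 G3) :
  couple_hom (proper_couple_comp c1 c2) = star_comp (couple_hom c2) (couple_hom c1).
Proof.
apply: gcs_hom_ext => f Qf.
have [Q1 E1] := couple_homE c1 Qf; have [_ E2] := couple_homE c2 Q1.
transitivity (gcs_in (C G3) (couple_fun (proper_couple_comp c1 c2) f)).
  exact: (couple_homE (proper_couple_comp c1 c2) Qf).2.
rewrite (couple_fun_comp c1 c2 Qf) -E2 -E1; reflexivity.
Qed.

(** A representative is chosen; equivalent couples give the same map. *)
Definition morphism_hom (G H : lcH_groupoid) (m : couple_morphism G H) :
  star_hom (C G) (C H) := couple_hom (sval (cid (mor_of_surj m))).

Lemma morphism_homE (G H : lcH_groupoid) (c : proper_couple G H) :
  morphism_hom (mor_of c) = couple_hom c.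
Proof.
rewrite /morphism_hom; case: cid => c' /= /mor_ofP cc'.
by apply: couple_hom_equiv; exact: couple_equiv_sym.
Qed.

End CoupleHom.

Theorem theorem6p9 (R : realType) :
  (forall G : lcH_groupoid, inhabited (groupoid_cstar R G)) /\
  forall C : (forall G : lcH_groupoid, groupoid_cstar R G),
  exists F : (forall G H : EG_lcH,
      @cat_hom EG_lcH G H ->
      @cat_hom (Cstar_alg R) (gcs_alg (C G)) (gcs_alg (C H))),
    @is_functor EG_lcH (Cstar_alg R) (fun G => gcs_alg (C G)) F /\
    forall (G H : lcH_groupoid) (c : proper_couple G H),
    exists (sigma_phi : star_hom (C G) (C (mid_lcH c)))
           (pi_psi : star_hom (C (mid_lcH c)) (C H)),
      [/\ @extends_pullback R (mid_lcH c) G _ _ (@lft _ _ c) sigma_phi,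
          @extends_pushforward R (mid_lcH c) H _ _ (@rgt _ _ c) pi_psi &
          F G H (mor_of c) = star_comp pi_psi sigma_phi].
Proof.
split=> [G|C]; first by split; exact: full_groupoid_cstar.
exists (@morphism_hom R C); split.
  split=> [G|G1 G2 G3 m2 m1].
    rewrite -[cat_id G]/(mor_of (proper_couple_id G)) morphism_homE.
    exact: couple_hom_id.
  have [c1 ->] := mor_of_surj m1; have [c2 ->] := mor_of_surj m2.
  rewrite -[cat_comp _ _]/(mor_comp (mor_of c2) (mor_of c1)) mor_compE.
  by rewrite !morphism_homE; exact: couple_hom_comp.
move=> G H c; exists (couple_sigma C c), (couple_pi C c); split.
- exact: svalP (cid (couple_sigma_exists C c)).
- exact: svalP (cid (couple_pi_exists C c)).
- exact: morphism_homE.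
Qed.
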